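(* Let $\varepsilon>0$, let $\nu$ be a probability measure on $\mathbb R^d$, let $\gamma^{\mathcal C}=\mathcal N(0,\mathcal C)$ be the centered Gaussian measure on $\mathbb R^d$ with covariance matrix $\mathcal C$, let $\pi_{\mathrm{H\&R}}$ be the transition kernel of Hit-and-Run with target measure $\gamma^{\mathcal C}$, and let $$\rho\ =\ \frac12\inf_{|\zeta|=1}\mathbb E_{v\sim\mathrm{Unif}(\mathbb S^{d-1})}\Bigl(\zeta\cdot\frac{\mathcal C^{-1/2}v}{|\mathcal C^{-1/2}v|}\Bigr)^2 .$$ Then there exist absolute constants $C,C'>0$ such that the mixing time of Hit-and-Run with respect to $\gamma^{\mathcal C}$, starting from $\nu$, to accuracy $\varepsilon$ satisfies $$\tau_{\operatorname{mix}}(\varepsilon,\nu)\ =\ \inf\bigl\{n\in\mathbb N:\ \mathsf{TV}\bigl(\nu\pi_{\mathrm{H\&R}}^n,\,\gamma^{\mathcal C}\bigr)\leq\varepsilon\bigr\}\ \leq\ C\,\rho^{-1}\,\log\Bigl(C'\max(\kappa,M,m^{-1})\,d\,\varepsilon^{-1}\,\boldsymbol{\mathcal W}^2_{\mathcal C^{-1/2}}(\gamma^{\mathcal C},\nu)\Bigr),$$ where $\kappa$, $M$, $m$ denote the condition number, the largest eigenvalue and the smallest eigenvalue of $\mathcal C^{-1}$.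
   Context: For $x\in\mathbb R^d$ and $v\in\mathbb S^{d-1}$ (the Euclidean unit sphere), let $\gamma^{\mathcal C}_{x,v}$ be the probability measure on $\mathbb R$ with density proportional to $h\mapsto\gamma^{\mathcal C}(x+hv)$, where $\gamma^{\mathcal C}(\cdot)$ denotes the Lebesgue density of $\mathcal N(0,\mathcal C)$; explicitly $\gamma^{\mathcal C}_{x,v}=\mathcal N\bigl(-\frac{x\cdot\mathcal C^{-1}v}{|\mathcal C^{-1/2}v|^2},\,|\mathcal C^{-1/2}v|^{-2}\bigr)$. The Hit-and-Run kernel is $$\pi_{\mathrm{H\&R}}(x,A)=\int_{\mathbb S^{d-1}}\int_{\mathbb R}1_A(x+hv)\,\gamma^{\mathcal C}_{x,v}(dh)\,\sigma_{d-1}(dv),$$ with $\sigma_{d-1}=\mathrm{Unif}(\mathbb S^{d-1})$ the uniform probability measure on the sphere. $\nu\pi_{\mathrm{H\&R}}^n$ denotes the law after $n$ steps started from $\nu$. $\mathsf{TV}$ is the total variation distance between probability measures. $|\cdot|$ is the Euclidean norm, $\cdot$ the Euclidean inner product, and $|x|_{\mathcal C^{-1/2}}=|\mathcal C^{-1/2}x|$. $\boldsymbol{\mathcal W}^2_{\mathcal C^{-1/2}}(\eta,\nu)=\inf\bigl(\mathbb E|X-\tilde X|^2_{\mathcal C^{-1/2}}\bigr)^{1/2}$, the infimum being over all couplings $(X,\tilde X)$ of $\eta$ and $\nu$, is the $L^2$-Wasserstein distance with respect to the metric induced by $|\cdot|_{\mathcal C^{-1/2}}$ (the superscript 2 is part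 of the notation, not a square). ''Absolute constants'' means numerical constants not depending on the other quantities.
   Formalization: The logarithm on the right is replaced by max(1, log(...)): as written the bound fails when the argument of the log is small, e.g. for ν = γ^C, where the Wasserstein distance is 0 and the right-hand side is −∞ while the mixing time is 0. *)

(* Defs.v *)
From HB Require Import structures.
From mathcomp Require Import all_boot all_order all_algebra.
From mathcomp Require Import all_classical all_reals all_analysis.
From mathcomp Require Import measurable_realfun.

Set Implicit Arguments.
Unset Strict Implicit.
Unset Printing Implicit Defensive.

Import Order.TTheory GRing.Theory Num.Theory.
Import numFieldNormedType.Exports.

Local Open Scope classical_set_scope.
Local Open Scope ring_scope.

(* The Borel sigma-algebra of R^n, generated by the coordinate maps. *)
Section measurable_colvec.
Context (R : realType) (n : nat).

Let coord (i : 'I_n) (x : 'cV[R]_n) : R := x i ord0.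

Let cV_set0 : g_sigma_preimage coord set0.
Proof. exact: sigma_algebra0. Qed.

Let cV_setC A : g_sigma_preimage coord A -> g_sigma_preimage coord (~` A).
Proof. exact: sigma_algebraC. Qed.

Let cV_bigcup (F : (set 'cV[R]_n)^nat) :
  (forall i, g_sigma_preimage coord (F i)) ->
  g_sigma_preimage coord (\bigcup_i (F i)).
Proof. exact: sigma_algebra_bigcup. Qed.

HB.instance Definition _ := @isMeasurable.Build default_measure_display
  'cV[R]_n (g_sigma_preimage coord) cV_set0 cV_setC cV_bigcup.

Lemma measurable_coord (i : 'I_n) :
  measurable_fun [set: 'cV[R]_n] (fun x => x i ord0 : R).
Proof.
move=> _ Y mY; rewrite setTI; apply: sub_sigma_algebra => /=.
rewrite -bigcup_seq/=; exists i => /=; first by rewrite mem_index_enum.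
by exists Y => //; rewrite setTI.
Qed.

Lemma measurable_fun_coordP d (T : measurableType d) (f : T -> 'cV[R]_n) :
  measurable_fun [set: T] f <->
  forall i, measurable_fun [set: T] (fun t => f t i ord0 : R).
Proof.
split=> [mf i|mf].
  exact: (measurableT_comp (measurable_coord i) mf).
apply: (@measurability _ _ _ _ setT f
  (\big[setU/set0]_(i < n) preimage_set_system setT (coord i) measurable)) => //.
move=> _ [B + <-].
rewrite -bigcup_seq/= => -[i _ [Y mY <-]].
by rewrite !setTI; have := mf i measurableT Y mY; rewrite setTI.
Qed.

End measurable_colvec.


(* d-dimensional Lebesgue measure, as an iterated product measure. *)
Section lebesgue_cV.
Context (R : realType).

Section step.
Context (n : nat) (mu : {sigma_finite_measure set 'cV[R]_n -> \bar R}).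

Definition cV_cons (p : measurableTypeR R * 'cV[R]_n) : 'cV[R]_n.+1 :=
  col_mx (p.1 : R)%:M p.2.

Lemma cV_cons0 p : cV_cons p ord0 ord0 = p.1.
Proof.
have -> : ord0 = lshift n (ord0 : 'I_1) :> 'I_n.+1 by exact/val_inj.
by rewrite /cV_cons [LHS]col_mxEu mxE eqxx mulr1n.
Qed.

Lemma cV_consS p j : cV_cons p (lift ord0 j) ord0 = p.2 j ord0.
Proof.
have -> : lift ord0 j = rshift 1 j :> 'I_n.+1 by exact/val_inj.
by rewrite /cV_cons [LHS]col_mxEd.
Qed.

Lemma measurable_cV_cons : measurable_fun [set: _] cV_cons.
Proof.
apply/measurable_fun_coordP => i.
case: (unliftP ord0 i) => [j|] ->.
  under eq_fun do rewrite cV_consS.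
  exact: (measurableT_comp (measurable_coord j) measurable_snd).
under eq_fun do rewrite cV_cons0.
exact: measurable_fst.
Qed.

Definition lebesgue_cV_step : set 'cV[R]_n.+1 -> \bar R :=
  pushforward (lebesgue_measure \x mu)%E cV_cons.

Let mpre A : measurable A -> measurable (cV_cons @^-1` A).
Proof. by move=> mA; rewrite -[X in measurable X]setTI; exact: measurable_cV_cons. Qed.

Let step0 : lebesgue_cV_step set0 = 0%E.
Proof. by rewrite /lebesgue_cV_step /pushforward preimage_set0 measure0. Qed.

Let step_ge0 A : (0 <= lebesgue_cV_step A)%E.
Proof. by rewrite /lebesgue_cV_step /pushforward; exact: measure_ge0. Qed.

Let step_sigma_additive : semi_sigma_additive lebesgue_cV_step.
Proof.
move=> F mF tF mUF; rewrite /lebesgue_cV_step /pushforward preimage_bigcup.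
apply: measure_semi_sigma_additive.
- by move=> i; exact: mpre.
- apply/trivIsetP => /= i j _ _ ij; rewrite -preimage_setI.
  by move/trivIsetP : tF => /(_ _ _ _ _ ij) ->//; rewrite preimage_set0.
- by rewrite -preimage_bigcup; exact: mpre.
Qed.

HB.instance Definition _ := isMeasure.Build _ _ _ lebesgue_cV_step
  step0 step_ge0 step_sigma_additive.

Let cV_uncons (x : 'cV[R]_n.+1) : measurableTypeR R * 'cV[R]_n :=
  (x ord0 ord0, \col_i x (lift ord0 i) ord0).

Let cV_consK : cancel cV_cons cV_uncons.
Proof.
move=> [t x]; rewrite /cV_uncons cV_cons0; congr pair.
by apply/colP => i; rewrite mxE cV_consS.
Qed.

Let measurable_cV_uncons : measurable_fun [set: _] cV_uncons.
Proof.
apply: measurable_fun_pair; first exact: measurable_coord.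
apply/measurable_fun_coordP => i.
under eq_fun do rewrite mxE.
exact: measurable_coord.
Qed.

Let step_sigma_finite : sigma_finite setT lebesgue_cV_step.
Proof.
have /sigma_finiteP[F [TF ndF Foo]] :
  sigma_finite setT (@lebesgue_measure R) by exact: sigma_finiteT.
have /sigma_finiteP[G [TG ndG Goo]] := sigma_finiteT mu.
exists (fun i => cV_uncons @^-1` (F i `*` G i)).
  rewrite -preimage_bigcup (_ : \bigcup_i _ = setT) ?preimage_setT//.
  rewrite -setXTT TF TG predeqE => -[x y]; split.
    by move=> [n0 _ []/= ? ?]; split; exists n0.
  move=> [/= [i _ Fix] [j _ Gjy]]; exists (maxn i j) => //; split.
    by move: x Fix; exact/subsetPset/ndF/leq_maxl.
  by move: y Gjy; exact/subsetPset/ndG/leq_maxr.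
move=> i; have [mF Fi] := Foo i; have [mG Gi] := Goo i; split.
  by rewrite -[X in measurable X]setTI; apply: measurable_cV_uncons => //;
     exact: measurableX.
rewrite /lebesgue_cV_step /pushforward -comp_preimage.
rewrite (_ : cV_uncons \o cV_cons = id); last first.
  by apply/funext => p /=; rewrite cV_consK.
by rewrite preimage_id product_measure1E// lte_mul_pinfty// ge0_fin_numE.
Qed.

HB.instance Definition _ := Measure_isSigmaFinite.Build _ _ _
  lebesgue_cV_step step_sigma_finite.

End step.

Fixpoint lebesgue_cV (n : nat) : {sigma_finite_measure set 'cV[R]_n -> \bar R} :=
  if n is m.+1 then lebesgue_cV_step (lebesgue_cV m) else \d_(0 : 'cV[R]_0).

End lebesgue_cV.

Section euclidean.
Context (R : realType) (d : nat).
Implicit Types (x y v : 'cV[R]_d) (A C : 'M[R]_d).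

Definition dotv x y : R := \sum_i x i ord0 * y i ord0.

(* Not to be confused with the sup norm `|x| of the library. *)
Definition enorm x : R := Num.sqrt (dotv x x).

Definition posdef A : Prop :=
  A^T = A /\ forall x, x != 0 -> 0 < dotv x (A *m x).

(* The symmetric positive definite square root of A (unique if A is positive
   definite). *)
Definition sqrtmx A : 'M[R]_d := xget 0 [set S | posdef S /\ S *m S = A].

Definition maxeig A : R := sup [set a | eigenvalue A a].
Definition mineig A : R := inf [set a | eigenvalue A a].
(* For positive definite A. *)
Definition condition_number A : R := maxeig A / mineig A.

End euclidean.

Section measurability.
Context (R : realType) (n : nat) d (T : measurableType d).
Implicit Types (f g : T -> 'cV[R]_n) (A : 'M[R]_n).

Lemma measurable_dotv f g : measurable_fun setT f -> measurable_fun setT g ->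
  measurable_fun setT (fun t => dotv (f t) (g t)).
Proof.
move=> /measurable_fun_coordP mf /measurable_fun_coordP mg.
by apply: measurable_sum => i; exact: measurable_funM.
Qed.

Lemma measurable_enorm f : measurable_fun setT f ->
  measurable_fun setT (fun t => enorm (f t)).
Proof.
move=> mf; apply: (measurableT_comp (f := @Num.sqrt R)).
  by apply: continuous_measurable_fun; exact: sqrt_continuous.
exact: measurable_dotv.
Qed.

Lemma measurable_mulmxl A f : measurable_fun setT f ->
  measurable_fun setT (fun t => A *m f t).
Proof.
move=> /measurable_fun_coordP mf; apply/measurable_fun_coordP => i.
under eq_fun do rewrite mxE.
by apply: measurable_sum => j; exact: measurable_funM.
Qed.

Lemma measurable_scalecV (h : T -> R) f :
  measurable_fun setT h -> measurable_fun setT f ->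
  measurable_fun setT (fun t => h t *: f t).
Proof.
move=> mh /measurable_fun_coordP mf; apply/measurable_fun_coordP => i.
under eq_fun do rewrite mxE.
exact: measurable_funM.
Qed.

Lemma measurable_addcV f g : measurable_fun setT f -> measurable_fun setT g ->
  measurable_fun setT (fun t => f t + g t).
Proof.
move=> /measurable_fun_coordP mf /measurable_fun_coordP mg.
apply/measurable_fun_coordP => i.
under eq_fun do rewrite mxE.
exact: measurable_funD.
Qed.

Lemma measurable_invr (h : T -> R) : measurable_fun setT h ->
  measurable_fun setT (fun t => (h t)^-1).
Proof.
move=> mh; rewrite (_ : (fun _ => _) =
    (fun t => if h t == 0 then 0 else (h t)^-1)); last first.
  by apply/funext => t; case: eqP => // ->; rewrite invr0.
apply: measurable_fun_if => //.
  by apply: measurable_fun_eqr => //; exact: measurable_cst.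
apply: (@measurable_comp _ _ _ _ _ _ [set r : R | r != 0] (@GRing.inv R)) => //=.
- exact: open_measurable.
- by move=> _ [t [_ /= /negbT t0] <-].
- by apply: open_continuous_measurable_fun => //; apply/in_setP => r /= r0;
    exact: inv_continuous.
- exact: measurable_funTS.
Qed.

End measurability.

Section gaussian.
Context (R : realType) (d : nat).
Implicit Types (x : 'cV[R]_d) (C : 'M[R]_d).

Definition gaussian_pdf C x : R :=
  expR (- dotv x (invmx C *m x) / 2) / Num.sqrt ((2 * pi) ^+ d * \det C).

Lemma measurable_gaussian_pdf C : measurable_fun setT (gaussian_pdf C).
Proof.
apply: measurable_funM => //.
apply: measurableT_comp => //; apply: measurable_funM => //.
apply: measurableT_comp => //.
by apply: measurable_dotv => //; exact: measurable_mulmxl.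
Qed.

Lemma gaussian_pdf_ge0 C x : 0 <= gaussian_pdf C x.
Proof. by rewrite divr_ge0 ?expR_ge0// sqrtr_ge0. Qed.

(* N(0, C), for C positive definite. *)
Definition gaussian C : set 'cV[R]_d -> \bar R :=
  fun A => (\int[lebesgue_cV R d]_(x in A) (gaussian_pdf C x)%:E)%E.

Let gaussian0 C : gaussian C set0 = 0%E.
Proof. by rewrite /gaussian integral_set0. Qed.

Let gaussian_ge0 C A : (0 <= gaussian C A)%E.
Proof. by apply: integral_ge0 => x _; rewrite lee_fin gaussian_pdf_ge0. Qed.

Let gaussian_sigma_additive C : semi_sigma_additive (gaussian C).
Proof.
apply: semi_sigma_additive_nng_induced.
  by apply/measurable_EFinP; exact: measurable_gaussian_pdf.
by move=> x; rewrite lee_fin gaussian_pdf_ge0.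
Qed.

HB.instance Definition _ C := isMeasure.Build _ _ _ (gaussian C)
  (gaussian0 C) (@gaussian_ge0 C) (@gaussian_sigma_additive C).

End gaussian.

Section unif_sphere.
Context (R : realType) (d : nat).

(* Lebesgue measure of the cone of the points of the unit ball whose direction
   lies in A; the apex 0 is negligible for d > 0. *)
Definition cone_measure : set 'cV[R]_d -> \bar R := fun A =>
  lebesgue_cV R d [set x | enorm x <= 1 /\ A ((enorm x)^-1 *: x)].

Let mcone A : measurable A ->
  measurable [set x : 'cV[R]_d | enorm x <= 1 /\ A ((enorm x)^-1 *: x)].
Proof.
move=> mA; apply: measurableI.
  rewrite -[X in measurable X]setTI.
  apply: (@measurable_fun_ler _ _ R setT (@enorm R d) (cst 1) _ _ _ [set true]) => //.
  exact: measurable_enorm.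
rewrite -[X in measurable X]setTI.
apply: (@measurable_scalecV R d _ _ (fun x => (enorm x)^-1) id _ _) => //.
by apply: measurable_invr; exact: measurable_enorm.
Qed.

Let cone0 : cone_measure set0 = 0%E.
Proof.
by rewrite /cone_measure (_ : [set _ | _] = set0) ?measure0//; apply/seteqP; split => // x [].
Qed.

Let cone_ge0 A : (0 <= cone_measure A)%E.
Proof. exact: measure_ge0. Qed.

Let cone_sigma_additive : semi_sigma_additive cone_measure.
Proof.
move=> F mF tF mUF; rewrite /cone_measure.
rewrite [X in lebesgue_cV R d X](_ : _ = \bigcup_i
    [set x | enorm x <= 1 /\ F i ((enorm x)^-1 *: x)]); last first.
  apply/seteqP; split => [x [x1 [i _ Fx]]|x [i _ [x1 Fx]]]; first by exists i.
  by split => //; exists i.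
apply: measure_semi_sigma_additive.
- by move=> i; exact: mcone.
- apply/trivIsetP => /= i j _ _ ij; apply/seteqP; split => // x [[_ Fi] [_ Fj]].
  move/trivIsetP : tF => /(_ _ _ Logic.I Logic.I ij) Fij.
  by have : (F i `&` F j) ((enorm x)^-1 *: x) by []; rewrite Fij.
- by apply: bigcup_measurable => i _; exact: mcone.
Qed.

HB.instance Definition _ := isMeasure.Build _ _ _ cone_measure
  cone0 cone_ge0 cone_sigma_additive.

(* Uniform probability on the unit sphere, as a measure on R^d. The second
   argument of mnormalize is a default value for a null or infinite total mass;
   it is never used, the total mass being the volume of the unit ball. *)
Definition unif_sphere : probability 'cV[R]_d R :=
  mnormalize cone_measure (\d_(0 : 'cV[R]_d)).

End unif_sphere.

Section hit_and_run.
Context (R : realType) (d : nat) (C : 'M[R]_d).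
Local Notation V := 'cV[R]_d.

Definition line_mean (p : V * V) : R :=
  - dotv p.1 (invmx C *m p.2) / enorm (sqrtmx (invmx C) *m p.2) ^+ 2.

Definition line_sd (p : V * V) : R := (enorm (sqrtmx (invmx C) *m p.2))^-1.

(* The law on R with density proportional to h |-> gaussian_pdf C (x + h *: v);
   normal_prob takes the mean and the standard deviation. *)
Definition line_gaussian (p : V * V) : {measure set (measurableTypeR R) -> \bar R} :=
  normal_prob (line_mean p) (line_sd p).

Let measurable_line_mean : measurable_fun setT line_mean.
Proof.
apply: measurable_funM; first apply: measurableT_comp => //.
  by apply: measurable_dotv => //; exact: measurable_mulmxl.
apply: measurable_invr; apply: measurable_funX.
by apply: measurable_enorm; exact: measurable_mulmxl.
Qed.

Let measurable_line_sd : measurable_fun setT line_sd.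
Proof.
by apply: measurable_invr; apply: measurable_enorm; exact: measurable_mulmxl.
Qed.

Let measurable_line_pdf : measurable_fun [set: (V * V) * measurableTypeR R]
  (fun q => normal_pdf (line_mean q.1) (line_sd q.1) (q.2 : R)).
Proof.
have mm : measurable_fun [set: (V * V) * measurableTypeR R]
    (fun q => line_mean q.1) by exact: measurableT_comp.
have ms : measurable_fun [set: (V * V) * measurableTypeR R]
    (fun q => line_sd q.1) by exact: measurableT_comp.
have mh : measurable_fun [set: (V * V) * measurableTypeR R]
    (fun q => q.2 : R) by exact: measurable_snd.
rewrite /normal_pdf; apply: measurable_fun_ifT.
- by apply: measurable_fun_eqr.
- by apply: measurableT_comp mh; exact: measurable_indic.
- apply: measurable_funM.
    apply: measurable_invr; apply: measurableT_comp.
      by apply: continuous_measurable_fun; exact: sqrt_continuous.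
    rewrite -[X in measurable_fun _ X]/(fun q => _ *+ 2).
    under eq_fun do rewrite -mulr_natr.
    by do 2 apply: measurable_funM => //; exact: measurable_funX.
  apply: measurableT_comp => //; apply: measurable_funM.
    apply: measurableT_comp => //; apply: measurable_funX.
    exact: measurable_funB.
  apply: measurable_invr.
  under eq_fun do rewrite -mulr_natr.
  by apply: measurable_funM => //; exact: measurable_funX.
Qed.

Let measurable_line_gaussian U : measurable U ->
  measurable_fun [set: V * V] (line_gaussian ^~ U).
Proof.
move=> mU.
pose f (q : (V * V) * measurableTypeR R) : \bar R :=
  ((normal_pdf (line_mean q.1) (line_sd q.1) (q.2 : R))%:E * (\1_U q.2)%:E)%E.
rewrite (_ : line_gaussian ^~ U = fubini_F (@lebesgue_measure R) f); last first.
  apply/funext => p; rewrite /line_gaussian/= /normal_prob integral_mkcond.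
  by rewrite epatch_indic.
apply: measurable_fun_fubini_tonelli_F.
  apply: emeasurable_funM; apply/measurable_EFinP => //.
  by apply: measurableT_comp; [exact: measurable_indic|exact: measurable_snd].
by move=> q; rewrite mule_ge0// lee_fin ?normal_pdf_ge0// indicE ler0n.
Qed.

HB.instance Definition _ := isKernel.Build _ _ _ _ R line_gaussian
  measurable_line_gaussian.

Let line_gaussianT p : line_gaussian p setT = 1%E.
Proof. exact: probability_setT. Qed.

HB.instance Definition _ := Kernel_isProbability.Build _ _ _ _ R line_gaussian
  line_gaussianT.

Definition hit_and_run (x : V) (A : set V) : \bar R :=
  (\int[unif_sphere R d]_v \int[line_gaussian (x, v)]_h
     (\1_A (x + (h : R) *: v))%:E)%E.

Let inner (p : V * V) (A : set V) : \bar R :=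
  (\int[line_gaussian p]_h (\1_A (p.1 + (h : R) *: p.2))%:E)%E.

Let measurable_line_point :
  measurable_fun [set: (V * V) * measurableTypeR R]
    (fun q => q.1.1 + (q.2 : R) *: q.1.2).
Proof.
apply: measurable_addcV.
  exact: (measurableT_comp measurable_fst measurable_fst).
apply: measurable_scalecV; first exact: measurable_snd.
exact: (measurableT_comp measurable_snd measurable_fst).
Qed.

Let inner_ge0 p A : (0 <= inner p A)%E.
Proof. by apply: integral_ge0 => h _; rewrite lee_fin indicE ler0n. Qed.

Let measurable_inner A : measurable A -> measurable_fun setT (inner ^~ A).
Proof.
move=> mA; rewrite /inner.
apply: (measurable_fun_integral_finite_kernel
  (fun q : (V * V) * measurableTypeR R =>
     (\1_A (q.1.1 + (q.2 : R) *: q.1.2))%:E)).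
  by move=> q; rewrite lee_fin indicE ler0n.
apply/measurable_EFinP; apply: measurableT_comp measurable_line_point.
exact: measurable_indic.
Qed.

Let measurable_line_indic (p : V * V) (A : set V) : measurable A ->
  measurable_fun [set: measurableTypeR R]
    (fun h => (\1_A (p.1 + (h : R) *: p.2) : R)%:E).
Proof.
move=> mA; apply/measurable_EFinP; apply: measurableT_comp.
  exact: measurable_indic.
exact: (measurableT_comp measurable_line_point (measurable_pair1 p)).
Qed.

Let hit_and_run0 x : hit_and_run x set0 = 0%E.
Proof.
rewrite /hit_and_run integral0_eq// => v _; rewrite integral0_eq// => h _.
by rewrite indic0.
Qed.

Let hit_and_run_ge0 x A : (0 <= hit_and_run x A)%E.
Proof. by apply: integral_ge0 => v _; exact: (inner_ge0 (x, v)). Qed.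

Let measurable_inner2 (x : V) (A : set V) : measurable A ->
  measurable_fun setT (fun v => inner (x, v) A).
Proof.
move=> mA.
exact: (measurableT_comp (measurable_inner mA) (measurable_pair1 x)).
Qed.

Let hit_and_run_sigma_additive x : semi_sigma_additive (hit_and_run x).
Proof.
move=> F mF tF mUF.
have innerF v : inner (x, v) (\bigcup_i F i) =
    (\sum_(i <oo) inner (x, v) (F i))%E.
  rewrite /inner -integral_nneseries//=; last first.
    by move=> i; exact: (measurable_line_indic (x, v)).
  apply: eq_integral => h _.
  by rewrite indic_bigcup.
rewrite [X in _ --> X](_ : _ =
    \int[unif_sphere R d]_v (\sum_(i <oo) inner (x, v) (F i)))%E; last first.
  by apply: eq_integral => v _; exact: innerF.
rewrite integral_nneseries//; last first.
  by move=> i; exact: measurable_inner2.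
by apply: is_cvg_ereal_nneg_natsum_cond => i _ _; exact: hit_and_run_ge0.
Qed.

HB.instance Definition _ x := isMeasure.Build _ _ _ (hit_and_run x)
  (hit_and_run0 x) (hit_and_run_ge0 x) (@hit_and_run_sigma_additive x).

Definition hit_and_run_kernel (x : V) : {measure set V -> \bar R} :=
  hit_and_run x.

Let measurable_hit_and_run A : measurable A ->
  measurable_fun setT (hit_and_run_kernel ^~ A).
Proof.
move=> mA.
rewrite (_ : hit_and_run_kernel ^~ A =
  fubini_F (unif_sphere R d) (inner ^~ A))//.
apply: measurable_fun_fubini_tonelli_F; first exact: measurable_inner.
by move=> p; exact: inner_ge0.
Qed.

HB.instance Definition _ := isKernel.Build _ _ _ _ R hit_and_run_kernel
  measurable_hit_and_run.

Let hit_and_runT x : hit_and_run_kernel x setT = 1%E.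
Proof.
rewrite /= /hit_and_run -[RHS](probability_setT (unif_sphere R d)).
rewrite -[RHS]mul1e -integral_cst//; apply: eq_integral => v _.
rewrite -[RHS](probability_setT (line_gaussian (x, v))).
rewrite -[RHS]mul1e -integral_cst//; apply: eq_integral => h _.
by rewrite indicT.
Qed.

HB.instance Definition _ := Kernel_isProbability.Build _ _ _ _ R
  hit_and_run_kernel hit_and_runT.

End hit_and_run.

(* The law after one step of the kernel k when the current law is mu. *)
Section kernel_step.
Context d (T : measurableType d) (R : realType).
Variables (k : R.-pker T ~> T) (mu : probability T R).

Definition kernel_step (A : set T) : \bar R := (\int[mu]_x k x A)%E.

Let kernel_step0 : kernel_step set0 = 0%E.
Proof. by apply: integral0_eq => x _; rewrite measure0. Qed.

Let kernel_step_ge0 A : (0 <= kernel_step A)%E.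
Proof. exact: integral_ge0. Qed.

Let kernel_step_sigma_additive : semi_sigma_additive kernel_step.
Proof.
move=> F mF tF mUF.
rewrite [X in _ --> X](_ : _ = \int[mu]_x (\sum_(i <oo) k x (F i)))%E; last first.
  apply: eq_integral => x _; apply/esym/cvg_lim => //.
  exact: measure_semi_sigma_additive.
rewrite integral_nneseries//; last by move=> i; exact: measurable_kernel.
by apply: is_cvg_ereal_nneg_natsum_cond => i _ _; exact: kernel_step_ge0.
Qed.

HB.instance Definition _ := isMeasure.Build _ _ _ kernel_step
  kernel_step0 kernel_step_ge0 kernel_step_sigma_additive.

Let kernel_stepT : kernel_step setT = 1%E.
Proof.
rewrite /kernel_step (eq_integral (cst 1%E)); last first.
  by move=> x _; exact: prob_kernel.
by rewrite integral_cst//= mul1e; exact: probability_setT.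
Qed.

HB.instance Definition _ := Measure_isProbability.Build _ _ _ kernel_step
  kernel_stepT.

End kernel_step.

Definition kernel_law d (T : measurableType d) (R : realType)
    (k : R.-pker T ~> T) (n : nat) (mu : probability T R) : probability T R :=
  iter n (fun m => kernel_step k m : probability T R) mu.

Definition tv_dist d (T : measurableType d) (R : realType)
    (mu nu : {measure set T -> \bar R}) : \bar R :=
  ereal_sup [set `|mu A - nu A|%E | A in measurable].

Definition coupling d (T : measurableType d) (R : realType)
    (mu nu : {measure set T -> \bar R}) : set (probability (T * T)%type R) :=
  [set p | forall A, measurable A ->
     p (fst @^-1` A) = mu A /\ p (snd @^-1` A) = nu A].

(* L^2-Wasserstein distance for the metric induced by x |-> enorm (S *m x);
   the exponent 2^-1 is the square root. *)
Definition wasserstein2 (R : realType) (d : nat) (S : 'M[R]_d)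
    (mu nu : {measure set 'cV[R]_d -> \bar R}) : \bar R :=
  ereal_inf [set ((\int[p]_z (enorm (S *m (z.1 - z.2)) ^+ 2)%:E) `^ 2^-1)%E
            | p in coupling mu nu].

Section mixing.
Context (R : realType) (d : nat) (C : 'M[R]_d).

Definition mixing_time (eps : R) (nu : probability 'cV[R]_d R) : \bar R :=
  ereal_inf [set (n%:R)%:E | n in [set n : nat |
    (tv_dist (kernel_law (hit_and_run_kernel C) n nu) (gaussian C)
       <= eps%:E)%E]].

(* The rate rho, where sqrtmx (invmx C) is C^(-1/2). *)
Definition hr_rate : R :=
  2^-1 * inf [set fine ('E_(unif_sphere R d)[fun v =>
      dotv zeta ((enorm (sqrtmx (invmx C) *m v))^-1
                 *: (sqrtmx (invmx C) *m v)) ^+ 2])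
    | zeta in [set zeta : 'cV[R]_d | enorm zeta = 1]].

End mixing.

(* Main.v *)
(* Let P be the operator f |-> (x |-> \int f(y) pi(x, dy)) of the Hit-and-Run kernel, and measure
   lengths by |x| = |C^(-1/2) x|.

   Contraction: two chains at x and x + delta that use the same direction v and the same normal
   variable end up at a difference equal to the part of delta orthogonal to v, whose mean square is
   at most (1 - 2 rho) |delta|^2. Dually, a bound g(x) <= g(x + delta) + W(x) + b |delta|^2 passes
   to P g with W replaced by P W and b by (1 - 2 rho) b.

   Smoothing: P has an explicit Lebesgue density, and for 0 <= f <= 1 two steps give
   P^2 f (x) - P^2 f (x + delta) <= c (d kappa^(1/2) + 2 + |x|) |delta|. One step would not do: moving
   the starting point of the density costs 1 / |z - x|, which is not integrable along lines.

   Replace the product on the right by theta (...)^2 + |delta|^2 / theta, propagate by j steps, and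
   integrate over a coupling of the Gaussian law and nu. The Gaussian law is invariant and has
   second moment at most 8 d, so that the total variation distance after j + 2 steps is at most
   c (theta d^2 kappa^2 + (1 - 2 rho)^j W^2 / theta); it remains to choose theta and j. *)

From HB Require Import structures.
Require Import Defs.
From mathcomp Require Import all_boot all_order all_algebra.
From mathcomp Require Import all_classical all_reals all_analysis.
From mathcomp Require Import finmap measurable_realfun spectral.
From mathcomp Require Import complex.
From mathcomp Require Import ring lra.
Set Implicit Arguments.
Unset Strict Implicit.
Unset Printing Implicit Defensive.
Import Order.TTheory GRing.Theory Num.Theory.
Import numFieldNormedType.Exports.
Local Open Scope classical_set_scope.
Local Open Scope ring_scope.

(** * Symmetric positive definite matrices *)

Section linear_algebra.
Context (R : realType).

Lemma poly_interpolation (f : R -> R) (s : seq R) :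
  exists q : {poly R}, {in s, forall x, q.[x] = f x}.
Proof.
elim: s => [|x s [q qs]]; first by exists 0.
have [xs|xs] := boolP (x \in s).
  by exists q => y; rewrite inE => /predU1P[->|]; exact: qs.
pose w := \prod_(y <- s) ('X - y%:P).
have wx : w.[x] != 0 by rewrite -[_ == 0]/(root w x) root_prod_XsubC.
exists (q + ((f x - q.[x]) / w.[x]) *: w) => y; rewrite inE => /predU1P[->|ys].
  by rewrite hornerD hornerZ divfK// addrC subrK.
have /eqP w0 : root w y by rewrite root_prod_XsubC.
by rewrite hornerD hornerZ w0 mulr0 addr0 qs.
Qed.

Lemma symmetric_diagonalizable n (A : 'M[R]_n) : A^T = A ->
  exists (P : 'M[R]_n) (D : 'rV[R]_n),
    P \in unitmx /\ P *m A = diag_mx D *m P.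
Proof.
move=> AT; pose C := [the numClosedFieldType of complex.complex R].
pose toC : R -> C := complex.real_complex R.
have toC_inj : injective toC by exact: complex.complexI.
pose Ac := map_mx toC A.
have Acr : Ac \is a @mxOver n n C Num.real.
  by apply/mxOverP => i j; rewrite mxE; apply/complex.complex_realP; exists (A i j).
have Acs : Ac \is symmetricmx.
  by apply/is_hermitianmxP; rewrite expr0 scale1r map_mx_id// /Ac map_trmx AT.
have Ach := realsym_hermsym Acs Acr.
have Dr := hermitian_spectral_diag_real Ach.
have /hermitian_normalmx/orthomx_spectralP AE := Ach.
have DDr : diag_mx (spectral_diag Ac) \is a @mxOver n n C Num.real.
  apply/mxOverP => i j; rewrite mxE; case: eqP => [->|_]; last by rewrite mulr0n rpred0.
  by rewrite mulr1n; move/mxOverP : Dr.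
have toCK m1 m2 (M : 'M[C]_(m1, m2)) : M \is a @mxOver m1 m2 C Num.real ->
    map_mx toC (map_mx (@complex.Re R) M) = M.
  by move=> /mxOverP Mr; apply/matrixP => i j; rewrite !mxE; exact: complex.RRe_real.
have [|P] := @real_similar C n _ _ _ Acr DDr.
  exists (spectralmx Ac); first exact: spectral_unit.
  apply/similarP; first exact: spectral_unit.
  by rewrite {2}AE !mulmxA mulmxV ?mul1mx// spectral_unit.
rewrite inE => /andP[/= Pr Pu] /(similarP Pu) PA.
exists (map_mx (@complex.Re R) P), (map_mx (@complex.Re R) (spectral_diag Ac)).
split; first by rewrite -(map_unitmx (complex.real_complex R)) toCK.
apply: (map_mx_inj (f := complex.real_complex R)).
by rewrite !map_mxM map_diag_mx !toCK.
Qed.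

Lemma dotvE n (x y : 'cV[R]_n) : dotv x y = (x^T *m y) ord0 ord0.
Proof. by rewrite !mxE; apply: eq_bigr => i _; rewrite mxE. Qed.

Lemma dotv_tr n (A : 'M[R]_n) x y : dotv x (A *m y) = dotv (A^T *m x) y.
Proof. by rewrite !dotvE trmx_mul trmxK mulmxA. Qed.

Lemma tr_horner_mx n (A : 'M[R]_n.+1) (q : {poly R}) : A^T = A ->
  (horner_mx A q)^T = horner_mx A q.
Proof.
move=> AT; elim/poly_ind: q => [|q c IH]; first by rewrite rmorph0 trmx0.
rewrite rmorphD rmorphM/= horner_mx_X horner_mx_C linearD/= trmx_mul AT IH.
by rewrite tr_scalar_mx -(comm_horner_mx _ (comm_mx_refl A)).
Qed.

Lemma horner_mx_intertwine n (P A B : 'M[R]_n.+1) (q : {poly R}) :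
  P *m A = B *m P -> P *m horner_mx A q = horner_mx B q *m P.
Proof.
move=> PA; elim/poly_ind: q => [|q c IH]; first by rewrite !rmorph0 mulmx0 mul0mx.
rewrite !rmorphD !rmorphM/= !horner_mx_X !horner_mx_C mulmxDr mulmxDl.
by rewrite -scalar_mxC mulmxA IH -!mulmxA PA.
Qed.

(* [F f] is conjugate to a diagonal matrix by a matrix that need not be orthogonal; its symmetry
   comes from interpolating [f] on the spectrum, which makes [F f] a polynomial in [A]. *)
Lemma symmetric_functional_calculus n (A : 'M[R]_n) : A^T = A ->
  exists F : (R -> R) -> 'M[R]_n,
    [/\ forall f, (F f)^T = F f,
        forall f g, F f *m F g = F (fun l => f l * g l),
        forall a b, F (fun l => a * l + b) = a *: A + b%:M
      & forall f g, (forall l, eigenvalue A l -> f l = g l) -> F f = F g].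
Proof.
case: n A => [|n] A AT.
  by exists (fun=> 0); split=> *; apply/matrixP => -[].
have [P [D [Pu PA]]] := symmetric_diagonalizable AT.
have De i : eigenvalue A (D ord0 i).
  apply/eigenvalueP; exists (row i P).
    by rewrite -row_mul PA row_mul row_diag_mx -scalemxAl -rowE.
  apply: contraTneq Pu => Pi0.
  rewrite -row_free_unit; apply/negP => /row_freeP[Q PQ].
  have := congr1 (row i) PQ; rewrite row_mul Pi0 mul0mx => /rowP /(_ i).
  by rewrite !mxE eqxx => /eqP; rewrite eq_sym oner_eq0.
pose F f : 'M[R]_n.+1 := invmx P *m diag_mx (map_mx f D) *m P.
exists F; split => [f|f g|a b|f g fg].
- have [q qD] := poly_interpolation f [seq D ord0 i | i <- enum 'I_n.+1].
  suff -> : F f = horner_mx A q by exact: tr_horner_mx.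
  rewrite /F -mulmxA; apply: (can_inj (mulKmx Pu)).
  rewrite mulKVmx// (horner_mx_intertwine _ PA) horner_mx_diag; congr (_ *m _).
  by congr diag_mx; apply/rowP => i; rewrite !mxE qD// map_f// mem_enum.
- rewrite /F -!mulmxA mulKVmx// (mulmxA (diag_mx _)) mulmx_diag.
  by congr (_ *m (_ *m _)); congr diag_mx; apply/rowP => i; rewrite !mxE.
- rewrite /F -mulmxA; apply: (can_inj (mulKmx Pu)); rewrite mulKVmx//.
  rewrite mulmxDr -scalemxAr PA scalar_mxC scalemxAl -mulmxDl; congr (_ *m _).
  by apply/matrixP => i j; rewrite !mxE; case: eqP => _; rewrite ?mulr0n ?mulr0 ?addr0// ?mulr1n.
- congr (_ *m diag_mx _ *m _); apply/rowP => i; rewrite !mxE; exact/fg/De.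
Qed.

Lemma dotvv_ge0 n (x : 'cV[R]_n) : 0 <= dotv x x.
Proof. by apply: sumr_ge0 => i _; rewrite -expr2 sqr_ge0. Qed.

Lemma dotvv_eq0 n (x : 'cV[R]_n) : dotv x x = 0 -> x = 0.
Proof.
move=> /eqP; rewrite psumr_eq0; last by move=> i _; rewrite -expr2 sqr_ge0.
move=> /allP x0; apply/colP => i; rewrite mxE; apply/eqP.
by have := x0 i (mem_index_enum i); rewrite /= -expr2 sqrf_eq0.
Qed.

Lemma dotvC n (x y : 'cV[R]_n) : dotv x y = dotv y x.
Proof. by apply: eq_bigr => i _; rewrite mulrC. Qed.

Lemma dotvDl n (x y z : 'cV[R]_n) : dotv (x + y) z = dotv x z + dotv y z.
Proof. by rewrite -big_split/=; apply: eq_bigr => i _; rewrite !mxE mulrDl. Qed.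

Lemma dotvZl n (a : R) (x y : 'cV[R]_n) : dotv (a *: x) y = a * dotv x y.
Proof. by rewrite mulr_sumr; apply: eq_bigr => i _; rewrite !mxE mulrA. Qed.

Lemma dotvDr n (x y z : 'cV[R]_n) : dotv z (x + y) = dotv z x + dotv z y.
Proof. by rewrite dotvC dotvDl !(dotvC z). Qed.

Lemma dotvZr n (a : R) (x y : 'cV[R]_n) : dotv x (a *: y) = a * dotv x y.
Proof. by rewrite dotvC dotvZl dotvC. Qed.

Lemma eigenvalue_posdef n (A : 'M[R]_n) l : posdef A -> eigenvalue A l -> 0 < l.
Proof.
move=> [AT Apos] /eigenvalueP[v vA v0].
have v0' : v^T != 0 by rewrite -trmx0 (inj_eq trmx_inj).
have Av : A *m v^T = l *: v^T by rewrite -{1}AT -trmx_mul vA linearZ.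
have := Apos _ v0'; rewrite Av dotvZr pmulr_lgt0// lt_neqAle dotvv_ge0 andbT.
by apply: contra_neq v0' => /esym; exact: dotvv_eq0.
Qed.

Lemma posdef_unitmx n (A : 'M[R]_n) : posdef A -> A \in unitmx.
Proof.
move=> Apos; rewrite -row_free_unit -kermx_eq0; apply/eqP/row_matrixP => i.
rewrite row0; apply/eqP/negP => /negP k0.
have : eigenvalue A 0.
  apply/eigenvalueP; exists (row i (kermx A)) => //.
  by rewrite scale0r -row_mul mulmx_ker row0.
by move/(eigenvalue_posdef Apos); rewrite ltxx.
Qed.

Lemma posdef_inv n (A : 'M[R]_n) : posdef A -> posdef (invmx A).
Proof.
move=> Apos; have Au := posdef_unitmx Apos; case: Apos => AT Apos.
split=> [|x x0]; first by rewrite trmx_inv AT.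
have : invmx A *m x != 0.
  by apply: contraNneq x0 => Ax0; rewrite -(mulKVmx Au x) Ax0 mulmx0.
by move=> /Apos; rewrite mulKVmx// dotvC.
Qed.

Lemma sqrtmxP n (A : 'M[R]_n) : posdef A ->
  posdef (sqrtmx A) /\ sqrtmx A *m sqrtmx A = A.
Proof.
move=> Apos; have AT := Apos.1.
suff : exists S : 'M[R]_n, posdef S /\ S *m S = A by exact: (@xgetPex _ 0 [set S : 'M[R]_n | posdef S /\ S *m S = A]).
have [F [Fsym FM FA Fext]] := symmetric_functional_calculus AT.
have FE : A = F (fun l => 1 * l + 0) by rewrite FA scale1r raddf0 addr0.
pose S := F (fun l => Num.sqrt l); pose T := F (fun l => Num.sqrt (Num.sqrt l)).
have SS : S *m S = A.
  rewrite FM FE; apply: Fext => l /(eigenvalue_posdef Apos) /ltW l0.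
  by rewrite -expr2 sqr_sqrtr// mul1r addr0.
have TT : T *m T = S.
  rewrite FM; apply: Fext => l /(eigenvalue_posdef Apos) /ltW l0.
  by rewrite -expr2 sqr_sqrtr// sqrtr_ge0.
exists S; split => //; split => [|x x0]; first exact: Fsym.
rewrite -TT -mulmxA dotv_tr Fsym lt_neqAle dotvv_ge0 andbT eq_sym.
apply: contra_neq x0 => /dotvv_eq0 Tx0.
apply/(can_inj (mulKmx (posdef_unitmx Apos))).
by rewrite mulmx0 -SS -TT -!mulmxA Tx0 !mulmx0.
Qed.

Lemma eigenvalue_finite n (A : 'M[R]_n) : A^T = A ->
  exists s : seq R, forall l, eigenvalue A l -> l \in s.
Proof.
move=> /symmetric_diagonalizable[P [D [Pu PA]]].
exists [seq D ord0 i | i <- enum 'I_n] => l /eigenvalueP[v vA v0].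
pose w := v *m invmx P.
have wD : w *m diag_mx D = l *: w.
  apply: (can_inj (mulmxK Pu)).
  by rewrite -mulmxA -PA !mulmxA mulmxKV// vA -scalemxAl mulmxKV.
have /rV0Pn[i wi] : w != 0.
  by apply: contraNneq v0 => w0; rewrite -(mulmxKV Pu v) -/w w0 mul0mx.
have /rowP/(_ i) := wD; rewrite mul_mx_diag mxE [RHS]mxE mulrC => E.
rewrite -(mulIf wi E).
by rewrite map_f// mem_enum.
Qed.

Lemma rayleigh_bounds n (A : 'M[R]_n) x : posdef A ->
  mineig A * dotv x x <= dotv x (A *m x) <= maxeig A * dotv x x.
Proof.
move=> Apos; have AT := Apos.1.
have [F [Fsym FM FA Fext]] := symmetric_functional_calculus AT.
have aux a b : (forall l, eigenvalue A l -> 0 <= a * l + b) ->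
    0 <= a * dotv x (A *m x) + b * dotv x x.
  move=> H; pose Q := F (fun l => Num.sqrt (a * l + b)).
  have QQ : Q *m Q = a *: A + b%:M.
    by rewrite FM -FA; apply: Fext => l /H ?; rewrite -expr2 sqr_sqrtr.
  have := dotvv_ge0 (Q *m x).
  rewrite -{1}[Q]Fsym -dotv_tr mulmxA QQ mulmxDl dotvDr -scalemxAl dotvZr.
  by rewrite mul_scalar_mx dotvZr.
have lb0 : lbound [set a | eigenvalue A a] 0.
  by move=> l /= /(eigenvalue_posdef Apos) /ltW.
have ub : exists b, ubound [set a | eigenvalue A a] b.
  have [s As] := eigenvalue_finite AT; exists (\sum_(l <- s) `|l|) => l /= /As ls.
  rewrite (big_rem _ ls)/= (le_trans (ler_norm l))// lerDl sumr_ge0//.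
apply/andP; split.
  have := aux 1 (- mineig A); rewrite mul1r mulNr subr_ge0; apply => l le.
  by rewrite mul1r subr_ge0; apply: ge_inf => //; exists 0.
have := aux (-1) (maxeig A); rewrite mulN1r addrC subr_ge0; apply => l le.
by rewrite mulN1r addrC subr_ge0; apply: ub_le_sup.
Qed.

Lemma mineig_gt0 n (A : 'M[R]_n) : (0 < n)%N -> posdef A -> 0 < mineig A.
Proof.
move=> n0 Apos; have AT := Apos.1.
have [s As] := eigenvalue_finite AT.
have [m m0 ms] : exists2 m : R, 0 < m & forall l, l \in s -> 0 < l -> m <= l.
  elim: s {As} => [|x s [m m0 ms]]; first by exists 1.
  exists (Num.min m (if 0 < x then x else 1)).
    by rewrite lt_min m0/=; case: ifPn.
  move=> l; rewrite inE => /predU1P[->|ls] l0.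
    by rewrite l0 ge_min lexx orbT.
  by rewrite ge_min ms.
rewrite (lt_le_trans m0)//; apply: lb_le_inf.
  case: n n0 A Apos AT As => // n _ A Apos AT _.
  have [P [D [Pu PA]]] := symmetric_diagonalizable AT.
  exists (D ord0 ord0) => /=; apply/eigenvalueP; exists (row ord0 P).
    by rewrite -row_mul PA row_mul row_diag_mx -scalemxAl -rowE.
  apply: contraTneq Pu => Pi0.
  rewrite -row_free_unit; apply/negP => /row_freeP[Q PQ].
  have := congr1 (row ord0) PQ; rewrite row_mul Pi0 mul0mx => /rowP /(_ ord0).
  by rewrite !mxE eqxx => /eqP; rewrite eq_sym oner_eq0.
by move=> l /= le; apply: ms; [exact: As|exact: eigenvalue_posdef le].
Qed.

End linear_algebra.

(** * Integral representations *)

Section integral_representation.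
Local Open Scope ereal_scope.
Context d (Y : measurableType d) (R : realType).
Context (m : {measure set Y -> \bar R}) (Phi : (Y -> \bar R) -> \bar R).
Import HBNNSimple.
Context (Phi_indic : forall A, measurable A -> Phi (fun y => (\1_A y)%:E) = m A)
  (PhiD : forall f g, measurable_fun setT f -> (forall y, 0 <= f y) ->
    measurable_fun setT g -> (forall y, 0 <= g y) ->
    Phi (fun y => f y + g y) = Phi f + Phi g)
  (PhiZ : forall (k : R) f, (0 <= k)%R -> measurable_fun setT f ->
    (forall y, 0 <= f y) -> Phi (fun y => k%:E * f y) = k%:E * Phi f)
  (Phi_lim : forall F : (Y -> \bar R)^nat,
    (forall n, measurable_fun setT (F n)) -> (forall n y, 0 <= F n y) ->
    (forall y, nondecreasing_seq (F ^~ y)) ->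
    Phi (fun y => limn (F ^~ y)) = limn (fun n => Phi (F n))).

Let Phi0 : Phi (fun=> 0) = 0.
Proof.
have := Phi_indic measurable0; rewrite measure0 => H; rewrite -[RHS]H.
by congr Phi; apply/funext => y; rewrite indic0.
Qed.

Let Phi_nnsfun (g : {nnsfun Y >-> R}) : \int[m]_y (g y)%:E = Phi (EFin \o g).
Proof.
under eq_integral do rewrite fimfunE -fsumEFin//.
have -> : EFin \o g = fun y => \sum_(r \in range g) (r * \1_(g @^-1` [set r]) y)%:E.
  by apply/funext => y; rewrite /= fimfunE -fsumEFin.
rewrite ge0_integral_fsum//; last 2 first.
  - by move=> r; exact/measurable_EFinP/measurableT_comp.
  - by move=> r z _; rewrite EFinM nnfun_muleindic_ge0.
have fg : finite_set (range g) by exact: fimfunP.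
rewrite fsbig_finite//.
have -> : (fun y => \sum_(r \in range g) (r * \1_(g @^-1` [set r]) y)%:E) =
    (fun y => \sum_(r <- fset_set (range g)) (r * \1_(g @^-1` [set r]) y)%:E).
  by apply/funext => y; rewrite fsbig_finite.
have : all (fun r => 0 <= r)%R (fset_set (range g)).
  by apply/allP => r; rewrite in_fset_set// => /set_mem[y _ <-].
elim: (enum_fset _) => [_|r s IH /= /andP[r0 s0]].
  rewrite big_nil -Phi0; congr Phi; apply/funext => y; by rewrite big_nil.
rewrite big_cons IH//.
under [in RHS]eq_fun do rewrite big_cons.
have mi r' : measurable_fun setT (fun y => (r' * \1_(g @^-1` [set r']) y)%:E).
  by exact/measurable_EFinP/measurableT_comp.
rewrite PhiD//; last 3 first.
- by move=> y; rewrite lee_fin mulr_ge0// indicE ler0n.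
- exact: emeasurable_sum.
- move=> y; rewrite big_seq sume_ge0// => r' /(allP s0) /= r'0.
  by rewrite lee_fin mulr_ge0// indicE ler0n.
congr +%E.
under [in RHS]eq_fun do rewrite EFinM.
rewrite PhiZ ?Phi_indic//; last by exact/measurable_EFinP/measurable_indic.
under eq_integral do rewrite EFinM.
rewrite ge0_integralZl//; last by exact/measurable_EFinP/measurable_indic.
by rewrite integral_indic// setIT.
Qed.

Lemma ge0_integral_representation f : measurable_fun setT f ->
  (forall y, 0 <= f y) -> \int[m]_y f y = Phi f.
Proof.
move=> mf f0; pose f_ := nnsfun_approx measurableT mf.
have fE : f = fun y => limn (fun n => (f_ n y)%:E).
  by apply/funext => y; apply/esym/cvg_lim => //=; exact: cvg_nnsfun_approx.
transitivity (\int[m]_y limn (fun n => (f_ n y)%:E)); first by rewrite -fE.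
transitivity (Phi (fun y => limn (fun n => (f_ n y)%:E))); last by rewrite -fE.
rewrite Phi_lim//.
- rewrite monotone_convergence//.
  + congr (limn _); apply/funext => n; exact: Phi_nnsfun.
  + by move=> n; exact/measurable_EFinP.
  + by move=> n y _; rewrite lee_fin.
  + by move=> y _ a b ab; rewrite lee_fin; exact/lefP/nd_nnsfun_approx.
- by move=> n; exact/measurable_EFinP.
- by move=> n y; rewrite lee_fin.
- by move=> y a b ab; rewrite lee_fin; exact/lefP/nd_nnsfun_approx.
Qed.

End integral_representation.

Section mixtures.
Local Open Scope ereal_scope.
Context (R : realType).

Lemma ge0_integral_density d (Y : measurableType d) (m mu : {measure set Y -> \bar R})
  (p : Y -> R) : measurable_fun setT p -> (forall y, (0 <= p y)%R) ->
  (forall A, measurable A -> m A = \int[mu]_(y in A) (p y)%:E) ->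
  forall f, measurable_fun setT f -> (forall y, 0 <= f y) ->
  \int[m]_y f y = \int[mu]_y ((p y)%:E * f y).
Proof.
move=> mp p0 mE f mf f0.
have mpE : measurable_fun setT (fun y => (p y)%:E) by exact/measurable_EFinP.
apply: (ge0_integral_representation (Phi := fun f => \int[mu]_y ((p y)%:E * f y))) => //.
- move=> A mA; rewrite mE// [RHS]integral_mkcond; apply: eq_integral => y _.
  by rewrite patchE indicE; case: (y \in A); rewrite ?mule1 ?mule0.
- move=> g h mg g0 mh h0; rewrite -ge0_integralD//.
  + by apply: eq_integral => y _; rewrite ge0_muleDr.
  + by move=> y _; rewrite mule_ge0// lee_fin.
  + exact: emeasurable_funM.
  + by move=> y _; rewrite mule_ge0// lee_fin.
  + exact: emeasurable_funM.
- move=> k g k0 mg g0; rewrite -ge0_integralZl//.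
  + by apply: eq_integral => y _; rewrite muleCA.
  + exact: emeasurable_funM.
  + by move=> y _; rewrite mule_ge0// lee_fin.
- move=> F mF F0 ndF; rewrite -monotone_convergence//.
  + apply: eq_integral => y _; rewrite limeMl//; last exact: ereal_nondecreasing_is_cvgn.
  + by move=> n; exact: emeasurable_funM.
  + by move=> n y _; rewrite mule_ge0// lee_fin.
  + by move=> y _ a b ab; rewrite lee_wpmul2l ?lee_fin//; exact: ndF.
Qed.

Lemma ge0_integral_mixture d1 d2 (X : measurableType d1) (Y : measurableType d2)
  (m : {measure set Y -> \bar R}) (mu : {measure set X -> \bar R})
  (k : X -> {measure set Y -> \bar R}) :
  (forall A, measurable A -> measurable_fun setT (k ^~ A)) ->
  (forall A, measurable A -> m A = \int[mu]_x k x A) ->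
  forall f, measurable_fun setT f -> (forall y, 0 <= f y) ->
  \int[m]_y f y = \int[mu]_x \int[k x]_y f y.
Proof.
move=> mk mE f mf f0.
apply: (ge0_integral_representation (Phi := fun f => \int[mu]_x \int[k x]_y f y)) => //.
- move=> A mA; rewrite mE//; apply: eq_integral => x _.
  by rewrite integral_indic// setIT.
- move=> g h mg g0 mh h0; rewrite -ge0_integralD//.
  + by apply: eq_integral => x _; rewrite ge0_integralD.
  + by move=> x _; exact: integral_ge0.
  + exact: measurable_fun_integral_kernel.
  + by move=> x _; exact: integral_ge0.
  + exact: measurable_fun_integral_kernel.
- move=> c g c0 mg g0; rewrite -ge0_integralZl//.
  + by apply: eq_integral => x _; rewrite ge0_integralZl.
  + exact: measurable_fun_integral_kernel.
  + by move=> x _; exact: integral_ge0.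
- move=> F mF F0 ndF; rewrite -monotone_convergence//.
  + by apply: eq_integral => x _; rewrite monotone_convergence// => y _; exact: ndF.
  + by move=> n; exact: measurable_fun_integral_kernel.
  + by move=> n x _; exact: integral_ge0.
  + by move=> x _ a b ab; apply: ge0_le_integral => // y _; exact: ndF.
Qed.

End mixtures.

(** * Lebesgue measure on column vectors *)

Section lebesgue_affine.
Local Open Scope ereal_scope.
Context (R : realType).
Notation mu := (@lebesgue_measure R).

Lemma ge0_integral_lebesgue_affine (a b : R) (f : R -> \bar R) : a != 0%R ->
  measurable_fun setT f -> (forall x, 0 <= f x) ->
  \int[mu]_x f x = `|a|%:E * \int[mu]_x f (a * x + b)%R.
Proof.
move=> a0 mf f0.
pose g : measurableTypeR R -> measurableTypeR R := fun x => (a * x + b)%R.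
have mg : measurable_fun setT g by exact/measurable_funD/measurable_cst/measurable_funM.
have a0' : (0 <= `|a|)%R by [].
pose pg : {measure set (measurableTypeR R) -> \bar R} :=
  measure_function_pushforward__canonical__measure_function_Measure mu mg.
pose nu : {measure set (measurableTypeR R) -> \bar R} := mscale (NngNum a0') pg.
have nuE A : measurable A -> mu A = nu A.
  apply: lebesgue_measure_unique => _ [[x y] _ <-] /=.
  rewrite /nu /mscale /= /pushforward /= lebesgue_measure_itv/=.
  case: (ltgtP a 0%R) a0 => // [an|ap] _.
    rewrite (_ : g @^-1` _ = [set` `[(y - b) / a, (x - b) / a[ ])%R; last first.
      apply/seteqP; split => t /=; rewrite /g !in_itv/=.
        by rewrite ler_ndivrMr// ltr_ndivlMr// !(mulrC t) lerBrDr ltrBlDr => /andP[-> ->].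
      by rewrite ler_ndivrMr// ltr_ndivlMr// !(mulrC t) lerBrDr ltrBlDr => /andP[-> ->].
    rewrite lebesgue_measure_itv/= !lte_fin ltr_nM2r ?invr_lt0// ltrD2r.
    by case: ifPn => _; rewrite ?mule0// -!EFinB -EFinM ltr0_norm//; congr EFin; field; rewrite lt_eqF.
  rewrite (_ : g @^-1` _ = [set` `](x - b) / a, (y - b) / a] ])%R; last first.
    apply/seteqP; split => t /=; rewrite /g !in_itv/=.
      by rewrite ler_pdivlMr// ltr_pdivrMr// !(mulrC t) lerBrDr ltrBlDr => /andP[-> ->].
    by rewrite ler_pdivlMr// ltr_pdivrMr// !(mulrC t) lerBrDr ltrBlDr => /andP[-> ->].
  rewrite lebesgue_measure_itv/= !lte_fin ltr_pM2r ?invr_gt0// ltrD2r.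
  by case: ifPn => _; rewrite ?mule0// -!EFinB -EFinM gtr0_norm//; congr EFin; field; rewrite gt_eqF.
rewrite (eq_measure_integral nu) => [|A mA _]; last exact: nuE.
rewrite ge0_integral_mscale//= ge0_integral_pushforward//.
Qed.

Lemma ge0_integral_lebesgue_cVS n (f : 'cV[R]_n.+1 -> \bar R) :
  measurable_fun setT f -> (forall x, 0 <= f x) ->
  \int[lebesgue_cV R n.+1]_x f x =
  \int[mu]_t \int[lebesgue_cV R n]_x f (cV_cons (t, x)).
Proof.
move=> mf f0; rewrite -[LHS]/(\int[pushforward (mu \x lebesgue_cV R n)%E (@cV_cons R n)]_x f x).
have mc := @measurable_cV_cons R n.
rewrite ge0_integral_pushforward//= ?preimage_setT.
rewrite (fubini_tonelli1 (fun p => f (cV_cons p)))//.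
exact: (measurableT_comp mf mc).
Qed.

Lemma measurable_cV_affine n (a : R) (b : 'cV[R]_n) :
  measurable_fun setT (fun x : 'cV[R]_n => a *: x + b : 'cV[R]_n)%R.
Proof.
by apply: measurable_addcV => //; apply: measurable_scalecV.
Qed.

Lemma ge0_integral_lebesgue_cV_affine n (a : R) (b : 'cV[R]_n) (f : 'cV[R]_n -> \bar R) :
  a != 0%R -> measurable_fun setT f -> (forall x, 0 <= f x) ->
  \int[lebesgue_cV R n]_x f x =
  (`|a| ^+ n)%:E * \int[lebesgue_cV R n]_x f (a *: x + b)%R.
Proof.
move=> a0; elim: n b f => [|n IH] b f mf f0.
  rewrite expr0 mul1e; apply: eq_integral => x _; congr f.
  by apply/matrixP => -[].
rewrite !ge0_integral_lebesgue_cVS//; last 1 first.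
  exact: (measurableT_comp mf (@measurable_cV_affine n.+1 a b)).
have mfc : measurable_fun setT (fun p => f (@cV_cons R n p)).
  exact: measurableT_comp mf (@measurable_cV_cons R n).
rewrite (ge0_integral_lebesgue_affine (b ord0 ord0) a0)//; last 2 first.
- exact: measurable_fun_fubini_tonelli_F mfc _.
- by move=> t; exact: integral_ge0.
rewrite exprS EFinM -muleA; congr (_ * _).
have mfa : measurable_fun setT (fun p : measurableTypeR R * 'cV[R]_n =>
    f (a *: cV_cons p + b)%R).
  apply: (measurableT_comp mf); apply: measurable_addcV => //.
  by apply: measurable_scalecV => //; exact: measurable_cV_cons.
rewrite -ge0_integralZl//; last 2 first.
- exact: measurable_fun_fubini_tonelli_F mfa _.
- by move=> t _; exact: integral_ge0.
apply: eq_integral => t _.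
pose b' := (\col_i b (lift ord0 i) ord0)%R.
have mft : measurable_fun setT (fun x => f (cV_cons ((a * t + b ord0 ord0)%R, x))).
  exact: (measurableT_comp mfc (measurable_pair1 _)).
rewrite (IH b')//.
congr (_ * _); apply: eq_integral => x _; congr f.
apply/colP => i; case: (unliftP ord0 i) => [j|] ->.
  rewrite cV_consS/= [RHS]mxE [X in _ = (X + _)%R]mxE cV_consS !mxE /=; congr (_ + _)%R.
by rewrite cV_cons0/= [RHS]mxE [X in _ = (X + _)%R]mxE cV_cons0.
Qed.

Lemma measurable_cV_cube n (a : R) :
  measurable [set x : 'cV[R]_n | forall i, (`|x i ord0| <= a)%R].
Proof.
rewrite (_ : [set _ | _] = \big[setI/setT]_(i < n) [set x : 'cV[R]_n | (`|x i ord0| <= a)%R]).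
  apply: bigsetI_measurable => i _; rewrite -[X in measurable X]setTI.
  apply: (@measurable_fun_ler _ _ R setT (fun x : 'cV[R]_n => `|x i ord0|%R) (cst a)
    _ _ _ [set true]) => //.
  by apply: measurableT_comp => //; exact: measurable_coord.
rewrite -bigcap_seq; apply/seteqP; split => [x H i _|x H i]; first exact: H.
by apply: (H i); rewrite /= mem_index_enum.
Qed.

Lemma lebesgue_cV_cube n (a : R) : (0 <= a)%R ->
  lebesgue_cV R n [set x : 'cV[R]_n | forall i, (`|x i ord0| <= a)%R] = ((2 * a) ^+ n)%:E.
Proof.
move=> a0; elim: n => [|n IH].
  by rewrite /= diracE mem_set// => -[].
have -> : lebesgue_cV R n.+1 [set x : 'cV[R]_n.+1 | forall i, (`|x i ord0| <= a)%R] =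
  (mu \x lebesgue_cV R n)%E ([set` `[- a, a]%R] `*` [set x : 'cV[R]_n | forall i, (`|x i ord0| <= a)%R]).
  rewrite /= /lebesgue_cV_step /pushforward; congr (_ _).
  apply/seteqP; split => [[t x] /= H|[t x] [/= Ht Hx] i].
    split=> [|i]; first by rewrite in_itv/= -ler_norml; have := H ord0; rewrite cV_cons0.
    by have := H (lift ord0 i); rewrite cV_consS.
  case: (unliftP ord0 i) => [j|] ->; first by rewrite cV_consS; exact: Hx.
  by rewrite cV_cons0/=; move: Ht; rewrite in_itv/= -ler_norml.
rewrite product_measure1E//; last exact: measurable_cV_cube.
rewrite IH /= lebesgue_measure_itv/= lte_fin -EFinB.
case: ifPn => [_|]; first by rewrite -EFinM exprS; congr (_ * _)%:E; ring.
rewrite -leNgt => an; have -> : a = 0%R by lra.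
by rewrite mulr0 mul0e expr0n.
Qed.

Lemma enorm_le_cube n (x : 'cV[R]_n) i : (`|x i ord0| <= enorm x)%R.
Proof.
rewrite -(ler_pXn2r (n := 2))// ?nnegrE ?sqrtr_ge0// sqr_sqrtr ?dotvv_ge0//.
by rewrite real_normK ?num_real// /dotv (bigD1 i)//= expr2 lerDl sumr_ge0// => j _; rewrite -expr2 sqr_ge0.
Qed.

Lemma measurable_enorm_ball n (r : R) : measurable [set x : 'cV[R]_n | (enorm x <= r)%R].
Proof.
rewrite -[X in measurable X]setTI.
apply: (@measurable_fun_ler _ _ R setT (@enorm R n) (cst r) _ _ _ [set true]) => //.
exact: measurable_enorm.
Qed.

Definition ball_volume n : R := fine (lebesgue_cV R n [set x | (enorm x <= 1)%R]).

Lemma lebesgue_cV_ball_lt_pinfty n (r : R) : lebesgue_cV R n [set x | (enorm x <= r)%R] < +oo.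
Proof.
apply: (@le_lt_trans _ _ (lebesgue_cV R n [set x : 'cV[R]_n | forall i, (`|x i ord0| <= `|r|)%R])).
  apply: (le_measure (lebesgue_cV R n) (mem_set (@measurable_enorm_ball n r))
    (mem_set (@measurable_cV_cube n `|r|))).
  by move=> x /= xr i; rewrite (le_trans (enorm_le_cube x i))// (le_trans xr)// ler_norm.
by rewrite lebesgue_cV_cube// ltry.
Qed.

Lemma lebesgue_cV_ball_gt0 n (r : R) : (0 < r)%R ->
  0 < lebesgue_cV R n [set x | (enorm x <= r)%R].
Proof.
move=> r0; have rn0 : (0 < r / n.+1%:R)%R by rewrite divr_gt0.
apply: (@lt_le_trans _ _ (lebesgue_cV R n [set x : 'cV[R]_n | forall i, (`|x i ord0| <= r / n.+1%:R)%R])).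
  by rewrite lebesgue_cV_cube ?ltW// lte_fin exprn_gt0// mulr_gt0.
apply: (le_measure (lebesgue_cV R n) (mem_set (@measurable_cV_cube n _))
  (mem_set (@measurable_enorm_ball n r))).
move=> x /= H; rewrite -(ler_pXn2r (n := 2))// ?nnegrE ?sqrtr_ge0 ?(ltW r0)//.
rewrite sqr_sqrtr ?dotvv_ge0//.
apply: (@le_trans _ _ (\sum_(i < n) (r / n.+1%:R) ^+ 2)%R).
  apply: ler_sum => i _; rewrite -expr2 -real_normK ?num_real//.
  by rewrite ler_pXn2r ?nnegrE ?(ltW rn0).
rewrite sumr_const card_ord expr_div_n -[X in (X <= _)%R]mulr_natl mulrCA ler_piMr ?sqr_ge0//.
rewrite ler_pdivrMr ?exprn_gt0// mul1r -natrX ler_nat.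
by rewrite (leq_trans (leqnSn n))// leq_pmulr.
Qed.

Lemma ball_volumeE n : lebesgue_cV R n [set x | (enorm x <= 1)%R] = (ball_volume n)%:E.
Proof. by rewrite fineK// ge0_fin_numE// lebesgue_cV_ball_lt_pinfty. Qed.

Lemma ball_volume_gt0 n : (0 < ball_volume n)%R.
Proof. by rewrite -lte_fin -ball_volumeE lebesgue_cV_ball_gt0. Qed.

Definition ball_pdf n (x : 'cV[R]_n) : R := (ball_volume n)^-1 * \1_[set x | (enorm x <= 1)%R] x.

Lemma ball_pdf_ge0 n (x : 'cV[R]_n) : (0 <= ball_pdf x)%R.
Proof. by rewrite mulr_ge0// ?invr_ge0 ?ltW ?ball_volume_gt0. Qed.

Lemma measurable_ball_pdf n : measurable_fun setT (@ball_pdf n).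
Proof.
by apply: measurable_funM => //; apply: measurable_indic; exact: measurable_enorm_ball.
Qed.

Lemma ge0_integral_unif_sphere n (f : 'cV[R]_n -> \bar R) :
  measurable_fun setT f -> (forall v, 0 <= f v) ->
  \int[unif_sphere R n]_v f v =
  \int[lebesgue_cV R n]_x ((ball_pdf x)%:E * f ((enorm x)^-1 *: x)%R).
Proof.
move=> mf f0; pose phi (x : 'cV[R]_n) := ((enorm x)^-1 *: x)%R.
have mphi : measurable_fun setT phi.
  by apply: measurable_scalecV => //; apply: measurable_invr; exact: measurable_enorm.
pose k x : {measure set 'cV[R]_n -> \bar R} := mscale (NngNum (ball_pdf_ge0 x)) (\d_(phi x)).
rewrite (@ge0_integral_mixture _ _ _ _ _ _ (lebesgue_cV R n) k)//.
- apply: eq_integral => x _; rewrite ge0_integral_mscale//=.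
  by rewrite integral_dirac// diracT mul1e.
- move=> A mA; rewrite /k /mscale/=; apply: emeasurable_funM.
    by apply/measurable_EFinP; exact: measurable_ball_pdf.
  apply/measurable_EFinP; apply: (measurableT_comp _ mphi) => //; exact: measurable_indic.
move=> A mA.
have mcone : measurable [set y | (enorm y <= 1)%R /\ A (phi y)].
  apply: measurableI; first exact: measurable_enorm_ball.
  by rewrite -[X in measurable X]setTI; exact: mphi.
have VT : cone_measure (d := n) (R := R) setT = (ball_volume n)%:E.
  by rewrite -ball_volumeE /cone_measure; congr (_ _); apply/seteqP; split=> x //= [].
transitivity (cone_measure A * ((ball_volume n)^-1)%:E).
  pose c : \bar R := cone_measure (d := n) setT.
  have : unif_sphere R n A = if (c == 0) || (c == +oo) then \d_(0%R : 'cV[R]_n) A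
      else cone_measure A * ((fine c)^-1)%:E.
    by rewrite /unif_sphere /= /mnormalize /c; case: ifP.
  by rewrite /c VT eqe gt_eqF ?ball_volume_gt0//= => <-.
rewrite muleC.
transitivity (\int[lebesgue_cV R n]_x
    ((ball_volume n)^-1%:E * (\1_[set y | (enorm y <= 1)%R /\ A (phi y)] x)%:E)).
  rewrite ge0_integralZl//; last 2 first.
  - by apply/measurable_EFinP; apply: measurable_indic; exact: mcone.
  - by rewrite lee_fin invr_ge0 ltW// ball_volume_gt0.
  by rewrite integral_indic ?setIT//; exact: mcone.
apply: eq_integral => x _.
transitivity ((ball_pdf x)%:E * (\1_A (phi x))%:E); last by [].
rewrite /ball_pdf EFinM -muleA; congr (_ * _).
rewrite -EFinM !indicE -natrM mulnb; congr (_%:R%:E); congr nat_of_bool.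
by apply/idP/andP => [/set_mem[? ?]|[/set_mem ? /set_mem ?]]; [split|]; apply/mem_set.
Qed.

End lebesgue_affine.

(** * The norm of the inverse covariance *)

Section precision_norm.
Context (R : realType) (d : nat) (C : 'M[R]_d) (Cpos : posdef C).
Implicit Types x y v : 'cV[R]_d.

Definition pip x y : R := dotv x (invmx C *m y).
Definition pnorm x : R := enorm (sqrtmx (invmx C) *m x).

Lemma dotv_sqrtmx_inv x y :
  dotv (sqrtmx (invmx C) *m x) (sqrtmx (invmx C) *m y) = pip x y.
Proof.
have [[ST _] SS] := sqrtmxP (posdef_inv Cpos).
by rewrite dotv_tr mulmxA ST SS /pip [RHS]dotv_tr trmx_inv Cpos.1.
Qed.

Lemma pipC x y : pip x y = pip y x.
Proof. by rewrite -!dotv_sqrtmx_inv dotvC. Qed.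
Lemma pipDl x y v : pip (x + y) v = pip x v + pip y v.
Proof. exact: dotvDl. Qed.
Lemma pipZl a x y : pip (a *: x) y = a * pip x y.
Proof. exact: dotvZl. Qed.
Lemma pipDr x y v : pip v (x + y) = pip v x + pip v y.
Proof. by rewrite !(pipC v) pipDl. Qed.
Lemma pipZr a x y : pip x (a *: y) = a * pip x y.
Proof. by rewrite pipC pipZl pipC. Qed.
Lemma pipNl x y : pip (- x) y = - pip x y.
Proof. by rewrite -scaleN1r pipZl mulN1r. Qed.
Lemma pipNr x y : pip x (- y) = - pip x y.
Proof. by rewrite pipC pipNl pipC. Qed.

Lemma pnorm_ge0 x : 0 <= pnorm x. Proof. exact: sqrtr_ge0. Qed.

Lemma sqr_pnorm x : pnorm x ^+ 2 = pip x x.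
Proof. by rewrite sqr_sqrtr ?dotvv_ge0// dotv_sqrtmx_inv. Qed.

Lemma pip_ge0 x : 0 <= pip x x. Proof. by rewrite -sqr_pnorm sqr_ge0. Qed.

Lemma pnorm0 : pnorm 0 = 0.
Proof. by apply/eqP; rewrite -sqrf_eq0 sqr_pnorm -(scale0r 0) pipZl mul0r. Qed.

Lemma pnorm_eq0 x : (pnorm x == 0) = (x == 0).
Proof.
apply/eqP/eqP => [x0|->]; last exact: pnorm0.
apply/eqP/negPn/negP => /(posdef_inv Cpos).2.
by rewrite -/(pip x x) -sqr_pnorm x0 expr0n ltxx.
Qed.

Lemma pnorm_gt0 x : (0 < pnorm x) = (x != 0).
Proof. by rewrite lt_neqAle pnorm_ge0 andbT eq_sym pnorm_eq0. Qed.

Lemma pnormZ a x : pnorm (a *: x) = `|a| * pnorm x.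
Proof.
apply/eqP; rewrite -(eqrXn2 (n := 2))// ?pnorm_ge0// ?mulr_ge0 ?pnorm_ge0//.
by rewrite exprMn !sqr_pnorm pipZl pipZr real_normK ?num_real// expr2 mulrA.
Qed.

Lemma pnormN x : pnorm (- x) = pnorm x.
Proof. by rewrite -scaleN1r pnormZ normrN normr1 mul1r. Qed.

Lemma cauchy_schwarz x y : `|pip x y| <= pnorm x * pnorm y.
Proof.
have [->|y0] := eqVneq y 0; first by rewrite -(scale0r 0) pipZr mul0r normr0 mulr_ge0 ?pnorm_ge0.
have py : 0 < pip y y by rewrite -sqr_pnorm exprn_gt0// pnorm_gt0.
rewrite -(ler_pXn2r (n := 2))// ?nnegrE ?mulr_ge0 ?pnorm_ge0//.
rewrite real_normK ?num_real// exprMn !sqr_pnorm.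
have := pip_ge0 (pip y y *: x - pip x y *: y).
rewrite pipDl !pipDr !pipNl !pipNr !pipZl !pipZr (pipC y x) => H.
by rewrite -(ler_pM2l py); lra.
Qed.

Lemma ler_pnormD x y : pnorm (x + y) <= pnorm x + pnorm y.
Proof.
rewrite -(ler_pXn2r (n := 2))// ?nnegrE ?addr_ge0 ?pnorm_ge0//.
rewrite sqrrD !sqr_pnorm pipDl !pipDr (pipC y x).
by have := cauchy_schwarz x y; rewrite ler_norml => /andP[_]; lra.
Qed.

Lemma ler_pnormB x y : pnorm x - pnorm y <= pnorm (x - y).
Proof. by rewrite lerBlDr (le_trans _ (ler_pnormD _ _))// subrK. Qed.

Lemma ler_dist_pnorm x y : `|pnorm x - pnorm y| <= pnorm (x - y).
Proof. by rewrite ler_norml ler_pnormB lerNl opprB -[leRHS]pnormN opprB ler_pnormB. Qed.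

Lemma enorm_pnorm x : Num.sqrt (mineig (invmx C)) * enorm x <= pnorm x.
Proof.
have [->|x0] := eqVneq x 0.
  by rewrite /enorm -(scale0r 0) dotvZl mul0r sqrtr0 mulr0 scale0r pnorm0.
have /andP[H _] := rayleigh_bounds x (posdef_inv Cpos).
by rewrite mulrC -sqrtrM ?dotvv_ge0// mulrC /pnorm /enorm dotv_sqrtmx_inv ler_wsqrtr.
Qed.

Lemma pnorm_enorm x : pnorm x <= Num.sqrt (maxeig (invmx C)) * enorm x.
Proof.
have /andP[_ H] := rayleigh_bounds x (posdef_inv Cpos).
by rewrite mulrC -sqrtrM ?dotvv_ge0// mulrC /pnorm {1}/enorm dotv_sqrtmx_inv ler_wsqrtr.
Qed.

Lemma enorm_eq0 x : (enorm x == 0) = (x == 0).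
Proof.
apply/eqP/eqP => [/eqP|->]; last by rewrite /enorm -(scale0r 0) dotvZl mul0r sqrtr0.
rewrite sqrtr_eq0 => x0; apply: dotvv_eq0.
by apply/eqP; rewrite eq_le x0 dotvv_ge0.
Qed.

Lemma enormZ a x : enorm (a *: x) = `|a| * enorm x.
Proof. by rewrite /enorm dotvZl dotvC dotvZl mulrA -expr2 sqrtrM ?sqr_ge0// sqrtr_sqr. Qed.

Lemma measurable_pnorm : measurable_fun setT pnorm.
Proof. by apply: measurable_enorm; exact: measurable_mulmxl. Qed.

Lemma measurable_pip d' (T : measurableType d') (f g : T -> 'cV[R]_d) :
  measurable_fun setT f -> measurable_fun setT g ->
  measurable_fun setT (fun t => pip (f t) (g t)).
Proof. by move=> mf mg; apply: measurable_dotv => //; exact: measurable_mulmxl. Qed.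

End precision_norm.

(** * The density of the Hit-and-Run kernel *)

Section standard_normal.
Context (R : realType).
Notation mu := (@lebesgue_measure R).

Definition psi (z : R) : R := normal_pdf 0 1 z.

Lemma psiE z : psi z = (Num.sqrt (2 * pi))^-1 * expR (- z ^+ 2 / 2).
Proof.
rewrite /psi normal_pdfE ?oner_eq0// /normal_peak /normal_fun subr0 expr1n mul1r.
by rewrite -[pi *+ 2]mulr_natl.
Qed.

Lemma psi_ge0 z : 0 <= psi z. Proof. exact: normal_pdf_ge0. Qed.

Lemma measurable_psi : measurable_fun setT psi.
Proof. exact: measurable_normal_pdf. Qed.

Lemma psiN z : psi (- z) = psi z. Proof. by rewrite !psiE sqrrN. Qed.

Lemma integral_psi : (\int[mu]_z (psi z)%:E = 1)%E.
Proof. exact: integral_normal_pdf. Qed.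

Lemma normal_pdf_psi (m s x : R) : 0 < s -> normal_pdf m s x = s^-1 * psi ((x - m) / s).
Proof.
move=> s0; rewrite psiE normal_pdfE ?gt_eqF// /normal_peak /normal_fun.
rewrite mulrA; congr (_ * expR _); last by field; rewrite gt_eqF.
rewrite -invfM; congr (_^-1); rewrite -mulrnAr sqrtrM ?sqr_ge0// sqrtr_sqr gtr0_norm//.
by rewrite -[pi *+ 2]mulr_natl.
Qed.

Lemma ge0_integral_normal_prob (m s : R) (f : R -> \bar R) : 0 < s ->
  measurable_fun setT f -> (forall x, 0 <= f x)%E ->
  (\int[normal_prob m s]_x f x = \int[mu]_z ((psi z)%:E * f (m + s * z)%R))%E.
Proof.
move=> s0 mf f0.
rewrite (@ge0_integral_density _ _ _ _ mu (normal_pdf m s))//; last 2 first.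
- exact: measurable_normal_pdf.
- by move=> y; exact: normal_pdf_ge0.
rewrite [LHS](@ge0_integral_lebesgue_affine R s m)//; last 3 first.
- by rewrite gt_eqF.
- by apply: emeasurable_funM => //; apply/measurable_EFinP; exact: measurable_normal_pdf.
- by move=> x; rewrite mule_ge0// lee_fin normal_pdf_ge0.
rewrite -ge0_integralZl//; last 2 first.
- apply: emeasurable_funM.
    apply/measurable_EFinP; apply: (measurableT_comp (measurable_normal_pdf m s)).
    by apply: measurable_funD => //; exact: measurable_funM.
  apply: (measurableT_comp mf).
  by apply: measurable_funD => //; exact: measurable_funM.
- by move=> x _; rewrite mule_ge0// lee_fin normal_pdf_ge0.
apply: eq_integral => z _; rewrite muleA -EFinM gtr0_norm// normal_pdf_psi//.
by rewrite mulrA divff ?gt_eqF// mul1r addrK mulrC mulKf ?gt_eqF// addrC.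
Qed.

End standard_normal.

Section hit_and_run_lines.
Context (R : realType) (d : nat) (C : 'M[R]_d) (Cpos : posdef C).
Notation V := 'cV[R]_d.
Notation mu := (@lebesgue_measure R).
Implicit Types x y v : V.
Local Notation pip := (pip C).
Local Notation pnorm := (pnorm C).

Definition line_point x v (z : R) : V :=
  x + (line_mean C (x, v) + line_sd C (x, v) * z) *: v.

Lemma line_meanE x v : line_mean C (x, v) = - pip x v / pnorm v ^+ 2.
Proof. by []. Qed.

Lemma line_sdE x v : line_sd C (x, v) = (pnorm v)^-1.
Proof. by []. Qed.

Lemma line_pointZ x v z (a : R) : 0 < a -> line_point x (a *: v) z = line_point x v z.
Proof.
move=> a0; have [->|v0] := eqVneq v 0; first by rewrite /line_point !scaler0.
rewrite /line_point !line_meanE !line_sdE scalerA; congr (_ + _ *: _).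
rewrite (pipZr Cpos) (pnormZ Cpos) gtr0_norm//.
field.
by rewrite (gt_eqF a0) (pnorm_eq0 Cpos) v0.
Qed.

Lemma measurable_line_point d' (T : measurableType d') (f g : T -> V) (h : T -> R) :
  measurable_fun setT f -> measurable_fun setT g -> measurable_fun setT h ->
  measurable_fun setT (fun t => line_point (f t) (g t) (h t)).
Proof.
move=> mf mg mh.
have mn : measurable_fun setT (fun t => (pnorm (g t))^-1).
  by apply: measurable_invr; exact: (measurableT_comp (measurable_pnorm C)).
apply: measurable_addcV => //; apply: measurable_scalecV => //.
under eq_fun do rewrite line_meanE line_sdE -exprVn.
apply: measurable_funD; last exact: measurable_funM.
apply: measurable_funM; last exact: measurable_funX.
by apply: measurableT_comp => //; exact: measurable_pip.
Qed.

Lemma integral_line_gaussian x v (f : V -> \bar R) :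
  measurable_fun setT f -> (forall y, 0 <= f y)%E ->
  (\int[line_gaussian C (x, v)]_h f (x + (h : R) *: v)%R =
   \int[mu]_z ((psi z)%:E * f (line_point x v z)))%E.
Proof.
move=> mf f0; have [v0|v0] := eqVneq v 0.
  have lT : line_gaussian C (x, v) setT = 1%E by exact: probability_setT.
  rewrite (eq_integral (cst (f x))); last by move=> h _; rewrite v0 scaler0 addr0.
  rewrite integral_cst// lT mule1.
  rewrite (eq_integral (fun z : measurableTypeR R => (psi z)%:E * f x)%E); last first.
    by move=> z _; rewrite /line_point v0 scaler0 addr0.
  rewrite ge0_integralZr//; last 2 first.
    by apply/measurable_EFinP; exact: measurable_psi.
    by move=> z _; rewrite lee_fin psi_ge0.
  by rewrite integral_psi mul1e.
rewrite -[LHS]/(\int[normal_prob (line_mean C (x, v)) (line_sd C (x, v))]_h f (x + (h : R) *: v)%R)%E.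
rewrite (ge0_integral_normal_prob _ _ (f := fun h => f (x + h *: v)))//.
  by rewrite line_sdE invr_gt0 (pnorm_gt0 Cpos).
apply: (measurableT_comp mf); apply: measurable_addcV => //.
exact: measurable_scalecV.
Qed.

Definition hr_op (f : V -> \bar R) x : \bar R := (\int[hit_and_run_kernel C x]_y f y)%E.

Lemma hr_opE (f : V -> \bar R) x :
  measurable_fun setT f -> (forall y, 0 <= f y)%E ->
  (hr_op f x = \int[unif_sphere R d]_v \int[mu]_z ((psi z)%:E * f (line_point x v z)))%E.
Proof.
move=> mf f0; rewrite /hr_op.
have mlp v : measurable_fun [set: measurableTypeR R] (fun h : measurableTypeR R => x + (h : R) *: v).
  by apply: measurable_addcV => //; exact: measurable_scalecV.
pose k v : {measure set V -> \bar R} :=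
  measure_function_pushforward__canonical__measure_function_Measure (line_gaussian C (x, v)) (mlp v).
have kfE v (g : V -> \bar R) : measurable_fun setT g -> (forall y, 0 <= g y)%E ->
    (\int[k v]_y g y = \int[mu]_z ((psi z)%:E * g (line_point x v z)))%E.
  move=> mg g0; rewrite -integral_line_gaussian//.
  by rewrite /k ge0_integral_pushforward//.
have kE v A : measurable A ->
    k v A = (\int[mu]_z ((psi z)%:E * (\1_A (line_point x v z))%:E))%E.
  move=> mA; transitivity (\int[k v]_y (\1_A y)%:E)%E; first by rewrite integral_indic// setIT.
  apply: kfE.
  - by apply/measurable_EFinP; exact: measurable_indic.
  - by move=> y; rewrite lee_fin.
rewrite (@ge0_integral_mixture _ _ _ _ _ _ (unif_sphere R d) k)//.
- by apply: eq_integral => v _; rewrite kfE.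
- move=> A mA; under eq_fun do rewrite kE//.
  apply: (measurable_fun_fubini_tonelli_F (fun p : V * measurableTypeR R =>
    (psi p.2)%:E * (\1_A (line_point x p.1 p.2))%:E)%E).
    apply: emeasurable_funM; apply/measurable_EFinP.
      exact: (measurableT_comp (@measurable_psi R) measurable_snd).
    apply: measurableT_comp; first exact: measurable_indic.
    exact: measurable_line_point.
  by move=> p; rewrite mule_ge0// lee_fin psi_ge0.
- move=> A mA; apply: eq_integral => v _; rewrite kE//.
  apply: (integral_line_gaussian x v (f := fun y => (\1_A y)%:E)).
  - by apply/measurable_EFinP; exact: measurable_indic.
  - by move=> y; rewrite lee_fin.
Qed.

Lemma measurable_line_integral (x : V) (f : V -> \bar R) :
  measurable_fun setT f -> (forall y, 0 <= f y)%E ->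
  measurable_fun setT (fun v => \int[mu]_z ((psi z)%:E * f (line_point x v z)))%E.
Proof.
move=> mf f0; apply: (measurable_fun_fubini_tonelli_F (fun p : V * measurableTypeR R =>
  (psi p.2)%:E * f (line_point x p.1 p.2))%E).
  apply: emeasurable_funM.
    by apply/measurable_EFinP; exact: (measurableT_comp (@measurable_psi R) measurable_snd).
  apply: (measurableT_comp mf).
  exact: measurable_line_point.
by move=> p; rewrite mule_ge0// lee_fin psi_ge0.
Qed.

Lemma hr_op_ball (f : V -> \bar R) x :
  measurable_fun setT f -> (forall y, 0 <= f y)%E ->
  (hr_op f x = \int[lebesgue_cV R d]_u
    ((ball_pdf u)%:E * \int[mu]_z ((psi z)%:E * f (line_point x u z))))%E.
Proof.
move=> mf f0; rewrite hr_opE// ge0_integral_unif_sphere; last 2 first.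
- exact: measurable_line_integral.
- by move=> v; apply: integral_ge0 => z _; rewrite mule_ge0// lee_fin psi_ge0.
apply: eq_integral => u _; congr (_ * _)%E; apply: eq_integral => z _.
have [->|u0] := eqVneq u 0; first by rewrite scaler0.
rewrite line_pointZ// invr_gt0 lt_neqAle eq_sym enorm_eq0 u0/=; exact: sqrtr_ge0.
Qed.

End hit_and_run_lines.

Section ge0_integral_setT.
Local Open Scope ereal_scope.
Context d (T : measurableType d) (R : realType) (m : {measure set T -> \bar R}).
Implicit Types f g : T -> \bar R.

Lemma ge0_integralTZl f k : measurable_fun setT f -> (forall x, 0 <= f x) -> 0 <= k ->
  \int[m]_x (k * f x) = k * \int[m]_x f x.
Proof. by move=> mf f0 k0; rewrite ge0_integralZl. Qed.

Lemma ge0_integralTZr f k : measurable_fun setT f -> (forall x, 0 <= f x) -> 0 <= k ->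
  \int[m]_x (f x * k) = \int[m]_x f x * k.
Proof. by move=> mf f0 k0; rewrite ge0_integralZr. Qed.

Lemma ge0_integralTD f g : measurable_fun setT f -> (forall x, 0 <= f x) ->
  measurable_fun setT g -> (forall x, 0 <= g x) ->
  \int[m]_x (f x + g x) = \int[m]_x f x + \int[m]_x g x.
Proof. by move=> mf f0 mg g0; rewrite ge0_integralD. Qed.

Lemma ge0_le_integralT f g : measurable_fun setT f -> (forall x, 0 <= f x) ->
  measurable_fun setT g -> (forall x, f x <= g x) ->
  \int[m]_x f x <= \int[m]_x g x.
Proof. by move=> mf f0 mg fg; apply: ge0_le_integral. Qed.

Lemma integralT_ge0 f : (forall x, 0 <= f x) -> 0 <= \int[m]_x f x.
Proof. by move=> f0; apply: integral_ge0. Qed.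

Lemma ge0_integral_eq_off_null f g N : measurable N -> m N = 0 ->
  measurable_fun setT f -> (forall x, 0 <= f x) ->
  measurable_fun setT g -> (forall x, 0 <= g x) ->
  (forall x, ~ N x -> f x = g x) -> \int[m]_x f x = \int[m]_x g x.
Proof.
move=> mN N0 mf f0 mg g0 fg; apply: ge0_ae_eq_integral => //.
exists N; split => // x /= fgx; apply: contrapT => Nx; apply: fgx => _; exact: fg.
Qed.

End ge0_integral_setT.

Section measurable_compositions.
Context (R : realType) (n : nat) d (T : measurableType d).
Implicit Types (h : T -> R) (f g : T -> 'cV[R]_n) (C : 'M[R]_n).

Lemma measurable_fun_pnorm C f : measurable_fun setT f ->
  measurable_fun setT (fun t => pnorm C (f t)).
Proof. exact: (measurableT_comp (measurable_pnorm C)). Qed.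

Lemma measurable_fun_psi h : measurable_fun setT h ->
  measurable_fun setT (fun t => psi (h t)).
Proof. exact: (measurableT_comp (@measurable_psi R)). Qed.

Lemma measurable_fun_ball_pdf f : measurable_fun setT f ->
  measurable_fun setT (fun t => ball_pdf (f t)).
Proof. exact: (measurableT_comp (@measurable_ball_pdf R n)). Qed.

Lemma measurable_subcV f g : measurable_fun setT f -> measurable_fun setT g ->
  measurable_fun setT (fun t => f t - g t).
Proof.
move=> mf mg; under eq_fun do rewrite -scaleN1r.
by apply: measurable_addcV => //; apply: measurable_scalecV.
Qed.

Lemma measurable_scaler_cV (a : R) :
  measurable_fun [set: 'cV[R]_n] ( *:%R a : 'cV[R]_n -> 'cV[R]_n).
Proof. by apply: (@measurable_scalecV R n _ _ (cst a) id). Qed.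

Lemma measurable_inv_id : measurable_fun [set: R] (@GRing.inv R).
Proof. have H := @measurable_invr R _ _ (fun t : R => t) (@measurable_id _ _ _); exact: H. Qed.

Lemma measurable_fun_norm h : measurable_fun setT h -> measurable_fun setT (fun t => `|h t|).
Proof. by move=> mh; apply: measurableT_comp. Qed.

Lemma measurable_fun_sqrt h : measurable_fun setT h ->
  measurable_fun setT (fun t => Num.sqrt (h t)).
Proof.
move=> mh; apply: (measurableT_comp (f := @Num.sqrt R)) => //.
by apply: continuous_measurable_fun; exact: sqrt_continuous.
Qed.

Lemma measurable_fun_expR h : measurable_fun setT h ->
  measurable_fun setT (fun t => expR (h t)).
Proof. by move=> mh; apply: measurableT_comp. Qed.

Lemma measurable_funNr h : measurable_fun setT h -> measurable_fun setT (fun t => - h t).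
Proof. by move=> mh; apply: measurableT_comp. Qed.

Lemma measurable_fun_natmul h k : measurable_fun setT h -> measurable_fun setT (fun t => h t *+ k).
Proof. by move=> mh; under eq_fun do rewrite -mulr_natr; exact: measurable_funM. Qed.

End measurable_compositions.

Ltac mfun := try assumption; lazymatch goal with
  | |- measurable_fun _ (fun _ => ?c) => exact: measurable_cst
  | |- measurable_fun _ (@psi _) => exact: measurable_psi
  | |- measurable_fun _ (@ball_pdf _ _) => exact: measurable_ball_pdf
  | |- measurable_fun _ (@pnorm _ _ _) => exact: measurable_pnorm
  | |- measurable_fun _ (GRing.scale _) =>
      exact: measurable_scaler_cV
  | |- measurable_fun _ GRing.inv => exact: measurable_inv_id
  | |- measurable_fun _ (cst _) => exact: measurable_cst
  | |- measurable_fun _ id => exact: measurable_id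
  | |- measurable_fun _ fst => exact: measurable_fst
  | |- measurable_fun _ snd => exact: measurable_snd
  | |- measurable_fun _ (fun t => t) => exact: measurable_id
  | |- measurable_fun _ (fun t => fst t) => exact: measurable_fst
  | |- measurable_fun _ (fun t => snd t) => exact: measurable_snd
  | |- measurable_fun _ (fun t => EFin _) => apply/measurable_EFinP; mfun
  | |- measurable_fun _ (fun t => mule _ _) => apply: emeasurable_funM; mfun
  | |- measurable_fun _ (fun t => adde _ _) => apply: emeasurable_funD; mfun
  | |- measurable_fun _ (fun t => GRing.mul _ _) => apply: measurable_funM; mfun
  | |- measurable_fun _ (fun t => GRing.scale _ _) => apply: measurable_scalecV; mfun
  | |- measurable_fun _ (fun t => GRing.inv _) => apply: measurable_invr; mfun
  | |- measurable_fun _ (fun t => GRing.exp _ _) => apply: measurable_funX; mfun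
  | |- measurable_fun _ (fun t => Num.norm _) => apply: measurable_fun_norm; mfun
  | |- measurable_fun _ (fun t => Num.sqrt _) => apply: measurable_fun_sqrt; mfun
  | |- measurable_fun _ (fun t => expR _) => apply: measurable_fun_expR; mfun
  | |- measurable_fun _ (fun t => enorm _) => apply: measurable_enorm; mfun
  | |- measurable_fun _ (fun t => pnorm _ _) => apply: measurable_fun_pnorm; mfun
  | |- measurable_fun _ (fun t => pip _ _ _) => apply: measurable_pip; mfun
  | |- measurable_fun _ (fun t => psi _) => apply: measurable_fun_psi; mfun
  | |- measurable_fun _ (fun t => ball_pdf _) => apply: measurable_fun_ball_pdf; mfun
  | |- measurable_fun _ (fun t => _ + - _) =>
      first [apply: measurable_subcV | apply: measurable_funB]; mfun
  | |- measurable_fun _ (fun t => GRing.opp _) => apply: measurable_funNr; mfun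
  | |- measurable_fun _ (fun t => _ + _) =>
      first [apply: measurable_addcV | apply: measurable_funD]; mfun
  | |- measurable_fun _ (fun t => _ *+ _) => apply: measurable_fun_natmul; mfun
  | |- measurable_fun _ (fun t => ?f _) =>
      apply: (@measurableT_comp _ _ _ _ _ _ f); mfun
  | |- _ => idtac
  end.

Section polar_density.
Context (R : realType) (d : nat) (C : 'M[R]_d) (Cpos : posdef C) (d0 : (0 < d)%N).
Notation V := 'cV[R]_d.
Notation mu := (@lebesgue_measure R).
Notation L := (lebesgue_cV R d).
Implicit Types x y v : V.
Local Notation pip := (pip C).
Local Notation pnorm := (pnorm C).

Lemma measurable_cV_set0 : measurable [set 0 : V].
Proof.
rewrite (_ : [set 0] = [set x : V | forall i, `|x i ord0| <= 0]); first exact: measurable_cV_cube.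
apply/seteqP; split => [x /= -> i|x /= x0]; first by rewrite mxE normr0.
by apply/colP => i; rewrite mxE; apply/eqP; rewrite -normr_le0.
Qed.

Lemma lebesgue_cV_set0 : L [set 0] = 0%E.
Proof.
apply/eqP; rewrite eq_le measure_ge0 andbT; apply/lee_addgt0Pr => e e0.
pose a := Num.min 1 e / 2.
have a0 : 0 < a by rewrite divr_gt0// lt_min ltr01.
have ae : (2 * a) ^+ d <= e.
  rewrite /a mulrC divfK// (le_trans (y := Num.min 1 e))//; last by rewrite ge_min lexx orbT.
  rewrite -[leRHS]expr1 ler_wiXn2l//; last by rewrite ge_min lexx.
  by rewrite le_min ler01 ltW.
rewrite add0e; apply: (@le_trans _ _ ((2 * a) ^+ d)%:E); last by rewrite lee_fin.
rewrite -lebesgue_cV_cube ?(ltW a0)//.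
apply: (le_measure L (mem_set measurable_cV_set0) (mem_set (@measurable_cV_cube _ d a))).
by move=> x /= -> i; rewrite mxE normr0 ltW.
Qed.

Definition line_pdf x r : R := pnorm r * psi (pip (x + r) r / pnorm r).

Definition radial_pdf (r : V) (t : R) : R := (`|t| ^+ d.+1)^-1 * ball_pdf (t^-1 *: r).

(* Up to a constant, the Lebesgue density of the kernel started at x: the Gaussian density of
   the line through x and z, times |z - x|^(1-d) from polar coordinates; the factor
   pnorm (z - x) / enorm (z - x) turns arc length into the unit of the standard normal. *)
Definition hr_shape x z : R :=
  pnorm (z - x) / enorm (z - x) ^+ d * psi (pip z (z - x) / pnorm (z - x)).

Lemma line_pdf_ge0 x r : 0 <= line_pdf x r.
Proof. by rewrite mulr_ge0 ?pnorm_ge0 ?psi_ge0. Qed.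

Lemma radial_pdf_ge0 r t : 0 <= radial_pdf r t.
Proof. by rewrite mulr_ge0 ?ball_pdf_ge0// invr_ge0 exprn_ge0. Qed.

Lemma hr_shape_ge0 x z : 0 <= hr_shape x z.
Proof. by rewrite mulr_ge0 ?psi_ge0// divr_ge0 ?pnorm_ge0// exprn_ge0// sqrtr_ge0. Qed.

Lemma measurable_line_pdf d' (T : measurableType d') (f g : T -> V) :
  measurable_fun setT f -> measurable_fun setT g ->
  measurable_fun setT (fun t => line_pdf (f t) (g t)).
Proof. by move=> mf mg; rewrite /line_pdf; mfun. Qed.

Lemma measurable_radial_pdf d' (T : measurableType d') (f : T -> V) (g : T -> R) :
  measurable_fun setT f -> measurable_fun setT g ->
  measurable_fun setT (fun t => radial_pdf (f t) (g t)).
Proof. by move=> mf mg; rewrite /radial_pdf; mfun. Qed.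

Lemma measurable_hr_shape d' (T : measurableType d') (f g : T -> V) :
  measurable_fun setT f -> measurable_fun setT g ->
  measurable_fun setT (fun t => hr_shape (f t) (g t)).
Proof. by move=> mf mg; rewrite /hr_shape; mfun. Qed.

Local Open Scope ereal_scope.

Lemma line_integral_reparam x u (f : V -> \bar R) : u != 0%R ->
  measurable_fun setT f -> (forall y, 0 <= f y) ->
  \int[mu]_z ((psi z)%:E * f (line_point C x u z)) =
  \int[mu]_t ((line_pdf x (t *: u) / `|t|)%:E * f (x + t *: u)%R).
Proof.
move=> u0 mf f0; have pu0 : (0 < pnorm u)%R by rewrite (pnorm_gt0 Cpos).
have pu := negbT (gt_eqF pu0).
rewrite (@ge0_integral_lebesgue_affine R (pnorm u) (pip x u / pnorm u))//; last 2 first.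
- apply: emeasurable_funM; first by mfun.
  by apply: (measurableT_comp mf); apply: measurable_line_point.
- by move=> z; rewrite mule_ge0// lee_fin psi_ge0.
rewrite -ge0_integralTZl//; last 2 first.
- apply: emeasurable_funM; first by mfun.
  by apply: (measurableT_comp mf); apply: measurable_line_point => //; mfun.
- by move=> z; rewrite mule_ge0// lee_fin psi_ge0.
apply: (@ge0_integral_eq_off_null _ (measurableTypeR R) R mu _ _ [set (0%R : R)]) => //.
- exact: lebesgue_measure_set1.
- apply: emeasurable_funM; first by mfun.
  apply: emeasurable_funM; first by mfun.
  by apply: (measurableT_comp mf); apply: measurable_line_point => //; mfun.
- by move=> z; rewrite mule_ge0 ?lee_fin// mule_ge0// lee_fin psi_ge0.
- apply: emeasurable_funM; last by mfun.
  apply/measurable_EFinP; apply: measurable_funM; last by mfun.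
  by apply: measurable_line_pdf; mfun.
- by move=> z; rewrite mule_ge0// lee_fin divr_ge0// line_pdf_ge0.
move=> t /eqP t0; rewrite muleA -EFinM; congr (_%:E * f _).
  have nt : (`|t| != 0)%R by rewrite normr_eq0.
  have psiE' : psi (pip (x + t *: u) (t *: u) / pnorm (t *: u)) =
      psi (pnorm u * t + pip x u / pnorm u).
    rewrite pipDl !(pipZr Cpos) pipZl -(sqr_pnorm Cpos) (pnormZ Cpos).
    have [tn|tp|/eqP] := ltgtP t 0%R; last by rewrite (negbTE t0).
      rewrite -psiN ltr0_norm//; congr psi; field.
      by rewrite pu lt_eqF.
    rewrite gtr0_norm//; congr psi; field.
    by rewrite pu gt_eqF.
  rewrite /line_pdf psiE' (pnormZ Cpos) ger0_norm ?(ltW pu0)//.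
  by field.
rewrite /line_point line_meanE line_sdE; congr (_ + _ *: _)%R.
by field.
Qed.

Lemma hr_op_radial x (f : V -> \bar R) :
  measurable_fun setT f -> (forall y, 0 <= f y) ->
  hr_op C f x = \int[L]_r (\int[mu]_t (radial_pdf r t)%:E *
    ((line_pdf x r)%:E * f (x + r)%R)).
Proof.
move=> mf f0; rewrite (hr_op_ball Cpos)//.
have mG : measurable_fun setT (fun p : V * measurableTypeR R =>
    (ball_pdf p.1)%:E * ((line_pdf x ((p.2 : R) *: p.1) / `|p.2 : R|)%:E *
      f (x + (p.2 : R) *: p.1)%R)).
  apply: emeasurable_funM; first by mfun.
  apply: emeasurable_funM; last by mfun.
  apply/measurable_EFinP; apply: measurable_funM; last by mfun.
  by apply: measurable_line_pdf; mfun.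
have G0 t u : 0 <= (line_pdf x (t *: u) / `|t|)%:E * f (x + t *: u)%R.
  by rewrite mule_ge0// lee_fin divr_ge0// line_pdf_ge0.
transitivity (\int[L]_u \int[mu]_t ((ball_pdf u)%:E *
    ((line_pdf x (t *: u) / `|t|)%:E * f (x + t *: u)%R))).
  apply: (@ge0_integral_eq_off_null _ V R L _ _ [set (0%R : V)]).
  - exact: measurable_cV_set0.
  - exact: lebesgue_cV_set0.
  - apply: emeasurable_funM; first by mfun.
    exact: measurable_line_integral.
  - move=> u; apply: mule_ge0; first by rewrite lee_fin ball_pdf_ge0.
    by apply: integralT_ge0 => z; rewrite mule_ge0// lee_fin psi_ge0.
  - apply: (measurable_fun_fubini_tonelli_F _ mG) => p.
    by rewrite mule_ge0 ?lee_fin ?ball_pdf_ge0.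
  - move=> u; apply: integralT_ge0 => t /=.
    by apply: mule_ge0; [rewrite lee_fin ball_pdf_ge0|exact: G0].
  - move=> u /eqP u0; rewrite line_integral_reparam// -ge0_integralTZl//.
    + apply: emeasurable_funM; last by mfun.
      apply/measurable_EFinP; apply: measurable_funM; last by mfun.
      by apply: measurable_line_pdf; mfun.
    + by rewrite lee_fin ball_pdf_ge0.
rewrite (fubini_tonelli (fun p : V * measurableTypeR R =>
    (ball_pdf p.1)%:E * ((line_pdf x ((p.2 : R) *: p.1) / `|p.2 : R|)%:E *
      f (x + (p.2 : R) *: p.1)%R)))//; last first.
  by move=> p; rewrite mule_ge0 ?lee_fin ?ball_pdf_ge0.
have mH : measurable_fun setT (fun p : V * measurableTypeR R =>
    (radial_pdf p.1 p.2)%:E * ((line_pdf x p.1)%:E * f (x + p.1)%R)).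
  apply: emeasurable_funM.
    by apply/measurable_EFinP; apply: measurable_radial_pdf; mfun.
  apply: emeasurable_funM; last by mfun.
  by apply/measurable_EFinP; apply: measurable_line_pdf; mfun.
have H0 (p : V * measurableTypeR R) :
    0 <= (radial_pdf p.1 p.2)%:E * ((line_pdf x p.1)%:E * f (x + p.1)%R).
  by rewrite mule_ge0 ?lee_fin ?radial_pdf_ge0// mule_ge0// lee_fin line_pdf_ge0.
transitivity (\int[L]_r \int[mu]_t ((radial_pdf r t)%:E *
    ((line_pdf x r)%:E * f (x + r)%R))); last first.
  apply: eq_integral => r _; rewrite ge0_integralTZr//.
  - by apply/measurable_EFinP; apply: measurable_radial_pdf; mfun.
  - by move=> t; rewrite lee_fin radial_pdf_ge0.
  - by rewrite mule_ge0 ?lee_fin ?line_pdf_ge0.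
apply: etrans (esym (fubini_tonelli _ mH H0)).
apply: eq_integral => t _ /=.
have [->|t0] := eqVneq t 0%R.
  rewrite integral0_eq; last first.
    by move=> u _; rewrite normr0 invr0 mulr0 mul0e mule0.
  rewrite integral0_eq// => r _.
  by rewrite /radial_pdf normr0 expr0n/= invr0 mul0r mul0e.
rewrite [LHS](@ge0_integral_lebesgue_cV_affine R d t^-1 0)//; last 3 first.
- by rewrite invr_neq0.
- apply: emeasurable_funM; first by mfun.
  apply: emeasurable_funM; last by mfun.
  apply/measurable_EFinP; apply: measurable_funM; last by mfun.
  by apply: measurable_line_pdf; mfun.
- by move=> u; rewrite mule_ge0 ?lee_fin ?ball_pdf_ge0.
rewrite -ge0_integralTZl//; last 2 first.
- apply: emeasurable_funM; first by mfun.
  apply: emeasurable_funM; last by mfun.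
  apply/measurable_EFinP; apply: measurable_funM; last by mfun.
  by apply: measurable_line_pdf; mfun.
- by move=> u; rewrite mule_ge0 ?lee_fin ?ball_pdf_ge0.
apply: eq_integral => r _; rewrite addr0 scalerA divff// scale1r !muleA -!EFinM.
congr (_%:E * _); rewrite /radial_pdf exprS invfM normfV exprVn.
by ring.
Qed.

Definition radial_cst : \bar R :=
  \int[mu]_t ((`|t| ^+ d.+1)^-1 * ((ball_volume R d)^-1 * (`|t^-1| <= 1)%R%:R))%:E.

Lemma measurable_radial_cst : measurable_fun [set: measurableTypeR R] (fun t : R =>
  ((`|t| ^+ d.+1)^-1 * ((ball_volume R d)^-1 * (`|t^-1| <= 1)%R%:R))%:E).
Proof.
have mt : measurable_fun [set: measurableTypeR R] (fun t : R => (`|t^-1| <= 1)%R).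
  by apply: measurable_fun_ler; mfun.
have mb : measurable_fun [set: measurableTypeR R] (fun t : R => (`|t^-1| <= 1)%R%:R : R).
  rewrite (_ : (fun t : R => _) = (fun t : R => if `|t^-1| <= 1 then 1 else 0)%R); last first.
    by apply/funext => t; case: ifP.
  by apply: measurable_fun_ifT.
by mfun.
Qed.

Lemma integral_radial_pdf r : r != 0%R ->
  \int[mu]_t (radial_pdf r t)%:E = ((enorm r ^+ d)^-1)%:E * radial_cst.
Proof.
move=> r0; have er : (enorm r != 0)%R by rewrite enorm_eq0.
have er0 : (0 <= enorm r)%R by exact: sqrtr_ge0.
have mR : measurable_fun [set: measurableTypeR R] (fun t => (radial_pdf r t)%:E).
  by apply/measurable_EFinP; apply: measurable_radial_pdf; mfun.
rewrite (@ge0_integral_lebesgue_affine R (enorm r) 0)//; last first.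
  by move=> t; rewrite lee_fin radial_pdf_ge0.
rewrite /radial_cst -!ge0_integralTZl//.
- apply: eq_integral => t _; rewrite -!EFinM addr0; congr EFin.
  rewrite /radial_pdf ger0_norm// normrM (ger0_norm er0) exprMn invfM.
  rewrite /ball_pdf indicE; have -> : (((enorm r * t)^-1 *: r \in
      [set x : V | (enorm x <= 1)%R]) = (`|t^-1| <= 1)%R).
    have E : enorm ((enorm r * t)^-1 *: r) = `|t^-1|%R.
      by rewrite enormZ invfM normrM mulrAC normfV (ger0_norm er0) mulVf// mul1r.
    by apply/idP/idP => [/set_mem/=|H]; [rewrite E|apply/mem_set; rewrite /= E].
  by rewrite exprS invfM -!mulrA mulVKf.
- exact: measurable_radial_cst.
- by move=> t; rewrite lee_fin mulr_ge0 ?invr_ge0 ?exprn_ge0// mulr_ge0// invr_ge0 ltW// ball_volume_gt0.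
- by rewrite lee_fin invr_ge0 exprn_ge0.
- by apply/measurable_EFinP; apply: measurable_radial_pdf; mfun.
- by move=> t; rewrite lee_fin radial_pdf_ge0.
Qed.

Lemma hr_op_density : exists2 c : R, (0 < c)%R & forall x (f : V -> \bar R),
  measurable_fun setT f -> (forall y, 0 <= f y) ->
  hr_op C f x = \int[L]_z ((c * hr_shape x z)%:E * f z).
Proof.
have c0 : 0 <= radial_cst.
  apply: integralT_ge0 => t; rewrite lee_fin mulr_ge0 ?invr_ge0 ?exprn_ge0//.
  by rewrite mulr_ge0// invr_ge0 ltW// ball_volume_gt0.
have hrE x (f : V -> \bar R) : measurable_fun setT f -> (forall y, 0 <= f y) ->
    hr_op C f x = radial_cst * \int[L]_z ((hr_shape x z)%:E * f z).
  move=> mf f0; rewrite hr_op_radial//.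
  rewrite [in RHS](@ge0_integral_lebesgue_cV_affine R d 1 x)//; last 2 first.
  - apply: emeasurable_funM; last by mfun.
    by apply/measurable_EFinP; apply: measurable_hr_shape; mfun.
  - by move=> z; rewrite mule_ge0// lee_fin hr_shape_ge0.
  have mG : measurable_fun setT (fun r : V =>
      (hr_shape x (1 *: r + x)%R)%:E * f (1 *: r + x)%R).
    apply: emeasurable_funM; last by mfun.
    by apply/measurable_EFinP; apply: measurable_hr_shape; mfun.
  have G0 (r : V) : 0 <= (hr_shape x (1 *: r + x)%R)%:E * f (1 *: r + x)%R.
    by rewrite mule_ge0// lee_fin hr_shape_ge0.
  rewrite normr1 expr1n mul1e -(ge0_integralTZl L mG G0 c0).
  apply: eq_integral => r _; rewrite scale1r (addrC r).
  have [->|r0] := eqVneq r 0%R.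
    rewrite /line_pdf /hr_shape addr0 subrr (pnorm0 Cpos) !mul0r !mul0e mule0.
    by rewrite mule0.
  rewrite (integral_radial_pdf r0); move: radial_cst => c.
  rewrite (muleC _ c) -!muleA; congr (_ * _).
  rewrite !muleA -!EFinM; congr (_%:E * _).
  rewrite /hr_shape /line_pdf (addrC x) addrK; ring.
have [h1 hoo] : radial_cst != 0 /\ radial_cst != +oo.
  have := @hrE 0%R (cst 1) (measurable_cst _) (fun=> lee01).
  have hT : hit_and_run_kernel C 0 setT = 1 by exact: prob_kernel.
  rewrite {1}/hr_op integral_cst// hT mule1.
  set I := \int[L]_z _ => H; split.
    by apply: contra_eq_neq H => ->; rewrite mul0e onee_eq0.
  have I0 : 0 <= I.
    by apply: integralT_ge0 => z; rewrite mule1 lee_fin hr_shape_ge0.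
  apply: contra_eq_neq H => ->.
  move: I0; rewrite le_eqVlt => /predU1P[<-|I0].
    by rewrite mule0 onee_eq0.
  by rewrite gt0_mulye.
have cfin : radial_cst \is a fin_num by rewrite ge0_fin_numE// ltey.
exists (fine radial_cst).
  by rewrite fine_gt0// lt_neqAle eq_sym h1 c0 ltey.
move=> x f mf f0; rewrite hrE// -{1}(fineK cfin) -ge0_integralTZl//.
- by apply: eq_integral => z _; rewrite EFinM muleA.
- apply: emeasurable_funM; last by mfun.
  by apply/measurable_EFinP; apply: measurable_hr_shape; mfun.
- by move=> z; rewrite mule_ge0// lee_fin hr_shape_ge0.
- by rewrite lee_fin fine_ge0.
Qed.

End polar_density.

(** * Iteration and invariance *)

Section kernel_iteration.
Local Open Scope ereal_scope.
Context d (T : measurableType d) (R : realType) (k : R.-pker T ~> T).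

Lemma ge0_integral_kernel_step (m : probability T R) (f : T -> \bar R) :
  measurable_fun setT f -> (forall x, 0 <= f x) ->
  \int[kernel_step k m]_x f x = \int[m]_x \int[k x]_y f y.
Proof.
move=> mf f0; apply: (@ge0_integral_mixture _ _ _ T T _ m k) => //.
by move=> A mA; exact: measurable_kernel.
Qed.

Definition kernel_op (f : T -> \bar R) x := \int[k x]_y f y.

Lemma measurable_kernel_op (f : T -> \bar R) :
  measurable_fun setT f -> (forall x, 0 <= f x) -> measurable_fun setT (kernel_op f).
Proof.
move=> mf f0; apply: measurable_fun_integral_kernel => //.
by move=> U mU; exact: measurable_kernel.
Qed.

Lemma kernel_op_ge0 (f : T -> \bar R) x : (forall x, 0 <= f x) -> 0 <= kernel_op f x.
Proof. by move=> f0; exact: integral_ge0. Qed.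

Lemma iter_kernel_op_ge0 (f : T -> \bar R) n x : (forall x, 0 <= f x) ->
  0 <= iter n kernel_op f x.
Proof. by move=> f0; elim: n x => // n IH x; exact: kernel_op_ge0. Qed.

Lemma measurable_iter_kernel_op (f : T -> \bar R) n :
  measurable_fun setT f -> (forall x, 0 <= f x) ->
  measurable_fun setT (iter n kernel_op f).
Proof.
move=> mf f0; elim: n => // n IH; apply: measurable_kernel_op => // x.
exact: iter_kernel_op_ge0.
Qed.

Lemma ge0_integral_kernel_law (m : probability T R) n (f : T -> \bar R) :
  measurable_fun setT f -> (forall x, 0 <= f x) ->
  \int[kernel_law k n m]_x f x = \int[m]_x iter n kernel_op f x.
Proof.
elim: n f => // n IH f mf f0; rewrite iterSr -IH.
- exact: ge0_integral_kernel_step.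
- exact: measurable_kernel_op.
- by move=> x; exact: kernel_op_ge0.
Qed.

End kernel_iteration.

Section gaussian_invariance.
Local Open Scope ereal_scope.
Context (R : realType) (d : nat) (C : 'M[R]_d) (Cpos : posdef C) (d0 : (0 < d)%N).
Notation V := 'cV[R]_d.
Notation L := (lebesgue_cV R d).
Local Notation pip := (pip C).
Local Notation pnorm := (pnorm C).

Lemma ge0_integral_gaussian (f : V -> \bar R) :
  measurable_fun setT f -> (forall x, 0 <= f x) ->
  \int[gaussian C]_x f x = \int[L]_x ((gaussian_pdf C x)%:E * f x).
Proof.
move=> mf f0; apply: (ge0_integral_density (mu := L)) => //.
- exact: measurable_gaussian_pdf.
- by move=> x; exact: gaussian_pdf_ge0.
Qed.

Lemma gaussian_pdfE x : gaussian_pdf C x =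
  (expR (- pip x x / 2) / Num.sqrt ((2 * pi) ^+ d * \det C))%R.
Proof. by []. Qed.

Lemma hr_shape_balance x z :
  (gaussian_pdf C x * hr_shape C x z = gaussian_pdf C z * hr_shape C z x)%R.
Proof.
have [->//|xz] := eqVneq x z.
have [r zE] : exists r, z = (x + r)%R by exists (z - x)%R; rewrite addrC subrK.
have zxr : (z - x)%R = r by rewrite zE addrAC subrr add0r.
have r0 : (pnorm r != 0)%R by rewrite (pnorm_eq0 Cpos) -zxr subr_eq0 eq_sym.
rewrite !gaussian_pdfE /hr_shape -(opprB z x) zxr (pnormN Cpos) (pipNr Cpos).
have -> : enorm (- r) = enorm r by rewrite -scaleN1r enormZ normrN normr1 mul1r.
have -> : psi (- pip x r / pnorm r) = psi (pip x r / pnorm r) by rewrite mulNr psiN.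
rewrite !psiE zE.
set K := Num.sqrt ((2 * pi) ^+ d * \det C); set s := (Num.sqrt (2 * pi))^-1%R.
set q := (pnorm r / enorm r ^+ d)%R.
suff E : (expR (- pip x x / 2) * expR (- (pip (x + r) r / pnorm r) ^+ 2 / 2) =
    expR (- pip (x + r) (x + r) / 2) * expR (- (pip x r / pnorm r) ^+ 2 / 2))%R.
  transitivity ((expR (- pip x x / 2) * expR (- (pip (x + r) r / pnorm r) ^+ 2 / 2)) * (K^-1 * q * s))%R.
    by ring.
  by rewrite E; ring.
rewrite -!expRD; congr expR.
rewrite !pipDl !(pipDr Cpos) (pipC Cpos r x) -(sqr_pnorm Cpos r).
by field.
Qed.

Lemma measurable_hr_op (f : V -> \bar R) :
  measurable_fun setT f -> (forall x, 0 <= f x) -> measurable_fun setT (hr_op C f).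
Proof. exact: (@measurable_kernel_op _ _ _ (hit_and_run_kernel C)). Qed.

Lemma hr_op_ge0 (f : V -> \bar R) x : (forall x, 0 <= f x) -> 0 <= hr_op C f x.
Proof. exact: (@kernel_op_ge0 _ _ _ (hit_and_run_kernel C)). Qed.

Lemma hr_op_cst (r : \bar R) x : hr_op C (cst r) x = r.
Proof.
have hT : hit_and_run_kernel C x setT = 1 by exact: prob_kernel.
by rewrite /hr_op integral_cst// hT mule1.
Qed.

Lemma gaussian_invariant (f : V -> \bar R) :
  measurable_fun setT f -> (forall x, 0 <= f x) ->
  \int[gaussian C]_x hr_op C f x = \int[gaussian C]_x f x.
Proof.
move=> mf f0; have [c c0 hrE] := hr_op_density Cpos d0.
have mg : measurable_fun [set: V] (fun x => (gaussian_pdf C x)%:E).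
  by apply/measurable_EFinP; exact: measurable_gaussian_pdf.
have g0 x : 0 <= (gaussian_pdf C x)%:E by rewrite lee_fin gaussian_pdf_ge0.
have ms (x : V) : measurable_fun [set: V] (fun z => (c * hr_shape C x z)%:E).
  by apply/measurable_EFinP; apply: measurable_funM => //; apply: measurable_hr_shape; mfun.
have s0 (x z : V) : 0 <= (c * hr_shape C x z)%:E.
  by rewrite lee_fin mulr_ge0 ?hr_shape_ge0// ltW.
rewrite !ge0_integral_gaussian//; last 2 first.
- exact: measurable_hr_op.
- by move=> x; exact: hr_op_ge0.
pose G (p : V * V) := (gaussian_pdf C p.1)%:E * ((c * hr_shape C p.1 p.2)%:E * f p.2).
have mG : measurable_fun setT G.
  apply: emeasurable_funM; first exact: (measurableT_comp mg measurable_fst).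
  apply: emeasurable_funM; last by mfun.
  apply/measurable_EFinP; apply: measurable_funM => //; apply: measurable_hr_shape; mfun.
have G0 p : 0 <= G p by rewrite mule_ge0// mule_ge0.
transitivity (\int[L]_x \int[L]_z G (x, z)).
  apply: eq_integral => x _; rewrite hrE// -ge0_integralTZl//.
  - by apply: emeasurable_funM.
  - by move=> z; rewrite mule_ge0.
rewrite (fubini_tonelli G mG G0); apply: eq_integral => z _.
transitivity (\int[L]_x (((gaussian_pdf C z)%:E * f z) * (c * hr_shape C z x)%:E)).
  apply: eq_integral => x _; rewrite /G/= muleA -EFinM mulrCA hr_shape_balance.
  by rewrite mulrCA EFinM -!muleA (muleC (f z)).
rewrite ge0_integralTZl//; last by rewrite mule_ge0.
rewrite -[RHS]mule1; congr (_ * _).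
have := hrE z (cst 1) (measurable_cst _) (fun=> lee01).
rewrite hr_op_cst => ->; apply: eq_integral => x _; by rewrite mule1.
Qed.

End gaussian_invariance.

(** * Two-step smoothing *)

Section relative_decrease.
Context (R : realType).
Implicit Types a b e s t h : R.

(* [a <= b + a * e] says that b >= a (1 - e), and holds trivially for e >= 1; it is multiplicative
   in this form without any smallness assumption on the errors. *)
Lemma relative_decreaseM a1 b1 e1 a2 b2 e2 :
  0 <= a1 -> 0 <= b1 -> 0 <= e1 -> 0 <= a2 -> 0 <= b2 -> 0 <= e2 ->
  a1 <= b1 + a1 * e1 -> a2 <= b2 + a2 * e2 ->
  a1 * a2 <= b1 * b2 + a1 * a2 * (e1 + e2).
Proof.
move=> a10 b10 e10 a20 b20 e20 H1 H2.
have [e|e] := leP 1 (e1 + e2).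
  rewrite (le_trans (y := a1 * a2 * (e1 + e2)))// ?ler_peMr ?mulr_ge0//.
  by rewrite lerDr mulr_ge0.
have H : (a1 * (1 - e1)) * (a2 * (1 - e2)) <= b1 * b2.
  apply: ler_pM; [| |lra|lra]; apply: mulr_ge0 => //; lra.
have : 0 <= a1 * a2 * (e1 * e2) by rewrite !mulr_ge0.
by lra.
Qed.

Lemma psi_relative s t e : `|t - s| <= e -> psi s <= psi t + psi s * ((`|s| + 1) * e).
Proof.
move=> ste; have e0 : 0 <= e by exact: le_trans ste.
have ps0 := psi_ge0 s; have pt0 := psi_ge0 t.
have [e1|e1] := leP 1 e.
  rewrite (le_trans (y := psi s * ((`|s| + 1) * e)))// ?lerDr//.
  rewrite ler_peMr//; have : 0 <= `|s| by []. by nra.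
have ptE : psi t = psi s * expR (- (t ^+ 2 - s ^+ 2) / 2).
  by rewrite !psiE -mulrA -expRD; congr (_ * expR _); field.
rewrite ptE -mulrDr ler_peMr// -lerBlDr.
rewrite mulNr; have := @expR_ge1Dx R (- ((t ^+ 2 - s ^+ 2) / 2)).
suff : (t ^+ 2 - s ^+ 2) / 2 <= (`|s| + 1) * e.
  by move: (_ / 2) (_ * e) => x y xy H; rewrite (le_trans _ H)// lerD2l lerN2.
have -> : (t ^+ 2 - s ^+ 2) / 2 = (t - s) * (s + (t - s) / 2) by field.
rewrite (le_trans (ler_norm _))// normrM mulrC ler_pM//.
rewrite (le_trans (ler_normD _ _))// lerD2l normrM (@ger0_norm _ 2^-1) ?invr_ge0//.
by rewrite ler_pdivrMr// mul1r (le_trans ste)// (le_trans (ltW e1))// ler1n.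
Qed.

Lemma bernoulli_ineq n t : 0 <= t -> t <= 1 -> 1 - n%:R * t <= (1 - t) ^+ n.
Proof.
move=> t0 t1; elim: n => [|n IH]; first by rewrite mul0r subr0 expr0.
rewrite exprS; apply: (le_trans (y := (1 - t) * (1 - n%:R * t))).
  have : 0 <= n%:R * t * t by rewrite !mulr_ge0.
  by rewrite -natr1; lra.
by rewrite ler_wpM2l// subr_ge0.
Qed.

Lemma invX_relative (n : nat) a b e : (0 < n)%N -> 0 < a -> 0 <= b -> 0 <= e ->
  b <= a + e -> a <= b + e -> (a ^+ n)^-1 <= (b ^+ n)^-1 + (a ^+ n)^-1 * (n%:R * (e / a)).
Proof.
move=> n0 a0 b0 e0 bae abe.
have an0 : 0 < (a ^+ n)^-1 by rewrite invr_gt0 exprn_gt0.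
have bn0 : 0 <= (b ^+ n)^-1 by rewrite invr_ge0 exprn_ge0.
have [e1|e1] := leP 1 (e / a).
  rewrite (le_trans (y := (a ^+ n)^-1 * (n%:R * (e / a))))// ?lerDr//.
  rewrite ler_peMr ?(ltW an0)// (le_trans e1)// ler_peMl ?(le_trans _ e1)//.
  by rewrite ler1n.
have t0 : 0 <= e / a by rewrite divr_ge0// ltW.
have ae : e < a by move: e1; rewrite ltr_pdivrMr// mul1r.
have [b00|bp] := eqVneq b 0.
  by move: abe; rewrite b00 add0r leNgt ae.
have b1 : 0 < b by rewrite lt_neqAle eq_sym bp.
have bern := bernoulli_ineq n t0 (ltW e1).
have : (1 - e / a) ^+ n <= (a / b) ^+ n.
  rewrite ler_pXn2r// ?nnegrE ?subr_ge0 ?(ltW e1)// ?divr_ge0// ?(ltW a0)//.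
  rewrite ler_pdivlMr//.
  have : (1 - e / a) * b <= (1 - e / a) * (a + e) by rewrite ler_wpM2l// subr_ge0 ltW.
  move=> H; apply: (le_trans H).
  have -> : (1 - e / a) * (a + e) = a - e ^+ 2 / a by field; rewrite gt_eqF.
  by rewrite lerBlDr lerDl divr_ge0 ?sqr_ge0 ?ltW.
move=> /(le_trans bern); rewrite expr_div_n => H.
have := ler_wpM2l (ltW an0) H.
by rewrite mulKf ?expf_neq0 ?gt_eqF// mulrBr mulr1 lerBlDr.
Qed.

Lemma share_relative h h' k e : 0 <= h -> 0 <= h' -> 0 <= k -> 0 <= e -> h <= h' + e ->
  h / (h + k) <= h' / (h' + k) + h / (h + k) * (e / h).
Proof.
move=> h0 h'0 k0 e0 hh'.
have [->|hn] := eqVneq h 0; first by rewrite !mul0r addr0 divr_ge0// addr_ge0.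
have hp : 0 < h by rewrite lt_neqAle eq_sym hn.
have hk : 0 < h + k by rewrite ltr_wpDr.
have -> : h / (h + k) * (e / h) = e / (h + k) by field; rewrite hn gt_eqF.
have [h'n|h'n] := eqVneq h' 0.
  by rewrite h'n mul0r add0r ler_pM2r ?invr_gt0// -(add0r e) -h'n.
have hk' : 0 < h' + k by rewrite ltr_wpDr// lt_neqAle eq_sym h'n.
rewrite -lerBlDr -mulrBl ler_pdivrMr// mulrAC ler_pdivlMr//.
have : 0 <= e * (h' + e - h + k) by rewrite mulr_ge0//; lra.
nra.
Qed.

End relative_decrease.

Section smoothing_pointwise.
Context (R : realType) (d : nat) (C : 'M[R]_d) (Cpos : posdef C) (d0 : (0 < d)%N).
Notation V := 'cV[R]_d.
Implicit Types x y z r delta : V.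

Lemma ler_enormD (n : nat) (u v : 'cV[R]_n) : enorm (u + v) <= enorm u + enorm v.
Proof.
have p1 : posdef (1%:M : 'M[R]_n).
  split=> [|x x0]; first by rewrite trmx1.
  rewrite mul1mx lt_neqAle dotvv_ge0 andbT eq_sym.
  by apply: contra_neq x0 => /dotvv_eq0.
have pE (w : 'cV[R]_n) : pnorm 1%:M w = enorm w.
  apply/eqP; rewrite -(eqrXn2 (n := 2)) ?pnorm_ge0 ?sqrtr_ge0// (sqr_pnorm p1) sqr_sqrtr ?dotvv_ge0//.
  by rewrite /pip invmx1 mul1mx.
by rewrite -!pE ler_pnormD.
Qed.

Local Notation pip := (pip C).
Local Notation pnorm := (pnorm C).
Local Notation hr_shape := (hr_shape C).

Definition kappa_rt : R := Num.sqrt (condition_number (invmx C)).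

Definition slope x z : R := pip z (z - x) / pnorm (z - x).

Lemma hr_shapeE x z :
  hr_shape x z = pnorm (z - x) / enorm (z - x) ^+ d * psi (slope x z).
Proof. by []. Qed.

Lemma hr_shape_diag x : hr_shape x x = 0.
Proof. by rewrite hr_shapeE subrr (pnorm0 Cpos) !mul0r. Qed.

Lemma kappa_rt_ge0 : 0 <= kappa_rt. Proof. exact: sqrtr_ge0. Qed.

Lemma enorm_ratio r delta : r != 0 -> enorm delta / enorm r <= kappa_rt * (pnorm delta / pnorm r).
Proof.
move=> r0; have er : 0 < enorm r by rewrite lt_neqAle eq_sym enorm_eq0 r0 sqrtr_ge0.
have pr : 0 < pnorm r by rewrite (pnorm_gt0 Cpos).
have m0 := mineig_gt0 d0 (posdef_inv Cpos).
have sm0 : 0 < Num.sqrt (mineig (invmx C)) by rewrite sqrtr_gt0.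
have H1 : enorm delta <= pnorm delta / Num.sqrt (mineig (invmx C)).
  by rewrite ler_pdivlMr// mulrC enorm_pnorm.
have H2 : (enorm r)^-1 <= Num.sqrt (maxeig (invmx C)) / pnorm r.
  by rewrite ler_pdivlMr// mulrC ler_pdivrMr// pnorm_enorm.
have -> : kappa_rt * (pnorm delta / pnorm r) = (pnorm delta / Num.sqrt (mineig (invmx C))) *
    (Num.sqrt (maxeig (invmx C)) / pnorm r).
  rewrite /kappa_rt /condition_number mulrC sqrtrM; last first.
    have /andP[H3 H4] := rayleigh_bounds r (posdef_inv Cpos).
    have rr : 0 < dotv r r by rewrite -sqrtr_gt0.
    by have := le_trans H3 H4; rewrite ler_pM2r// => /(le_trans (ltW m0)).
  rewrite sqrtrV ?(ltW m0)//; ring.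
by apply: ler_pM => //; rewrite ?sqrtr_ge0// ?divr_ge0 ?sqrtr_ge0 ?invr_ge0 ?(ltW er) ?pnorm_ge0.
Qed.

Lemma slope_source x z delta : z != x -> z != x + delta ->
  `|slope (x + delta) z - slope x z| <= 2 * pnorm delta * (pnorm x / pnorm (z - x) + 1).
Proof.
move=> zx zxd.
have [r rE] : exists r, z - x = r by exists (z - x).
have [r' r'E] : exists r', z - (x + delta) = r' by exists (z - (x + delta)).
have rr' : r - r' = delta by rewrite -rE -r'E; apply/matrixP => i j; rewrite !mxE; ring.
have zE : z = x + r by rewrite -rE addrC subrK.
have pr : 0 < pnorm r by rewrite (pnorm_gt0 Cpos) -rE subr_eq0.
have pr' : 0 < pnorm r' by rewrite (pnorm_gt0 Cpos) -r'E subr_eq0.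
have [w wdef] : exists w, w = (pnorm r')^-1 *: r' - (pnorm r)^-1 *: r by eexists.
have {wdef} wdef : w = (pnorm r')^-1 *: r' - (pnorm r)^-1 *: r by [].
have -> : slope (x + delta) z - slope x z = pip z w.
  by rewrite /slope rE r'E wdef (pipDr Cpos) (pipNr Cpos) !(pipZr Cpos) mulrC (mulrC (pip z r)).
have wE : w = ((pnorm r')^-1 - (pnorm r)^-1) *: r' - (pnorm r)^-1 *: (r - r').
  by rewrite wdef scalerBl scalerBr opprB addrA subrK.
have wle : pnorm w <= 2 * pnorm delta / pnorm r.
  rewrite wE (le_trans (ler_pnormD Cpos _ _))// (pnormN Cpos) !(pnormZ Cpos) rr'.
  rewrite (ger0_norm (_ : 0 <= (pnorm r)^-1)) ?invr_ge0 ?(ltW pr)//.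
  have -> : (pnorm r')^-1 - (pnorm r)^-1 = (pnorm r - pnorm r') / (pnorm r * pnorm r').
    by field; rewrite !gt_eqF.
  rewrite normrM (ger0_norm (_ : 0 <= (pnorm r * pnorm r')^-1)); last first.
    by rewrite invr_ge0 mulr_ge0 ?pnorm_ge0.
  have := ler_dist_pnorm Cpos r r'; rewrite rr' => H.
  have -> : `|pnorm r - pnorm r'| / (pnorm r * pnorm r') * pnorm r' = `|pnorm r - pnorm r'| / pnorm r.
    by field; rewrite !gt_eqF.
  rewrite [X in _ + X]mulrC -mulrDl ler_pM2r ?invr_gt0//; lra.
rewrite (le_trans (cauchy_schwarz Cpos _ _))//.
rewrite (le_trans (ler_wpM2l (pnorm_ge0 _ _) wle))//.
have pz : pnorm z <= pnorm x + pnorm r by rewrite {1}zE ler_pnormD.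
rewrite (le_trans (ler_wpM2r _ pz))//.
  by rewrite divr_ge0// ?pnorm_ge0// mulr_ge0 ?pnorm_ge0.
by rewrite le_eqVlt; apply/orP; left; apply/eqP; rewrite rE; field; rewrite gt_eqF.
Qed.

Definition shape_cost x z : R :=
  (d%:R * kappa_rt + 1) / pnorm (z - x) +
  (`|slope x z| + 1) * (2 * (pnorm x / pnorm (z - x) + 1)).

Lemma shape_cost_ge0 x z : 0 <= shape_cost x z.
Proof.
rewrite addr_ge0// ?divr_ge0 ?pnorm_ge0 ?addr_ge0 ?mulr_ge0 ?kappa_rt_ge0//.
by rewrite addr_ge0// divr_ge0 ?pnorm_ge0.
Qed.

Lemma hr_shape_source x z delta :
  hr_shape x z <= hr_shape (x + delta) z + hr_shape x z * (pnorm delta * shape_cost x z).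
Proof.
have [->|zx] := eqVneq z x.
  by rewrite hr_shape_diag mul0r addr0 hr_shape_ge0.
have pr : 0 < pnorm (z - x) by rewrite (pnorm_gt0 Cpos) subr_eq0.
have [zxd|zxd] := eqVneq z (x + delta).
  have pd : pnorm delta = pnorm (z - x) by rewrite zxd addrAC subrr add0r.
  rewrite (le_trans (y := hr_shape x z * (pnorm delta * shape_cost x z)))//; last first.
    by rewrite lerDr hr_shape_ge0.
  rewrite ler_peMr ?hr_shape_ge0// pd /shape_cost mulrDr.
  rewrite [X in _ <= X + _]mulrC divfK ?gt_eqF//.
  rewrite -addrA addrCA lerDl addr_ge0 ?mulr_ge0 ?kappa_rt_ge0 ?pnorm_ge0//.
  by rewrite !addr_ge0// divr_ge0 ?pnorm_ge0.
have [r rE] : exists r, z - x = r by exists (z - x).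
have [r' r'E] : exists r', z - (x + delta) = r' by exists (z - (x + delta)).
have rr' : r - r' = delta by rewrite -rE -r'E; apply/matrixP => i j; rewrite !mxE; ring.
have r'r : r' - r = - delta by rewrite -rr' opprB.
have Hpsi := psi_relative (slope_source zx zxd).
have Hn : pnorm r <= pnorm r' + pnorm r * (pnorm delta / pnorm r).
  rewrite [pnorm r * _]mulrC divfK; last by rewrite gt_eqF// -rE.
  rewrite -rr'.
  by have := ler_pnormB Cpos r r'; lra.
have er : 0 < enorm r by rewrite lt_neqAle eq_sym enorm_eq0 -rE subr_eq0 zx sqrtr_ge0.
have er' : 0 <= enorm r' by exact: sqrtr_ge0.
have Hp : (enorm r ^+ d)^-1 <= (enorm r' ^+ d)^-1 +
    (enorm r ^+ d)^-1 * (d%:R * (enorm delta / enorm r)).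
  apply: invX_relative => //; first exact: sqrtr_ge0.
    have -> : r' = r - delta by rewrite -rr' opprB addrCA subrr addr0.
    by rewrite (le_trans (ler_enormD _ _))// -scaleN1r enormZ normrN1 mul1r.
  have {1}-> : r = r' + delta by rewrite -rr' addrCA subrr addr0.
  exact: ler_enormD.
have [pd0 pi0] : 0 <= pnorm delta /\ 0 <= (pnorm r)^-1.
  by rewrite invr_ge0 !pnorm_ge0.
have k0 := kappa_rt_ge0.
have en0 : 0 <= (enorm r ^+ d)^-1 by rewrite invr_ge0 exprn_ge0 ?(ltW er).
have en0' : 0 <= (enorm r' ^+ d)^-1 by rewrite invr_ge0 exprn_ge0.
have e10 : 0 <= pnorm delta / pnorm r by rewrite mulr_ge0.
have e20 : 0 <= d%:R * (enorm delta / enorm r).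
  by rewrite mulr_ge0// divr_ge0 ?sqrtr_ge0// ltW.
have e30 : 0 <= (`|slope x z| + 1) * (2 * pnorm delta * (pnorm x / pnorm r + 1)).
  by rewrite mulr_ge0 ?addr_ge0// mulr_ge0 ?mulr_ge0// addr_ge0// mulr_ge0 ?pnorm_ge0.
have H12 := relative_decreaseM (pnorm_ge0 C r) (pnorm_ge0 C r') e10 en0 en0' e20 Hn Hp.
rewrite !rE in Hpsi.
have H123 := relative_decreaseM (mulr_ge0 (pnorm_ge0 C r) en0)
  (mulr_ge0 (pnorm_ge0 C r') en0') (addr_ge0 e10 e20) (psi_ge0 _) (psi_ge0 _) e30 H12 Hpsi.
rewrite !hr_shapeE rE r'E (le_trans H123)// lerD2l ler_wpM2l//.
  by rewrite mulr_ge0 ?psi_ge0// mulr_ge0 ?pnorm_ge0.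
rewrite /shape_cost rE.
have r0 : r != 0 by rewrite -rE subr_eq0.
have H := enorm_ratio delta r0.
have : d%:R * (enorm delta / enorm r) <= d%:R * (kappa_rt * (pnorm delta / pnorm r)).
  by rewrite ler_wpM2l.
move=> H'; have -> : pnorm delta * ((d%:R * kappa_rt + 1) / pnorm r +
    (`|slope x z| + 1) * (2 * (pnorm x / pnorm r + 1))) =
  pnorm delta / pnorm r + d%:R * (kappa_rt * (pnorm delta / pnorm r)) +
    (`|slope x z| + 1) * (2 * pnorm delta * (pnorm x / pnorm r + 1)) by ring.
by rewrite lerD2r lerD2l.
Qed.

Lemma hr_shape_translate x z delta :
  hr_shape x z <= hr_shape (x + delta) (z + delta) +
    hr_shape x z * (pnorm delta * (`|slope x z| + 1)).
Proof.
have rE : z + delta - (x + delta) = z - x by rewrite opprD addrACA subrr addr0.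
have [->|zx] := eqVneq z x.
  by rewrite hr_shape_diag mul0r addr0 hr_shape_ge0.
have pr : 0 < pnorm (z - x) by rewrite (pnorm_gt0 Cpos) subr_eq0.
have sd : `|slope (x + delta) (z + delta) - slope x z| <= pnorm delta.
  rewrite /slope rE -mulrBl pipDl addrAC subrr add0r normrM normfV.
  by rewrite (ger0_norm (pnorm_ge0 _ _)) ler_pdivrMr// cauchy_schwarz.
rewrite !hr_shapeE rE -!mulrA -!mulrDr; do 2 rewrite ler_wpM2l ?invr_ge0 ?exprn_ge0 ?sqrtr_ge0 ?pnorm_ge0//.
by rewrite [X in _ + _ * X]mulrC psi_relative.
Qed.

(* The two-step density at x -> z -> y is split in the proportions h : k, where h and k are the
   lengths of the two steps. The part weighted by h is compared by moving x only, the part weighted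
   by k by translating x and z together: the errors 1/h and 1/k then both become 1/(h + k),
   which, unlike 1/h, is integrable along the lines. *)
Definition share h k : R := h / (h + k).

Lemma two_step_source x z y delta :
  hr_shape x z * share (pnorm (z - x)) (pnorm (y - z)) <=
  hr_shape (x + delta) z * share (pnorm (z - (x + delta))) (pnorm (y - z)) +
  hr_shape x z * share (pnorm (z - x)) (pnorm (y - z)) *
  (pnorm delta * (shape_cost x z + (pnorm (z - x))^-1)).
Proof.
have H1 := hr_shape_source x z delta.
have pd : pnorm (z - x) <= pnorm (z - (x + delta)) + pnorm delta.
  by rewrite opprD addrA -{1}(subrK delta (z - x)) ler_pnormD.
have H2 := share_relative (pnorm_ge0 C (z - x)) (pnorm_ge0 C (z - (x + delta)))
  (pnorm_ge0 C (y - z)) (pnorm_ge0 C delta) pd.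
rewrite mulrDr; apply: relative_decreaseM => //.
- exact: hr_shape_ge0.
- exact: hr_shape_ge0.
- by rewrite mulr_ge0 ?pnorm_ge0 ?shape_cost_ge0.
- by rewrite divr_ge0 ?addr_ge0 ?pnorm_ge0.
- by rewrite divr_ge0 ?addr_ge0 ?pnorm_ge0.
- by rewrite divr_ge0 ?pnorm_ge0.
Qed.

Lemma two_step_translate x z y delta :
  hr_shape x z * (share (pnorm (y - z)) (pnorm (z - x)) * hr_shape z y) <=
  hr_shape (x + delta) (z + delta) *
   (share (pnorm (y - (z + delta))) (pnorm (z - x)) * hr_shape (z + delta) y) +
  hr_shape x z * (share (pnorm (y - z)) (pnorm (z - x)) * hr_shape z y) *
  (pnorm delta * ((`|slope x z| + 1) + (shape_cost z y + (pnorm (y - z))^-1))).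
Proof.
have H1 := hr_shape_translate x z delta.
have H2 := hr_shape_source z y delta.
have pd : pnorm (y - z) <= pnorm (y - (z + delta)) + pnorm delta.
  by rewrite opprD addrA -{1}(subrK delta (y - z)) ler_pnormD.
have H3 := share_relative (pnorm_ge0 C (y - z)) (pnorm_ge0 C (y - (z + delta)))
  (pnorm_ge0 C (z - x)) (pnorm_ge0 C delta) pd.
have s0 a b : 0 <= share (pnorm a) (pnorm b).
  by rewrite divr_ge0 ?addr_ge0 ?pnorm_ge0.
have c0 a b : 0 <= pnorm delta * shape_cost a b by rewrite mulr_ge0 ?pnorm_ge0 ?shape_cost_ge0.
have n0 a : 0 <= pnorm delta / pnorm a by rewrite divr_ge0 ?pnorm_ge0.
have H23 := relative_decreaseM (s0 _ _) (s0 _ _) (n0 _) (hr_shape_ge0 C _ _)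
  (hr_shape_ge0 C _ _) (c0 _ _) H3 H2.
have -> : pnorm delta * ((`|slope x z| + 1) + (shape_cost z y + (pnorm (y - z))^-1)) =
  pnorm delta * (`|slope x z| + 1) +
  (pnorm delta / pnorm (y - z) + pnorm delta * shape_cost z y) by ring.
apply: relative_decreaseM => //.
- exact: hr_shape_ge0.
- exact: hr_shape_ge0.
- by rewrite mulr_ge0 ?addr_ge0 ?pnorm_ge0.
- by rewrite mulr_ge0 ?hr_shape_ge0.
- by rewrite mulr_ge0 ?hr_shape_ge0.
- by rewrite addr_ge0.
Qed.

End smoothing_pointwise.

Section inverse_sqrt_singularity.
Context (R : realType).
Notation mu := (@lebesgue_measure R).
Implicit Types t s : R.

Definition isqrt t : R := (Num.sqrt `|t|)^-1.

Definition isqrt_trunc (n : nat) t : R :=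
  if ((4^-1 ^+ n < `|t|) && (`|t| <= 1)) then isqrt t else 0.

Lemma isqrt_ge0 t : 0 <= isqrt t. Proof. by rewrite invr_ge0 sqrtr_ge0. Qed.

Lemma isqrt_trunc_ge0 n t : 0 <= isqrt_trunc n t.
Proof. by rewrite /isqrt_trunc; case: ifP => // _; exact: isqrt_ge0. Qed.

Lemma measurable_isqrt : measurable_fun [set: measurableTypeR R] isqrt.
Proof. by rewrite /isqrt; mfun. Qed.

Lemma measurable_isqrt_trunc n : measurable_fun [set: measurableTypeR R] (isqrt_trunc n).
Proof.
apply: measurable_fun_ifT => //; last exact: measurable_isqrt.
by apply: measurable_and; [apply: measurable_fun_ltr|apply: measurable_fun_ler]; mfun.
Qed.

(* Self-similarity at scale 4: integrating gives I_(n+1) <= 4 + I_n / 2, hence I_n <= 8. *)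
Lemma isqrt_truncS n t :
  isqrt_trunc n.+1 t <= 2 * \1_`[-1, 1] t + 2 * isqrt_trunc n (4 * t + 0).
Proof.
have i0 : 0 <= isqrt_trunc n (4 * t + 0) by exact: isqrt_trunc_ge0.
rewrite indicE mem_setE/= in_itv/= -ler_norml addr0 in i0 *.
rewrite {1}/isqrt_trunc; case: ifPn => [/andP[tn t1]|_]; last first.
  by rewrite addr_ge0 ?mulr_ge0.
rewrite t1 mulr1.
have [t4|t4] := leP (4 * `|t|) 1; last first.
  rewrite -[leLHS]addr0 lerD ?mulr_ge0// /isqrt invf_ple ?posrE// ?sqrtr_gt0; last by lra.
  have -> : 2^-1 = Num.sqrt (2^-1 ^+ 2) :> R by rewrite sqrtr_sqr ger0_norm.
  rewrite ler_wsqrtr//; lra.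
rewrite /isqrt_trunc normrM ger0_norm// t4 andbT.
rewrite -[leLHS]add0r lerD//.
have -> : 4^-1 ^+ n < 4 * `|t|.
  by rewrite -ltr_pdivrMl// mulrC -exprSr.
rewrite /isqrt normrM (ger0_norm (_ : 0 <= 4 :> R))// sqrtrM// invfM.
have -> : Num.sqrt 4 = 2 :> R by rewrite (_ : 4 = 2 ^+ 2 :> R) ?sqrtr_sqr ?ger0_norm//; lra.
by rewrite mulrA mulfV// mul1r.
Qed.

Local Open Scope ereal_scope.

Lemma integral_isqrt_trunc n : \int[mu]_t (isqrt_trunc n t)%:E <= 8%:E.
Proof.
elim: n => [|n IH].
  rewrite integral0_eq// => t _; rewrite /isqrt_trunc expr0.
  by case: ltP => //= t1; rewrite leNgt t1.
have mn m : measurable_fun [set: measurableTypeR R] (fun t => (isqrt_trunc m t)%:E).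
  by apply/measurable_EFinP; exact: measurable_isqrt_trunc.
have n0 m t : 0 <= (isqrt_trunc m t)%:E by rewrite lee_fin isqrt_trunc_ge0.
have H : \int[mu]_t (isqrt_trunc n t)%:E = 4%:E * \int[mu]_t (isqrt_trunc n (4 * t + 0)%R)%:E.
  rewrite [LHS](@ge0_integral_lebesgue_affine R 4 0)//; last exact: mn.
  by rewrite ger0_norm.
have mn4 : measurable_fun [set: measurableTypeR R] (fun t => (isqrt_trunc n (4 * t + 0)%R)%:E).
  by apply: (measurableT_comp (mn n)); mfun.
have m1 : measurable_fun [set: measurableTypeR R] (fun t : R => (\1_`[(-1)%R, 1%R] t : R)%:E).
  by apply/measurable_EFinP; exact: measurable_indic.
apply: (@le_trans _ _ (\int[mu]_t (2%:E * (\1_`[(-1)%R, 1%R] t)%:E +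
    2%:E * (isqrt_trunc n (4 * t + 0)%R)%:E))).
  apply: ge0_le_integralT => //.
  - by apply: emeasurable_funD; apply: emeasurable_funM => //; exact: measurable_cst.
  - by move=> t; rewrite -!EFinM -EFinD lee_fin isqrt_truncS.
have mA : measurable_fun [set: measurableTypeR R]
    (fun t : R => (2 : R)%:E * (\1_`[(-1)%R, 1%R] t : R)%:E).
  by apply: emeasurable_funM => //; exact: measurable_cst.
have mB : measurable_fun [set: measurableTypeR R]
    (fun t : R => 2%:E * (isqrt_trunc n (4 * t + 0)%R)%:E).
  by apply: emeasurable_funM => //; exact: measurable_cst.
have A0 (t : R) : 0 <= (2 : R)%:E * (\1_`[(-1)%R, 1%R] t : R)%:E by rewrite mule_ge0// lee_fin.
have B0 (t : R) : 0 <= 2%:E * (isqrt_trunc n (4 * t + 0)%R)%:E by rewrite mule_ge0.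
rewrite (ge0_integralTD _ mA A0 mB B0).
have I0 (t : R) : 0 <= (\1_`[(-1)%R, 1%R] t : R)%:E by rewrite lee_fin.
have t0 : 0 <= (2 : R)%:E by rewrite lee_fin.
rewrite (ge0_integralTZl _ m1 I0 t0) (ge0_integralTZl _ mn4 (fun t => n0 _ _) t0).
rewrite integral_indic//= setIT lebesgue_measure_itv/= lte_fin.
move: IH; rewrite H.
have : 0 <= \int[mu]_t (isqrt_trunc n (4 * t + 0)%R)%:E by exact: integralT_ge0.
case: (\int[mu]_t _) => [r|//|//]; last first.
  by rewrite mulry gtr0_sg// mul1e leye_eq.
rewrite -!EFinM !lee_fin => r0 r8; rewrite ifT; last by lra.
rewrite -EFinB -EFinM -EFinD lee_fin; lra.
Qed.

Definition isqrt_unit t : R := (if `|t| <= 1 then isqrt t else 0)%R.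

Lemma measurable_isqrt_unit : measurable_fun [set: measurableTypeR R] isqrt_unit.
Proof.
by apply: measurable_fun_ifT => //; [apply: measurable_fun_ler; mfun|exact: measurable_isqrt].
Qed.

Lemma isqrt_unit_ge0 t : (0 <= isqrt_unit t)%R.
Proof. by rewrite /isqrt_unit; case: ifP => // _; exact: isqrt_ge0. Qed.

Lemma isqrt_trunc_homo t : {homo isqrt_trunc^~ t : n m / (n <= m)%N >-> (n <= m)%R}.
Proof.
move=> n m nm; rewrite /isqrt_trunc; case: ifPn => [/andP[tn ->]|_]; last first.
  by case: ifP => // _; exact: isqrt_ge0.
rewrite andbT ifT//; apply: le_lt_trans tn.
by apply: ler_wiXn2l => //; lra.
Qed.

Lemma integral_isqrt_unit : \int[mu]_t (isqrt_unit t)%:E <= 8%:E.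
Proof.
have -> : \int[mu]_t (isqrt_unit t)%:E = \int[mu]_t limn (fun n => (isqrt_trunc n t)%:E).
  apply: eq_integral => t _; apply/esym/cvg_lim => //.
  apply: cvg_near_cst.
  have [->|t0] := eqVneq t 0%R.
    by near=> n; rewrite /isqrt_trunc /isqrt_unit /isqrt normr0 sqrtr0 invr0; do 2 case: ifP.
  have t0' : (0 < `|t|)%R by rewrite normr_gt0.
  have : (fun n => 4^-1 ^+ n : R)%R @ \oo --> (0 : R)%R.
    by apply: cvg_expr; rewrite ger0_norm//; lra.
  move=> /cvgrPdist_lt/(_ _ t0')[N _ HN].
  exists N => // n /= Nn; rewrite /isqrt_trunc /isqrt_unit.
  have := HN n Nn; rewrite /= sub0r normrN ger0_norm ?exprn_ge0// => ->.
  by [].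
rewrite monotone_convergence//.
- apply: lime_le.
    apply: ereal_nondecreasing_is_cvgn => n m nm.
    apply: ge0_le_integralT.
    + by apply/measurable_EFinP; exact: measurable_isqrt_trunc.
    + by move=> t; rewrite lee_fin isqrt_trunc_ge0.
    + by apply/measurable_EFinP; exact: measurable_isqrt_trunc.
    + by move=> t; rewrite lee_fin isqrt_trunc_homo.
  by near=> n; exact: integral_isqrt_trunc.
- by move=> n; apply/measurable_EFinP; exact: measurable_isqrt_trunc.
- by move=> n t _; rewrite lee_fin isqrt_trunc_ge0.
- by move=> t _ n m nm; rewrite lee_fin isqrt_trunc_homo.
Unshelve. all: by end_near. Qed.

Lemma isqrt_le_unit t : (isqrt t <= 1 + isqrt_unit t)%R.
Proof.
rewrite /isqrt_unit; case: (leP `|t|%R 1%R) => [_|t1]; first by rewrite lerDr.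
rewrite addr0 /isqrt invf_le1 ?sqrtr_gt0 ?(lt_trans ltr01)//.
by rewrite -(@sqrtr1 R) ler_wsqrtr// ltW.
Qed.

Lemma psi_weight_le t : (psi t * (1 + `|t|) <= 2 * Num.sqrt 2 * normal_pdf 0 (Num.sqrt 2) t)%R.
Proof.
have s2 : (0 < Num.sqrt 2 :> R)%R by rewrite sqrtr_gt0.
rewrite normal_pdf_psi// subr0 !mulrA mulfK ?gt_eqF//.
have -> : psi t = (psi (t / Num.sqrt 2) * expR (- (t ^+ 2 / 4)))%R.
  rewrite !psiE -mulrA -expRD; congr (_ * expR _)%R.
  rewrite expr_div_n sqr_sqrtr//; by field.
rewrite [leRHS]mulrC -mulrA ler_wpM2l ?psi_ge0// mulrC.
rewrite expRN ler_pdivrMr ?expR_gt0//.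
apply: (@le_trans _ _ (2 * (1 + t ^+ 2 / 4))%R); last by rewrite ler_wpM2l// expR_ge1Dx.
have : (0 <= (`|t| - 1) ^+ 2)%R by rewrite sqr_ge0.
rewrite -[(t ^+ 2)%R](real_normK (num_real t)); move: `|t|%R => u.
have -> : ((u - 1) ^+ 2 = u ^+ 2 - 2 * u + 1)%R by ring.
move: (u ^+ 2)%R => w; lra.
Qed.

Lemma integral_psi_isqrt : exists2 K : R, (0 <= K)%R & forall m : R,
  \int[mu]_t ((psi t)%:E * ((1 + `|t|) * (1 + isqrt (t - m)))%:E) <= K%:E.
Proof.
pose a : R := (2 * Num.sqrt 2)%R; pose pk : R := normal_peak (Num.sqrt 2).
have a0 : (0 <= a)%R by rewrite mulr_ge0 ?sqrtr_ge0.
have pk0 : (0 <= pk)%R by exact: normal_peak_ge0.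
have s2 : (Num.sqrt 2 != 0 :> R)%R by rewrite gt_eqF// sqrtr_gt0.
exists (a * 2 + a * pk * 8)%R; first by rewrite addr_ge0// !mulr_ge0.
move=> m; pose q t := normal_pdf 0 (Num.sqrt 2) t : R.
have mq : measurable_fun [set: measurableTypeR R] (fun t => (q t)%:E).
  by apply/measurable_EFinP; exact: measurable_normal_pdf.
have q0 t : 0 <= (q t)%:E by rewrite lee_fin normal_pdf_ge0.
have mu' : measurable_fun [set: measurableTypeR R] (fun t : R => (isqrt_unit t)%:E).
  by apply/measurable_EFinP; exact: measurable_isqrt_unit.
have mum : measurable_fun [set: measurableTypeR R] (fun t : R => (isqrt_unit (t - m))%:E).
  by apply: (measurableT_comp mu'); mfun.
have u0 t : 0 <= (isqrt_unit t)%:E by rewrite lee_fin isqrt_unit_ge0.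
have mF : measurable_fun [set: measurableTypeR R]
    (fun t : R => (a * 2)%:E * (q t)%:E) by apply: emeasurable_funM => //; exact: measurable_cst.
have mG : measurable_fun [set: measurableTypeR R]
    (fun t : R => (a * pk)%:E * (isqrt_unit (t - m))%:E).
  by apply: emeasurable_funM => //; exact: measurable_cst.
have F0 t : 0 <= (a * 2)%:E * (q t)%:E by rewrite mule_ge0// lee_fin mulr_ge0.
have G0 t : 0 <= (a * pk)%:E * (isqrt_unit (t - m))%:E by rewrite mule_ge0// lee_fin mulr_ge0.
apply: (@le_trans _ _ (\int[mu]_t ((a * 2)%:E * (q t)%:E + (a * pk)%:E * (isqrt_unit (t - m))%:E))).
  apply: ge0_le_integralT.
  - apply: emeasurable_funM; first by mfun.
    apply/measurable_EFinP; apply: measurable_funM; first by mfun.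
    apply: measurable_funD; first by mfun.
    by apply: (measurableT_comp measurable_isqrt); mfun.
  - move=> t; rewrite mule_ge0// lee_fin ?psi_ge0// mulr_ge0 ?addr_ge0//; exact: isqrt_ge0.
  - exact: emeasurable_funD.
  - move=> t; rewrite -!EFinM -EFinD lee_fin mulrA.
    apply: (@le_trans _ _ (a * q t * (2 + isqrt_unit (t - m)))%R).
      apply: ler_pM.
      + by rewrite mulr_ge0 ?psi_ge0// addr_ge0.
      + by rewrite addr_ge0// isqrt_ge0.
      + exact: psi_weight_le.
      + by have := isqrt_le_unit (t - m); lra.
    rewrite mulrDr; apply: lerD; first by rewrite mulrAC.
    apply: ler_wpM2r; first exact: isqrt_unit_ge0.
    apply: ler_wpM2l; [exact: a0|exact: normal_pdf_ub].
rewrite (ge0_integralTD _ mF F0 mG G0).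
have a20 : 0 <= (a * 2)%:E by rewrite lee_fin mulr_ge0.
have ap0 : 0 <= (a * pk)%:E by rewrite lee_fin mulr_ge0.
rewrite (ge0_integralTZl _ mq q0 a20) (ge0_integralTZl _ mum (fun t => u0 _) ap0).
rewrite (integral_normal_pdf 0 (Num.sqrt 2)) mule1 EFinD leeD2l//.
rewrite [leRHS]EFinM lee_wpmul2l//.
have <- : \int[mu]_t (isqrt_unit t)%:E = \int[mu]_t (isqrt_unit (t - m))%:E.
  rewrite (@ge0_integral_lebesgue_affine R 1 (- m))//.
  by rewrite normr1 mul1e; apply: eq_integral => t _; rewrite mul1r.
exact: integral_isqrt_unit.
Qed.

End inverse_sqrt_singularity.

Section smoothing.
Context (R : realType) (d : nat) (C : 'M[R]_d) (Cpos : posdef C) (d0 : (0 < d)%N).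
Notation V := 'cV[R]_d.
Notation L := (lebesgue_cV R d).
Notation mu := (@lebesgue_measure R).
Implicit Types x y z delta : V.
Local Notation pip := (pip C).
Local Notation pnorm := (pnorm C).
Local Notation hr_shape := (hr_shape C).
Local Notation slope := (slope C).
Local Notation shape_cost := (shape_cost C).

Definition smooth_dim : R := d%:R * kappa_rt C + 2.

Definition singular_weight x z : R := (1 + `|slope x z|) * (1 + isqrt (pnorm (z - x))).

Lemma singular_weight_ge0 x z : 0 <= singular_weight x z.
Proof. by rewrite mulr_ge0 ?addr_ge0// isqrt_ge0. Qed.

Lemma smooth_dim_ge2 : 2 <= smooth_dim.
Proof. by rewrite lerDr mulr_ge0// kappa_rt_ge0. Qed.

Lemma inv_sum_le_isqrt (h k : R) : 0 < h -> 0 < k -> (h + k)^-1 <= isqrt h * isqrt k.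
Proof.
move=> h0 k0; rewrite /isqrt !gtr0_norm// -invfM lef_pV2 ?posrE ?addr_gt0 ?mulr_gt0 ?sqrtr_gt0//.
have := sqr_ge0 (Num.sqrt h - Num.sqrt k).
rewrite sqrrB !sqr_sqrtr ?(ltW h0) ?(ltW k0)// => H.
have : 0 <= Num.sqrt h * Num.sqrt k by rewrite mulr_ge0 ?sqrtr_ge0.
by move: H; rewrite mulr2n; move: (_ * _) => w; lra.
Qed.

Lemma two_step_cost x z y : hr_shape x z * hr_shape z y *
  (share (pnorm (z - x)) (pnorm (y - z)) * (shape_cost x z + (pnorm (z - x))^-1) +
   share (pnorm (y - z)) (pnorm (z - x)) *
     ((`|slope x z| + 1) + (shape_cost z y + (pnorm (y - z))^-1))) <=
  hr_shape x z * hr_shape z y *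
    (6 * (smooth_dim + pnorm x) * (singular_weight x z * singular_weight z y)).
Proof.
have [->|zx] := eqVneq z x; first by rewrite (hr_shape_diag Cpos) !mul0r.
have [->|yz] := eqVneq y z; first by rewrite (hr_shape_diag Cpos) mulr0 !mul0r.
apply: ler_wpM2l; first by rewrite mulr_ge0 ?hr_shape_ge0.
rewrite /shape_cost /singular_weight.
have h1p : 0 < pnorm (z - x) by rewrite (pnorm_gt0 Cpos) subr_eq0.
have h2p : 0 < pnorm (y - z) by rewrite (pnorm_gt0 Cpos) subr_eq0.
have zX : pnorm z <= pnorm x + pnorm (z - x).
  by rewrite -{1}(subrK x z) addrC ler_pnormD.
have D2 := smooth_dim_ge2.
have DE : d%:R * kappa_rt C = smooth_dim - 2 by rewrite /smooth_dim addrK.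
have X0 : 0 <= pnorm x by exact: pnorm_ge0.
have w1 := inv_sum_le_isqrt h1p h2p.
have b10 : 0 <= isqrt (pnorm (z - x)) by exact: isqrt_ge0.
have b20 : 0 <= isqrt (pnorm (y - z)) by exact: isqrt_ge0.
have S10 : 0 <= `|slope x z| by [].
have S20 : 0 <= `|slope z y| by [].
rewrite /share DE (addrC (pnorm (y - z))).
move: (pnorm (z - x)) (pnorm (y - z)) (pnorm x) (pnorm z) `|slope x z| `|slope z y|
  (isqrt (pnorm (z - x))) (isqrt (pnorm (y - z))) smooth_dim h1p h2p zX D2 X0 w1 b10 b20 S10 S20 => {DE zx yz}.
move=> h1 h2 X Z S1 S2 b1 b2 D h1p h2p zX D2 X0 w1 b10 b20 S10 S20.
have hs : 0 < h1 + h2 by rewrite addr_gt0.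
pose w := (h1 + h2)^-1.
have w0 : 0 <= w by rewrite invr_ge0 ltW.
have wh1 : w * h1 <= 1 by rewrite mulrC ler_pdivrMr// mul1r lerDl ltW.
have wh2 : w * h2 <= 1 by rewrite mulrC ler_pdivrMr// mul1r lerDr ltW.
have wZ : w * Z <= X * (b1 * b2) + 1.
  rewrite (le_trans (ler_wpM2l w0 zX))// mulrDr lerD// mulrC ler_wpM2l//; exact: w1.
have -> : h1 / (h1 + h2) * ((D - 2 + 1) / h1 + (S1 + 1) * (2 * (X / h1 + 1)) + h1^-1) =
  D * w + 2 * (S1 + 1) * (w * X + w * h1).
  by rewrite /w; field; rewrite !gt_eqF.
have -> : h2 / (h1 + h2) * (S1 + 1 + ((D - 2 + 1) / h2 + (S2 + 1) * (2 * (Z / h2 + 1)) + h2^-1)) =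
  (S1 + 1) * (w * h2) + D * w + 2 * (S2 + 1) * (w * Z + w * h2).
  by rewrite /w; field; rewrite !gt_eqF.
pose P := (1 + S1) * (1 + S2) * (1 + b1 * b2).
have bb0 : 0 <= b1 * b2 by rewrite mulr_ge0.
have T1 : 1 <= 1 + S1 by rewrite lerDl.
have T2 : 1 <= 1 + S2 by rewrite lerDl.
have P1 : (1 + S1) * (1 + b1 * b2) <= P.
  by rewrite /P -mulrA (mulrC (1 + S2)) mulrA ler_peMr// mulr_ge0// addr_ge0.
have P2 : (1 + S2) * (1 + b1 * b2) <= P.
  by rewrite /P -mulrA ler_peMl// mulr_ge0// addr_ge0.
have P3 : b1 * b2 <= P.
  rewrite (le_trans _ P1)//; apply: (le_trans (y := 1 * (1 + b1 * b2))).
    by rewrite mul1r lerDr.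
  by rewrite ler_wpM2r// addr_ge0.
have PB : P <= (1 + S1) * (1 + b1) * ((1 + S2) * (1 + b2)).
  rewrite [leRHS]mulrACA /P ler_wpM2l ?mulr_ge0 ?addr_ge0//.
  have -> : (1 + b1) * (1 + b2) = 1 + b1 * b2 + (b1 + b2) by ring.
  by rewrite lerDl addr_ge0.
apply: (le_trans (y := 6 * (D + X) * P)); last first.
  by rewrite ler_wpM2l// mulr_ge0// addr_ge0// (le_trans _ D2).
have P0 : 0 <= P by rewrite (le_trans bb0).
have Dw : D * w <= D * P by rewrite ler_wpM2l ?(le_trans w1)// (le_trans _ D2).
have P4 : 1 + S1 <= P.
  rewrite (le_trans _ P1)// ler_peMr ?lerDl// addr_ge0//.
have P5 : 1 + S2 <= P.
  rewrite (le_trans _ P2)// ler_peMr ?lerDl// addr_ge0//.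
have T1b : (1 + S1) * (b1 * b2) <= P.
  by rewrite (le_trans _ P1)// ler_wpM2l ?addr_ge0// lerDr.
have T2b : (1 + S2) * (b1 * b2) <= P.
  by rewrite (le_trans _ P2)// ler_wpM2l ?addr_ge0// lerDr.
have wX : w * X <= X * (b1 * b2) by rewrite mulrC ler_wpM2l//; exact: w1.
have XT1 : X * ((1 + S1) * (b1 * b2)) <= X * P by rewrite ler_wpM2l.
have XT2 : X * ((1 + S2) * (b1 * b2)) <= X * P by rewrite ler_wpM2l.
have q1 : (S1 + 1) * (w * X + w * h1) <= X * P + P.
  rewrite mulrDr addrC (addrC (X * P)); apply: lerD.
    by rewrite (le_trans (ler_wpM2l _ wh1)) ?addr_ge0// mulr1 addrC.
  rewrite (le_trans _ XT1)//.
  have -> : X * ((1 + S1) * (b1 * b2)) = (S1 + 1) * (X * (b1 * b2)) by ring.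
  by rewrite ler_wpM2l ?addr_ge0.
have q2 : (S1 + 1) * (w * h2) <= P.
  by rewrite (le_trans (ler_wpM2l _ wh2)) ?addr_ge0// mulr1 addrC.
have q3 : (S2 + 1) * (w * Z + w * h2) <= X * P + 2 * P.
  apply: (le_trans (y := (S2 + 1) * (X * (b1 * b2) + 2))).
    by rewrite ler_wpM2l ?addr_ge0//; lra.
  rewrite mulrDr; apply: lerD; first by rewrite mulrCA (addrC S2).
  by rewrite mulrC ler_wpM2l// addrC.
have DP : 0 <= (D - 2) * P by rewrite mulr_ge0// subr_ge0.
have XP : 0 <= X * P by rewrite mulr_ge0.
have DPE : (D - 2) * P = D * P - 2 * P by ring.
have -> : 6 * (D + X) * P = 6 * (D * P) + 6 * (X * P) by ring.
rewrite -!(mulrA 2); move: q1 q2 q3 Dw DP XP; rewrite DPE.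
move: (D * P) (X * P) (D * w) ((S1 + 1) * _) ((S1 + 1) * _) ((S2 + 1) * _).
move=> DP XP Dw q1 q2 q3; lra.
Qed.

End smoothing.

Section smoothing_integrated.
Local Open Scope ereal_scope.
Context (R : realType) (d : nat) (C : 'M[R]_d) (Cpos : posdef C) (d0 : (0 < d)%N).
Notation V := 'cV[R]_d.
Notation L := (lebesgue_cV R d).
Notation mu := (@lebesgue_measure R).
Implicit Types x y z delta : V.
Local Notation pip := (pip C).
Local Notation pnorm := (pnorm C).
Local Notation hr_shape := (hr_shape C).
Local Notation slope := (slope C).
Local Notation shape_cost := (shape_cost C).

Lemma measurable_slope d' (T : measurableType d') (f g : T -> V) :
  measurable_fun setT f -> measurable_fun setT g ->
  measurable_fun setT (fun t => slope (f t) (g t)).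
Proof. by move=> mf mg; rewrite /slope; mfun. Qed.

Lemma measurable_singular_weight d' (T : measurableType d') (f g : T -> V) :
  measurable_fun setT f -> measurable_fun setT g ->
  measurable_fun setT (fun t => singular_weight C (f t) (g t)).
Proof.
move=> mf mg; rewrite /singular_weight /isqrt.
apply: measurable_funM; last by mfun.
apply: measurable_funD; first by mfun.
by apply: measurable_fun_norm; exact: measurable_slope.
Qed.

Lemma singular_weight_line x v t :
  (singular_weight C x (line_point C x v t) <=
   (1 + `|t|) * (1 + isqrt (t - pip x v / pnorm v)))%R.
Proof.
rewrite /singular_weight /slope; set r := (line_point C x v t - x)%R.
have rE : r = ((line_mean C (x, v) + line_sd C (x, v) * t) *: v)%R.
  by rewrite /r /line_point addrAC subrr add0r.
have [v0|v0] := eqVneq v 0%R.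
  rewrite rE v0 scaler0 (pnorm0 Cpos) invr0 mulr0 normr0 addr0 mul1r /isqrt normr0 sqrtr0 invr0 addr0.
  rewrite -[leLHS]mulr1 ler_pM// lerDl//; exact: isqrt_ge0.
have pv : (0 < pnorm v)%R by rewrite (pnorm_gt0 Cpos).
set a := (line_mean C (x, v) + line_sd C (x, v) * t)%R in rE.
have aE : (a * pnorm v = t - pip x v / pnorm v)%R.
  by rewrite /a line_meanE line_sdE; field; rewrite gt_eqF.
have nr : pnorm r = `|t - pip x v / pnorm v|%R.
  by rewrite rE (pnormZ Cpos) -aE normrM (ger0_norm (ltW pv)).
have -> : isqrt (pnorm r) = isqrt (t - pip x v / pnorm v)%R by rewrite nr /isqrt normr_id.
apply: ler_wpM2r; first by rewrite addr_ge0// isqrt_ge0.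
rewrite lerD2l.
have lpE : line_point C x v t = (x + r)%R by rewrite /r addrC subrK.
have [a0|a0] := eqVneq a 0%R.
  by rewrite rE a0 scale0r (pnorm0 Cpos) invr0 mulr0 normr0.
rewrite normrM normfV (ger0_norm (pnorm_ge0 _ _)) ler_pdivrMr; last first.
  by rewrite rE (pnormZ Cpos) mulr_gt0// normr_gt0.
rewrite lpE rE (pnormZ Cpos) (pipZr Cpos) pipDl pipZl -(sqr_pnorm Cpos) normrM mulrCA.
rewrite [leRHS]mulrCA ler_wpM2l//.
have -> : (pip x v + pnorm v * (a * pnorm v) = t * pnorm v)%R.
  by rewrite aE; field; rewrite gt_eqF.
by rewrite normrM (ger0_norm (ltW pv)).
Qed.

Lemma hr_op_singular_weight K x :
  (forall m : R, \int[mu]_t ((psi t)%:E * ((1 + `|t|) * (1 + isqrt (t - m)))%:E) <= K%:E) ->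
  hr_op C (fun z => (singular_weight C x z)%:E) x <= K%:E.
Proof.
move=> HK; have msw : measurable_fun setT (fun z : V => (singular_weight C x z)%:E).
  by apply/measurable_EFinP; apply: measurable_singular_weight; mfun.
have sw0 z : 0 <= (singular_weight C x z)%:E by rewrite lee_fin singular_weight_ge0.
have K0 : 0 <= K%:E.
  apply: le_trans (HK 0%R); apply: integralT_ge0 => t.
  by rewrite mule_ge0// lee_fin ?psi_ge0// mulr_ge0 ?addr_ge0// isqrt_ge0.
rewrite (hr_opE Cpos)//.
have <- : \int[unif_sphere R d]_v (cst K%:E v) = K%:E.
  rewrite integral_cst//; transitivity (K%:E * 1); last by rewrite mule1.
  by congr (_ * _); exact: probability_setT.
apply: ge0_le_integralT.
- exact: (measurable_line_integral C x msw sw0).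
- by move=> v; apply: integralT_ge0 => t; rewrite mule_ge0// lee_fin psi_ge0.
- exact: measurable_cst.
- move=> v; apply: le_trans (HK (pip x v / pnorm v)%R).
  apply: ge0_le_integralT.
  + apply: emeasurable_funM; first by mfun.
    by apply: (measurableT_comp msw); apply: measurable_line_point; mfun.
  + by move=> t; rewrite mule_ge0// lee_fin psi_ge0.
  + apply: emeasurable_funM; first by mfun.
    apply/measurable_EFinP; apply: measurable_funM; first by mfun.
    apply: measurable_funD; first by mfun.
    by apply: (measurableT_comp (@measurable_isqrt R)); mfun.
  + move=> t; rewrite lee_wpmul2l ?lee_fin ?psi_ge0//; exact: singular_weight_line.
Qed.

Lemma two_step_total x z y delta :
  (hr_shape x z * share (pnorm (z - x)) (pnorm (y - z)) * hr_shape z y +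
   hr_shape x z * (share (pnorm (y - z)) (pnorm (z - x)) * hr_shape z y) <=
   hr_shape (x + delta) z * share (pnorm (z - (x + delta))) (pnorm (y - z)) * hr_shape z y +
   hr_shape (x + delta) (z + delta) *
     (share (pnorm (y - (z + delta))) (pnorm (z - x)) * hr_shape (z + delta) y) +
   6 * (smooth_dim C + pnorm x) * pnorm delta *
     (hr_shape x z * hr_shape z y * (singular_weight C x z * singular_weight C z y)))%R.
Proof.
have q0 : (0 <= hr_shape z y)%R by exact: hr_shape_ge0.
have A1 := ler_wpM2r q0 (two_step_source Cpos d0 x z y delta).
have A2 := two_step_translate Cpos d0 x z y delta.
have A3 := ler_wpM2l (pnorm_ge0 C delta) (two_step_cost Cpos x z y).
apply: (le_trans (lerD A1 A2)); rewrite mulrDl addrACA lerD2l.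
move: A3 => {A1 A2}.
set a1 := shape_cost x z; set a2 := shape_cost z y.
move: (hr_shape x z) (hr_shape z y) (share _ _) (share _ _) a1 a2 => q1 q2 s1 s2 a1 a2.
move: (pnorm (z - x))^-1%R (pnorm (y - z))^-1%R `|slope x z|%R => b1 b2 S.
move: (smooth_dim C) (pnorm x) (singular_weight C x z) (singular_weight C z y) => D X w1 w2.
move: (pnorm delta) => nd A3.
apply: le_trans (le_trans A3 _); rewrite le_eqVlt; apply/orP; left; apply/eqP; ring.
Qed.

Lemma two_step_cost_integral K c x : (0 <= K)%R -> (0 < c)%R ->
  (forall m : R, \int[mu]_t ((psi t)%:E * ((1 + `|t|) * (1 + isqrt (t - m)))%:E) <= K%:E) ->
  (forall x (f : V -> \bar R), measurable_fun setT f -> (forall y, 0 <= f y) ->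
    hr_op C f x = \int[L]_z ((c * hr_shape x z)%:E * f z)) ->
  \int[(L \x L)%E]_p (c * c * (hr_shape x p.1 * hr_shape p.1 p.2 *
    (singular_weight C x p.1 * singular_weight C p.1 p.2)))%:E <= (K ^+ 2)%:E.
Proof.
move=> K0 c0 HK hrE; set IE := fun p : V * V => _%:E.
have K0E : 0 <= K%:E by rewrite lee_fin.
have mshape d' (T : measurableType d') (a b : T -> V) : measurable_fun setT a ->
    measurable_fun setT b -> measurable_fun setT (fun t => hr_shape (a t) (b t)).
  exact: measurable_hr_shape.
have msw (x' : V) : measurable_fun setT (fun z : V => (singular_weight C x' z)%:E).
  by apply/measurable_EFinP; apply: measurable_singular_weight; mfun.
have sw0 x' z : 0 <= (singular_weight C x' z)%:E by rewrite lee_fin singular_weight_ge0.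
have ms (x' : V) : measurable_fun setT (fun z : V => (c * hr_shape x' z)%:E).
  by apply/measurable_EFinP; apply: measurable_funM; [exact: measurable_cst|apply: mshape; mfun].
have s0 x' z : 0 <= (c * hr_shape x' z)%:E.
  by rewrite lee_fin; exact: (mulr_ge0 (ltW c0) (hr_shape_ge0 _ _ _)).
have IE0 p : 0 <= IE p.
  by rewrite lee_fin; apply: mulr_ge0; [|apply: mulr_ge0]; apply: mulr_ge0;
    rewrite ?hr_shape_ge0 ?singular_weight_ge0// ltW.
have mIE : measurable_fun setT IE.
  apply/measurable_EFinP; apply: measurable_funM; first exact: measurable_cst.
  apply: measurable_funM; apply: measurable_funM; try (apply: mshape; mfun).
    by apply: measurable_singular_weight; mfun.
  by apply: measurable_singular_weight; mfun.
have inner z : fubini_F L IE z = (c * hr_shape x z)%:E * ((singular_weight C x z)%:E *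
    hr_op C (fun y => (singular_weight C z y)%:E) z).
  rewrite (hrE z _ (msw z) (sw0 z)).
  have m1 : measurable_fun setT (fun y => (c * hr_shape z y)%:E * (singular_weight C z y)%:E).
    exact: emeasurable_funM.
  have p1 y : 0 <= (c * hr_shape z y)%:E * (singular_weight C z y)%:E by exact: mule_ge0.
  have m2 : measurable_fun setT (fun y => (singular_weight C x z)%:E *
      ((c * hr_shape z y)%:E * (singular_weight C z y)%:E)).
    by apply: emeasurable_funM; [exact: measurable_cst|].
  have p2 y : 0 <= (singular_weight C x z)%:E *
      ((c * hr_shape z y)%:E * (singular_weight C z y)%:E) by exact: mule_ge0.
  rewrite -(ge0_integralTZl _ m1 p1 (sw0 x z)) -(ge0_integralTZl _ m2 p2 (s0 x z)).
  apply: eq_integral => y _; rewrite -!EFinM; congr EFin.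
  rewrite /=; move: (hr_shape _ _) (hr_shape _ _) (singular_weight _ _ _) (singular_weight _ _ _).
  by move=> q1 q2 w1 w2; ring.
have mwK : measurable_fun setT (fun z => (singular_weight C x z)%:E * K%:E).
  by apply: emeasurable_funM => //; exact: measurable_cst.
have wK0 z : 0 <= (singular_weight C x z)%:E * K%:E by exact: mule_ge0.
apply: (@le_trans _ _ (\int[L]_z ((c * hr_shape x z)%:E * ((singular_weight C x z)%:E * K%:E)))).
  rewrite (fubini_tonelli1 IE mIE IE0); apply: ge0_le_integralT.
  - exact: measurable_fun_fubini_tonelli_F mIE IE0.
  - by move=> z; apply: integralT_ge0 => y; exact: IE0.
  - exact: emeasurable_funM.
  - move=> z; rewrite inner; apply: lee_wpmul2l; first exact: s0.
    apply: lee_wpmul2l; first exact: sw0.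
    exact: hr_op_singular_weight.
rewrite -(hrE x _ mwK wK0).
rewrite /hr_op (ge0_integralTZr _ (msw x) (sw0 x) K0E) expr2 EFinM.
apply: lee_wpmul2r => //; exact: hr_op_singular_weight.
Qed.

Lemma hr_op2_smoothing K : (0 <= K)%R ->
  (forall m : R, \int[mu]_t ((psi t)%:E * ((1 + `|t|) * (1 + isqrt (t - m)))%:E) <= K%:E) ->
  forall (f : V -> \bar R) x delta, measurable_fun setT f ->
  (forall y, 0 <= f y) -> (forall y, f y <= 1) ->
  hr_op C (hr_op C f) x <= hr_op C (hr_op C f) (x + delta)%R +
    (6 * K ^+ 2 * (smooth_dim C + pnorm x) * pnorm delta)%:E.
Proof.
move=> K0 HK f x delta mf f0 f1.
have [c c0 hrE] := hr_op_density Cpos d0.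
have c20 : (0 <= c * c)%R by rewrite mulr_ge0// ltW.
have mff : measurable_fun setT (fun p : V * V => f p.2).
  exact: (measurableT_comp mf measurable_snd).
pose F x' (p : V * V) := (hr_shape x' p.1 * share (pnorm (p.1 - x')) (pnorm (p.2 - p.1)) *
  hr_shape p.1 p.2)%R.
pose G x' (p : V * V) := (hr_shape x' p.1 * (share (pnorm (p.2 - p.1)) (pnorm (p.1 - x')) *
  hr_shape p.1 p.2))%R.
pose E (p : V * V) := (hr_shape x p.1 * hr_shape p.1 p.2 *
  (singular_weight C x p.1 * singular_weight C p.1 p.2))%R.
have sh0 a b : (0 <= share (pnorm a) (pnorm b))%R.
  by rewrite divr_ge0 ?addr_ge0 ?pnorm_ge0.
have F0 x' p : (0 <= F x' p)%R.
  by apply: mulr_ge0; [apply: mulr_ge0|]; rewrite ?hr_shape_ge0 ?sh0.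
have G0 x' p : (0 <= G x' p)%R.
  by apply: mulr_ge0; [|apply: mulr_ge0]; rewrite ?hr_shape_ge0 ?sh0.
have E0 p : (0 <= E p)%R.
  by apply: mulr_ge0; apply: mulr_ge0; rewrite ?hr_shape_ge0 ?singular_weight_ge0.
have msh d' (T : measurableType d') (a b : T -> R) : measurable_fun setT a ->
    measurable_fun setT b -> measurable_fun setT (fun t => share (a t) (b t)).
  by move=> ma mb; rewrite /share; mfun.
have mshape d' (T : measurableType d') (a b : T -> V) : measurable_fun setT a ->
    measurable_fun setT b -> measurable_fun setT (fun t => hr_shape (a t) (b t)).
  exact: measurable_hr_shape.
have mF x' : measurable_fun setT (F x').
  apply: measurable_funM; last by apply: mshape; mfun.
  apply: measurable_funM; first by apply: mshape; mfun.
  by apply: msh; mfun.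
have mG x' : measurable_fun setT (G x').
  apply: measurable_funM; first by apply: mshape; mfun.
  apply: measurable_funM; last by apply: mshape; mfun.
  by apply: msh; mfun.
have mE : measurable_fun setT E.
  apply: measurable_funM.
    by apply: measurable_funM; apply: mshape; mfun.
  by apply: measurable_funM; apply: measurable_singular_weight; mfun.
pose e := (6 * (smooth_dim C + pnorm x) * pnorm delta)%R.
have e0 : (0 <= e)%R.
  by rewrite mulr_ge0 ?pnorm_ge0// mulr_ge0// addr_ge0 ?pnorm_ge0// (le_trans _ (smooth_dim_ge2 _)).
pose IF x' (p : V * V) := (c * c * F x' p)%:E * f p.2.
pose IG x' (p : V * V) := (c * c * G x' p)%:E * f p.2.
have cF0 x' p : 0 <= (c * c * F x' p)%:E by rewrite lee_fin; exact: mulr_ge0 c20 (F0 _ _).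
have cG0 x' p : 0 <= (c * c * G x' p)%:E by rewrite lee_fin; exact: mulr_ge0 c20 (G0 _ _).
have IF0 x' p : 0 <= IF x' p by exact: mule_ge0.
have IG0 x' p : 0 <= IG x' p by exact: mule_ge0.
have mIF x' : measurable_fun setT (IF x').
  by apply: emeasurable_funM => //; apply/measurable_EFinP; apply: measurable_funM.
have mIG x' : measurable_fun setT (IG x').
  by apply: emeasurable_funM => //; apply/measurable_EFinP; apply: measurable_funM.
pose IE (p : V * V) := (c * c * E p)%:E.
have IE0 p : 0 <= IE p by rewrite lee_fin; exact: mulr_ge0 c20 (E0 _).
have mIE : measurable_fun setT IE.
  by apply/measurable_EFinP; apply: measurable_funM.
have P2E x' : hr_op C (hr_op C f) x' =
    \int[(L \x L)%E]_p IF x' p + \int[(L \x L)%E]_p IG x' p.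
  rewrite -ge0_integralTD//.
  rewrite (fubini_tonelli1 (fun p => IF x' p + IG x' p)); last 2 first.
  - exact: emeasurable_funD.
  - by move=> p; rewrite adde_ge0.
  rewrite hrE; last 2 first.
  - exact: measurable_hr_op.
  - by move=> z; exact: hr_op_ge0.
  apply: eq_integral => z _; rewrite hrE// /fubini_F -ge0_integralTZl//; last 3 first.
  - apply: emeasurable_funM => //; apply/measurable_EFinP; apply: measurable_funM => //.
    by apply: mshape; mfun.
  - by move=> y; rewrite mule_ge0// lee_fin mulr_ge0 ?hr_shape_ge0// ltW.
  - by rewrite lee_fin mulr_ge0 ?hr_shape_ge0// ltW.
  apply: eq_integral => y _; rewrite /IF /IG -(ge0_muleDl _ (cF0 _ _) (cG0 _ _)).
  rewrite muleA; congr (_ * _); rewrite -EFinM -EFinD; congr EFin.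
  rewrite /F /G /=.
  have [->|zx] := eqVneq z x'; first by rewrite (hr_shape_diag Cpos) !(mul0r, mulr0) addr0.
  have hp : (0 < pnorm (z - x'))%R by rewrite (pnorm_gt0 Cpos) subr_eq0.
  have : (share (pnorm (z - x')) (pnorm (y - z)) + share (pnorm (y - z)) (pnorm (z - x')) = 1)%R.
    rewrite /share (addrC (pnorm (y - z))) -mulrDl mulfV// gt_eqF// ltr_wpDr// pnorm_ge0//.
  move: (share _ _) (share _ _) (hr_shape x' z) (hr_shape z y) => s1 s2 q1 q2 s12.
  rewrite -[LHS]mulr1 -s12; ring.
pose tau (p : V * V) : V * V := (p.1 + delta, p.2)%R.
have mtau : measurable_fun setT tau by apply: measurable_fun_pair; mfun.
have mIGt : measurable_fun setT (fun p => IG (x + delta)%R (tau p)).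
  exact: (measurableT_comp (mIG _) mtau).
have transl : \int[(L \x L)%E]_p IG (x + delta)%R (tau p) =
    \int[(L \x L)%E]_p IG (x + delta)%R p.
  have H1 := fubini_tonelli1 (m1 := L) (m2 := L) _ mIGt (fun p => IG0 _ _).
  have H2 := fubini_tonelli1 (m1 := L) (m2 := L) _ (mIG (x + delta)%R) (IG0 _).
  apply: (etrans H1); apply: (etrans _ (esym H2)) => {H1 H2}.
  rewrite [RHS](@ge0_integral_lebesgue_cV_affine R d 1 delta)//; last 2 first.
  - exact: measurable_fun_fubini_tonelli_F (mIG _) (IG0 _).
  - by move=> z; apply: integralT_ge0 => y; exact: IG0.
  rewrite normr1 expr1n mul1e; apply: eq_integral => z _; rewrite scale1r.
  by apply: eq_integral => y _.
have pointwise p : IF x p + IG x p <=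
    IF (x + delta)%R p + IG (x + delta)%R (tau p) + e%:E * IE p.
  case: p => z y; rewrite /IF /IG /IE /=.
  have := f0 y; have := f1 y; case: (f y) => [r|//|//]; rewrite !lee_fin => r1 r0.
  have A : (F x (z, y) + G x (z, y) <= F (x + delta) (z, y) + G (x + delta) (tau (z, y)) +
      e * E (z, y))%R.
    have := two_step_total x z y delta.
    rewrite /F /G /E /tau /= /e.
    by have -> : (z + delta - (x + delta) = z - x)%R by rewrite opprD addrACA subrr addr0.
  have r2 : (0 <= c * c * r)%R by exact: mulr_ge0.
  have B := ler_wpM2l r2 A.
  have D : (c * c * r * (e * E (z, y)) <= c * c * (e * E (z, y)))%R.
    have eE : (0 <= e * E (z, y))%R by exact: mulr_ge0 e0 (E0 _).
    have w0 := mulr_ge0 c20 eE.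
    by move: w0; move: (e * _)%R => w w0; rewrite mulrAC ler_piMr.
  move: B D; move: (F _ _) (F _ _) (G _ _) (G _ _) (E _) => F1 F2 G1 G2 E1.
  move=> B D.
  have -> : (c * c * F2 * r + c * c * G2 * r = c * c * r * (F2 + G2))%R by ring.
  apply: (le_trans B); rewrite mulrDr; apply: (le_trans (lerD (lexx _) D)).
  by rewrite le_eqVlt; apply/orP; left; apply/eqP; ring.
have mR : measurable_fun setT (fun p => IF (x + delta)%R p + IG (x + delta)%R (tau p)).
  exact: emeasurable_funD.
have meIE : measurable_fun setT (fun p => e%:E * IE p).
  by apply: emeasurable_funM => //; exact: measurable_cst.
have e0E : 0 <= e%:E by rewrite lee_fin.
have IEK : \int[(L \x L)%E]_p IE p <= (K ^+ 2)%:E.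
  exact: two_step_cost_integral K0 c0 HK hrE.
have S1 := ge0_integralTD (L \x L)%E (mIF x) (IF0 x) (mIG x) (IG0 x).
have S2 := ge0_integralTD (L \x L)%E mR
  (fun p => adde_ge0 (IF0 _ p) (IG0 _ (tau p))) meIE (fun p => mule_ge0 e0E (IE0 p)).
have S3 := ge0_integralTD (L \x L)%E (mIF (x + delta)%R) (IF0 _) mIGt (fun p => IG0 _ (tau p)).
have S4 := ge0_integralTZl (L \x L)%E mIE IE0 e0E.
have S5 : e%:E * \int[(L \x L)%E]_p IE p <= (e * K ^+ 2)%:E.
  by rewrite (EFinM e); exact: (lee_wpmul2l e0E IEK).
have -> : (6 * K ^+ 2 * (smooth_dim C + pnorm x) * pnorm delta = e * K ^+ 2)%R.
  by rewrite /e; move: (smooth_dim C) (pnorm x) (pnorm delta) => D X nd; ring.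
rewrite (P2E x) (P2E (x + delta)%R).
apply: le_trans (leeD2l _ S5).
have := ge0_le_integralT (L \x L)%E (emeasurable_funD (mIF x) (mIG x))
  (fun p => adde_ge0 (IF0 x p) (IG0 x p)) (emeasurable_funD mR meIE) pointwise.
rewrite [leLHS]S1 => /le_trans; apply.
have S23 := etrans S2 (f_equal2 adde (etrans S3 (f_equal (adde _) transl)) S4).
by rewrite [leLHS]S23.
Qed.

End smoothing_integrated.

(** * Contraction and the rate *)

Section contraction.
Local Open Scope ereal_scope.
Context (R : realType) (d : nat) (C : 'M[R]_d) (Cpos : posdef C).
Notation V := 'cV[R]_d.
Notation mu := (@lebesgue_measure R).
Notation sigma := (unif_sphere R d).
Implicit Types x y v delta : V.
Local Notation pip := (pip C).
Local Notation pnorm := (pnorm C).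

Definition line_rejection delta v : V := (delta - (pip delta v / pnorm v ^+ 2) *: v)%R.

Lemma sqr_pnorm_line_rejection delta v :
  (pnorm (line_rejection delta v) ^+ 2 + (pip delta v / pnorm v) ^+ 2 = pnorm delta ^+ 2)%R.
Proof.
rewrite /line_rejection; have [->|v0] := eqVneq v 0%R.
  by rewrite scaler0 subr0 (pnorm0 Cpos) invr0 mulr0 expr0n addr0.
have pv : (pnorm v != 0)%R by rewrite (pnorm_eq0 Cpos).
rewrite [X in (X + _)%R](sqr_pnorm Cpos) !pipDl !(pipDr Cpos) !pipNl !(pipNr Cpos) !pipZl !(pipZr Cpos).
rewrite (pipC Cpos v delta) -!(sqr_pnorm Cpos).
by field.
Qed.

Lemma line_point_add x delta v z :
  line_point C (x + delta)%R v z = (line_point C x v z + line_rejection delta v)%R.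
Proof.
rewrite /line_point /line_rejection !line_meanE !line_sdE pipDl.
rewrite [RHS]addrACA -scalerBl; congr (_ + _ *: _)%R; ring.
Qed.

Lemma sqr_dir_le delta v : ((pip delta v / pnorm v) ^+ 2 <= pnorm delta ^+ 2)%R.
Proof. by rewrite -(sqr_pnorm_line_rejection delta v) lerDr sqr_ge0. Qed.

Lemma measurable_sqr_dir delta :
  measurable_fun setT (fun v => ((pip delta v / pnorm v) ^+ 2)%R).
Proof.
apply: measurable_funX; apply: measurable_funM; last by mfun.
by apply: measurable_pip; mfun.
Qed.

Lemma unif_sphere_cst (r : R) : \int[sigma]_v (cst r%:E v) = r%:E.
Proof.
rewrite integral_cst//; transitivity (r%:E * 1); last by rewrite mule1.
by congr (_ * _); exact: probability_setT.
Qed.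

Lemma hr_rate_dir delta :
  (2 * hr_rate C * pnorm delta ^+ 2)%:E <= \int[sigma]_v ((pip delta v / pnorm v) ^+ 2)%:E.
Proof.
have [->|delta0] := eqVneq delta 0%R.
  rewrite (pnorm0 Cpos) expr0n mulr0; apply: integralT_ge0 => v.
  by rewrite lee_fin sqr_ge0.
have pd : (0 < pnorm delta)%R by rewrite (pnorm_gt0 Cpos).
pose zeta : V := ((pnorm delta)^-1 *: (sqrtmx (invmx C) *m delta))%R.
have z1 : enorm zeta = 1%R.
  by rewrite /zeta enormZ gtr0_norm ?invr_gt0// mulVf// gt_eqF.
have zE v : dotv zeta ((enorm (sqrtmx (invmx C) *m v))^-1 *: (sqrtmx (invmx C) *m v))%R =
    ((pnorm delta)^-1 * (pip delta v / pnorm v))%R.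
  rewrite /zeta dotvZl dotvC dotvZl dotvC (dotv_sqrtmx_inv Cpos) -/(pnorm v); ring.
pose q := fine (\int[sigma]_v ((pip delta v / pnorm v) ^+ 2)%:E).
have ge0 : 0 <= \int[sigma]_v ((pip delta v / pnorm v) ^+ 2)%:E.
  by apply: integralT_ge0 => v; rewrite lee_fin sqr_ge0.
have le1 : \int[sigma]_v ((pip delta v / pnorm v) ^+ 2)%:E <= (pnorm delta ^+ 2)%:E.
  rewrite -[leRHS]unif_sphere_cst; apply: ge0_le_integralT.
  - by apply/measurable_EFinP; exact: measurable_sqr_dir.
  - by move=> v; rewrite lee_fin sqr_ge0.
  - exact: measurable_cst.
  - by move=> v; rewrite lee_fin; exact: sqr_dir_le.
have qE : \int[sigma]_v ((pip delta v / pnorm v) ^+ 2)%:E = q%:E.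
  by rewrite fineK// ge0_fin_numE// (le_lt_trans le1)// ltry.
rewrite qE lee_fin mulrC -ler_pdivlMl ?exprn_gt0//.
rewrite /hr_rate mulrA divff// mul1r.
apply: ge_inf.
  exists 0%R => _ [xi _ <-]; apply: fine_ge0; rewrite unlock.
  by apply: integralT_ge0 => v; rewrite lee_fin sqr_ge0.
exists zeta => //; rewrite unlock.
transitivity (fine (((pnorm delta ^+ 2)^-1)%:E * q%:E)); last by [].
rewrite -qE -ge0_integralTZl//.
- congr fine; apply: eq_integral => v _; rewrite -EFinM; congr EFin.
  by rewrite [RHS]/= zE exprMn exprVn.
- by apply/measurable_EFinP; exact: measurable_sqr_dir.
- by move=> v; rewrite lee_fin sqr_ge0.
- by rewrite lee_fin invr_ge0 sqr_ge0.
Qed.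

Lemma integral_sqr_line_rejection delta :
  \int[sigma]_v (pnorm (line_rejection delta v) ^+ 2)%:E <=
    ((1 - 2 * hr_rate C) * pnorm delta ^+ 2)%:E.
Proof.
have mr : measurable_fun setT (fun v => (pnorm (line_rejection delta v) ^+ 2)%R).
  apply: measurable_funX; apply: measurable_fun_pnorm; apply: measurable_subcV; first by mfun.
  apply: measurable_scalecV; last by mfun.
  apply: measurable_funM; first by apply: measurable_pip; mfun.
  by mfun.
have mr' : measurable_fun setT (fun v => (pnorm (line_rejection delta v) ^+ 2)%:E).
  exact/measurable_EFinP.
have md : measurable_fun setT (fun v => ((pip delta v / pnorm v) ^+ 2)%:E).
  by apply/measurable_EFinP; exact: measurable_sqr_dir.
have r0 v : 0 <= (pnorm (line_rejection delta v) ^+ 2)%:E by rewrite lee_fin sqr_ge0.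
have q0 v : 0 <= ((pip delta v / pnorm v) ^+ 2)%:E by rewrite lee_fin sqr_ge0.
have S := ge0_integralTD sigma mr' r0 md q0.
have E : \int[sigma]_v ((pnorm (line_rejection delta v) ^+ 2)%:E +
    ((pip delta v / pnorm v) ^+ 2)%:E) = (pnorm delta ^+ 2)%:E.
  rewrite -[RHS]unif_sphere_cst; apply: eq_integral => v _.
  by rewrite -EFinD sqr_pnorm_line_rejection.
have H := hr_rate_dir delta.
have -> : ((1 - 2 * hr_rate C) * pnorm delta ^+ 2 =
    pnorm delta ^+ 2 - 2 * hr_rate C * pnorm delta ^+ 2)%R by rewrite mulrBl mul1r.
rewrite EFinB -E S leeBrDr//.
exact: leeD2l.
Qed.

Lemma hr_rate_le : (0 < d)%N -> (2 * hr_rate C <= 1)%R.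
Proof.
move=> d0; pose delta : V := const_mx 1%R.
have dn : delta != 0%R.
  apply/eqP => /matrixP /(_ (Ordinal d0) ord0); rewrite !mxE => /eqP.
  by rewrite oner_eq0.
have p2 : (0 < pnorm delta ^+ 2)%R by rewrite exprn_gt0// (pnorm_gt0 Cpos).
have := integral_sqr_line_rejection delta.
move/(le_trans _) => /(_ 0); rewrite lee_fin pmulr_lge0// subr_ge0; apply.
by apply: integralT_ge0 => v; rewrite lee_fin sqr_ge0.
Qed.

Lemma hr_op_contraction (g W : V -> \bar R) (beta : R) : (0 <= beta)%R ->
  measurable_fun setT g -> (forall y, 0 <= g y) ->
  measurable_fun setT W -> (forall y, 0 <= W y) ->
  (forall x delta, g x <= g (x + delta)%R + W x + (beta * pnorm delta ^+ 2)%:E) ->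
  forall x delta, hr_op C g x <= hr_op C g (x + delta)%R + hr_op C W x +
    (beta * (1 - 2 * hr_rate C) * pnorm delta ^+ 2)%:E.
Proof.
move=> b0 mg g0 mW W0 H x delta.
pose I h (y v : V) := \int[mu]_z ((psi z)%:E * (h (line_point C y v z) : \bar R)).
pose J v := (beta * pnorm (line_rejection delta v) ^+ 2)%:E.
have mJ : measurable_fun setT J.
  apply/measurable_EFinP; apply: measurable_funM; first by mfun.
  apply: measurable_funX; apply: measurable_fun_pnorm; apply: measurable_subcV; first by mfun.
  apply: measurable_scalecV; last by mfun.
  apply: measurable_funM; first by apply: measurable_pip; mfun.
  by mfun.
have J0 v : 0 <= J v by rewrite lee_fin mulr_ge0// sqr_ge0.
have mI h y : measurable_fun setT h -> (forall y, 0 <= h y) -> measurable_fun setT (I h y).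
  by move=> mh h0; exact: measurable_line_integral.
have I0 h y v : (forall y, 0 <= h y) -> 0 <= I h y v.
  by move=> h0; apply: integralT_ge0 => z; rewrite mule_ge0// lee_fin psi_ge0.
have IE h y : measurable_fun setT h -> (forall y, 0 <= h y) -> hr_op C h y = \int[sigma]_v I h y v.
  exact: (hr_opE Cpos).
have mpsi : measurable_fun setT (fun z : measurableTypeR R => (psi z)%:E) by mfun.
have psi0 z : 0 <= (psi z : R)%:E by rewrite lee_fin psi_ge0.
have mline h y v : measurable_fun setT h ->
    measurable_fun setT (fun z : measurableTypeR R => (psi z)%:E * h (line_point C y v z)).
  move=> mh; apply: emeasurable_funM; first by mfun.
  by apply: (measurableT_comp mh); apply: measurable_line_point; mfun.
have line0 h y v z : (forall y, 0 <= h y) -> 0 <= (psi z)%:E * h (line_point C y v z).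
  by move=> h0; exact: mule_ge0.
have step v : I g x v <= I g (x + delta)%R v + I W x v + J v.
  have mc : measurable_fun setT (fun z : measurableTypeR R => (psi z)%:E * J v).
    by apply: emeasurable_funM; [|exact: measurable_cst].
  have c0 z : 0 <= (psi z : R)%:E * J v by exact: mule_ge0.
  have -> : J v = \int[mu]_z ((psi z)%:E * J v).
    by rewrite (ge0_integralTZr _ mpsi psi0 (J0 v)) integral_psi mul1e.
  rewrite -(ge0_integralTD _ (mline _ _ _ mg) (fun z => line0 _ _ _ _ g0)
    (mline _ _ _ mW) (fun z => line0 _ _ _ _ W0)).
  rewrite -(ge0_integralTD _ (emeasurable_funD (mline _ _ _ mg) (mline _ _ _ mW))
    (fun z => adde_ge0 (line0 _ _ _ _ g0) (line0 _ _ _ _ W0)) mc c0).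
  apply: ge0_le_integralT.
  - exact: mline.
  - by move=> z; exact: line0.
  - exact: (emeasurable_funD (emeasurable_funD (mline _ _ _ mg) (mline _ _ _ mW)) mc).
  - move=> z; rewrite -ge0_muleDr// -ge0_muleDr//; last by exact: adde_ge0.
    by apply: lee_wpmul2l => //; rewrite line_point_add; exact: H.
rewrite !IE//.
have JE : \int[sigma]_v J v <= (beta * (1 - 2 * hr_rate C) * pnorm delta ^+ 2)%:E.
  rewrite (eq_integral (fun v => beta%:E * (pnorm (line_rejection delta v) ^+ 2)%:E)); last first.
    by move=> v _.
  rewrite ge0_integralTZl//; last 2 first.
  - apply/measurable_EFinP; apply: measurable_funX; apply: measurable_fun_pnorm.
    apply: measurable_subcV; first by mfun.
    apply: measurable_scalecV; last by mfun.
    by apply: measurable_funM; [apply: measurable_pip; mfun|mfun].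
  - by move=> v; rewrite lee_fin sqr_ge0.
  rewrite -(mulrA beta) (EFinM beta); apply: lee_wpmul2l; first by rewrite lee_fin.
  exact: integral_sqr_line_rejection.
apply: le_trans (leeD2l _ JE).
have mgx := mI _ (x + delta)%R mg g0.
have mWx := mI _ x mW W0.
rewrite -(ge0_integralTD _ mgx (fun v => I0 _ _ v g0) mWx (fun v => I0 _ _ v W0)).
rewrite -(ge0_integralTD _ (emeasurable_funD mgx mWx)
  (fun v => adde_ge0 (I0 _ _ v g0) (I0 _ _ v W0)) mJ J0).
apply: ge0_le_integralT.
- exact: mI.
- by move=> v; exact: I0.
- exact: (emeasurable_funD (emeasurable_funD mgx mWx) mJ).
- exact: step.
Qed.

Lemma iter_hr_op_contraction n (g W : V -> \bar R) (beta : R) : (0 < d)%N -> (0 <= beta)%R ->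
  measurable_fun setT g -> (forall y, 0 <= g y) ->
  measurable_fun setT W -> (forall y, 0 <= W y) ->
  (forall x delta, g x <= g (x + delta)%R + W x + (beta * pnorm delta ^+ 2)%:E) ->
  forall x delta, iter n (hr_op C) g x <= iter n (hr_op C) g (x + delta)%R +
    iter n (hr_op C) W x + (beta * (1 - 2 * hr_rate C) ^+ n * pnorm delta ^+ 2)%:E.
Proof.
move=> d0; have r0 : (0 <= 1 - 2 * hr_rate C)%R by rewrite subr_ge0 hr_rate_le.
elim: n g W beta => [|n IH] g W beta b0 mg g0 mW W0 H x delta.
  by rewrite /= expr0 mulr1.
rewrite !iterSr exprS (mulrA beta); apply: IH.
- exact: mulr_ge0.
- exact: measurable_hr_op.
- by move=> y; exact: hr_op_ge0.
- exact: measurable_hr_op.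
- by move=> y; exact: hr_op_ge0.
- exact: hr_op_contraction.
Qed.

End contraction.

Section rate_positive.
Local Open Scope ereal_scope.
Context (R : realType) (d : nat).
Notation V := 'cV[R]_d.
Notation L := (lebesgue_cV R d).

Lemma dotv_delta (w : V) i : dotv w (delta_mx i ord0) = w i ord0.
Proof.
rewrite /dotv (bigD1 i)//= mxE !eqxx mulr1 big1 ?addr0// => j ji.
by rewrite mxE (negbTE ji) mulr0.
Qed.

(* For h = e_i / 2, (w.u)^2 + (w.(u + h))^2 >= w_i^2 / 8, and both points stay in the unit ball when
   |u| <= 1/2. *)
Lemma coord_le_ball_second_moment (w : V) i :
  ((ball_volume R d)^-1 * (w i ord0 ^+ 2 / 16))%:E * L [set x | (enorm x <= 2^-1)%R] <=
  \int[L]_u (ball_pdf u * dotv w u ^+ 2)%:E.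
Proof.
pose B : set V := [set x | (enorm x <= 2^-1)%R].
have mB : measurable B by exact: measurable_enorm_ball.
pose phi (u : V) := (ball_pdf u * dotv w u ^+ 2)%:E.
have bv0 : (0 <= (ball_volume R d)^-1)%R by rewrite invr_ge0 ltW// ball_volume_gt0.
have mphi : measurable_fun setT phi.
  apply/measurable_EFinP; apply: measurable_funM; first by mfun.
  by apply: measurable_funX; apply: measurable_dotv; mfun.
have phi0 u : 0 <= phi u.
  by rewrite lee_fin; apply: mulr_ge0; [exact: ball_pdf_ge0|exact: sqr_ge0].
pose h : V := (2^-1 *: delta_mx i ord0)%R.
have eh : (enorm h = 2^-1)%R.
  rewrite /h enormZ ger0_norm ?invr_ge0// /enorm dotv_delta mxE !eqxx sqrtr1 mulr1//.
have mphi2 : measurable_fun setT (fun u : V => phi (u + h)%R).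
  by apply: (measurableT_comp mphi); apply: measurable_addcV; mfun.
have shift : \int[L]_u phi (u + h)%R = \int[L]_u phi u.
  rewrite [RHS](@ge0_integral_lebesgue_cV_affine R d 1 h)//.
  by rewrite normr1 expr1n mul1e; apply: eq_integral => u _; rewrite scale1r.
have H : \int[L]_u (((ball_volume R d)^-1 * (w i ord0 ^+ 2 / 8))%:E * (\1_B u)%:E) <=
    \int[L]_u (phi u + phi (u + h)%R).
  apply: ge0_le_integralT.
  - by apply: emeasurable_funM; [exact: measurable_cst|apply/measurable_EFinP; exact: measurable_indic].
  - move=> u; rewrite -EFinM lee_fin; apply: mulr_ge0 => //; apply: mulr_ge0 => //.
    by rewrite divr_ge0// sqr_ge0.
  - exact: emeasurable_funD.
  - move=> u; rewrite indicE; case: (boolP (u \in B)) => [|_]; last first.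
      by rewrite mule0 adde_ge0.
    move=> uB; have {}uB : (enorm u <= 2^-1)%R by exact: (set_mem uB).
    rewrite mule1 -EFinD lee_fin.
    have u1 : (enorm u <= 1)%R by rewrite (le_trans uB)//; lra.
    have u2 : (enorm (u + h) <= 1)%R.
      by apply: (le_trans (ler_enormD _ _)); rewrite eh; lra.
    rewrite /ball_pdf !indicE !mem_set//= !mulr1 -mulrDr; apply: ler_wpM2l => //.
    rewrite dotvDr /h dotvZr dotv_delta; move: (dotv w u) (w i ord0) => a b.
    have := sqr_ge0 (2 * a + 2^-1 * b)%R.
    by rewrite !expr2 => ?; lra.
rewrite [leRHS](ge0_integralTD _ mphi phi0 mphi2 (fun u => phi0 _)) shift in H.
have mI : measurable_fun setT (fun u : V => (\1_B u : R)%:E).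
  by apply/measurable_EFinP; exact: measurable_indic.
have I0 (u : V) : 0 <= (\1_B u : R)%:E by rewrite lee_fin.
have k0 : 0 <= ((ball_volume R d)^-1 * (w i ord0 ^+ 2 / 8))%:E.
  by rewrite lee_fin; apply: mulr_ge0 => //; rewrite divr_ge0// sqr_ge0.
rewrite [leLHS](ge0_integralTZl _ mI I0 k0) integral_indic// setIT in H.
rewrite -(@lee_pmul2l _ (2 : R)%:E)//.
rewrite muleA -EFinM mulrCA.
have -> : (2 * (w i ord0 ^+ 2 / 16) = w i ord0 ^+ 2 / 8)%R by field.
by apply: (le_trans H); rewrite -[X in X + _]mul1e -[X in _ + X]mul1e -ge0_muleDl.
Qed.

Lemma ball_second_moment : (0 < d)%N -> exists2 c : R, (0 < c)%R &
  forall w : V, (c * dotv w w)%:E <= \int[L]_u (ball_pdf u * dotv w u ^+ 2)%:E.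
Proof.
move=> d0; pose b := fine (L [set x : V | (enorm x <= 2^-1)%R]).
have bE : L [set x : V | (enorm x <= 2^-1)%R] = b%:E.
  by rewrite fineK// ge0_fin_numE// lebesgue_cV_ball_lt_pinfty.
have b0 : (0 < b)%R by rewrite -lte_fin -bE lebesgue_cV_ball_gt0// invr_gt0.
have bv := ball_volume_gt0 R d.
exists ((ball_volume R d)^-1 * b / 16 / d%:R)%R.
  by rewrite !divr_gt0// ?ltr0n// mulr_gt0// invr_gt0.
move=> w; have I0 : 0 <= \int[L]_u (ball_pdf u * dotv w u ^+ 2)%:E.
  by apply: integralT_ge0 => u; rewrite lee_fin mulr_ge0 ?ball_pdf_ge0 ?sqr_ge0.
have := coord_le_ball_second_moment w; rewrite bE.
case: (\int[L]_u _)%E I0 => [r| |]; rewrite ?leey// => _ H.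
rewrite lee_fin /dotv mulrAC ler_pdivrMr ?ltr0n// mulr_sumr.
apply: (@le_trans _ _ (\sum_(i < d) r)%R); last first.
  by rewrite sumr_const card_ord mulr_natr.
apply: ler_sum => i _; have := H i; rewrite -EFinM lee_fin; apply: le_trans.
by rewrite -expr2 le_eqVlt; apply/orP; left; apply/eqP; field; rewrite gt_eqF.
Qed.

Lemma hr_rate_gt0 (C : 'M[R]_d) : (0 < d)%N -> posdef C -> (0 < hr_rate C)%R.
Proof.
move=> d0 Cpos; have [c c0 Hc] := ball_second_moment d0.
set S := sqrtmx (invmx C).
have [[ST Spos] SS] := sqrtmxP (posdef_inv Cpos).
have m0 := mineig_gt0 d0 (posdef_inv Cpos).
set m := mineig (invmx C) in m0; set M := maxeig (invmx C).
have v1 : exists v : V, enorm v = 1%R.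
  exists (delta_mx (Ordinal d0) ord0); rewrite /enorm dotv_delta mxE !eqxx sqrtr1//.
have M0 : (0 < M)%R.
  case: v1 => v v1; have vv : dotv v v = 1%R.
    by rewrite -[LHS]sqr_sqrtr ?dotvv_ge0// -/(enorm v) v1 expr1n.
  have /andP[H1 H2] := rayleigh_bounds v (posdef_inv Cpos).
  by move: H1 H2; rewrite vv !mulr1 -/m -/M => H1 H2; exact: lt_le_trans m0 (le_trans H1 H2).
rewrite /hr_rate mulr_gt0// ?invr_gt0//.
apply: (@lt_le_trans _ _ (M^-1 * (c * m))%R); first by rewrite !mulr_gt0// invr_gt0.
apply: lb_le_inf.
  by case: v1 => v v1; eexists; exists v => //; reflexivity.
move=> _ [zeta z1 <-]; rewrite -/S unlock.
have zz : dotv zeta zeta = 1%R.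
  by rewrite -[LHS]sqr_sqrtr ?dotvv_ge0// -/(enorm zeta) (z1 : enorm zeta = 1%R) expr1n.
have [eta etaE] : exists eta, (S *m eta = zeta)%R.
  exists (C *m S *m zeta); have CSS : (C *m S) *m S = 1%:M.
    by rewrite -mulmxA SS mulmxV// posdef_unitmx.
  by rewrite mulmxA (mulmx1C CSS) mul1mx.
have eta1 : (pnorm C eta = 1)%R by rewrite /pnorm -/S etaE.
have fE v : (dotv zeta ((enorm (S *m v))^-1 *: (S *m v)) ^+ 2 =
    (pip C eta v / pnorm C v) ^+ 2)%R.
  by rewrite dotvZr mulrC -etaE (dotv_sqrtmx_inv Cpos).
have pipE u : (pip C eta u = dotv (S *m zeta) u)%R.
  by rewrite -(dotv_sqrtmx_inv Cpos) -/S etaE dotv_tr ST.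
set I := \int[_]_v _.
have IE : I = \int[unif_sphere R d]_v ((pip C eta v / pnorm C v) ^+ 2)%:E.
  by apply: eq_integral => v _; rewrite /comp/= fE.
have mf : measurable_fun setT (fun v : V => ((pip C eta v / pnorm C v) ^+ 2)%:E).
  by apply/measurable_EFinP; exact: measurable_sqr_dir.
have f0 v : 0 <= ((pip C eta v / pnorm C v) ^+ 2)%:E by rewrite lee_fin sqr_ge0.
have I0 : 0 <= I by rewrite IE; exact: integralT_ge0.
have I1 : I <= 1.
  rewrite IE -[leRHS](unif_sphere_cst d); apply: (ge0_le_integralT _ mf f0 (measurable_cst _)) => v.
  by rewrite lee_fin; apply: (le_trans (sqr_dir_le Cpos _ _)); rewrite eta1 expr1n.
have Ifin : I \is a fin_num by rewrite ge0_fin_numE// (le_lt_trans I1)// ltry.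
rewrite -lee_fin fineK// IE ge0_integral_unif_sphere//.
have mw : (m <= dotv (S *m zeta) (S *m zeta))%R.
  have /andP[H _] := rayleigh_bounds zeta (posdef_inv Cpos).
  by rewrite (dotv_sqrtmx_inv Cpos) (le_trans _ H)// zz mulr1.
have M'0 : 0 <= (M^-1)%:E by rewrite lee_fin invr_ge0 ltW.
have mb : measurable_fun setT (fun u : V => (ball_pdf u * dotv (S *m zeta) u ^+ 2)%:E).
  apply/measurable_EFinP; apply: measurable_funM; first by mfun.
  by apply: measurable_funX; apply: measurable_dotv; mfun.
have b0 (u : V) : 0 <= (ball_pdf u * dotv (S *m zeta) u ^+ 2)%:E.
  by rewrite lee_fin mulr_ge0 ?ball_pdf_ge0 ?sqr_ge0.
apply: (@le_trans _ _ ((M^-1)%:E * (c * dotv (S *m zeta) (S *m zeta))%:E)).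
  by rewrite -EFinM lee_fin; apply: ler_wpM2l; [rewrite invr_ge0 ltW|apply: ler_wpM2l => //; exact: ltW].
apply: (le_trans (lee_wpmul2l M'0 (Hc _))).
rewrite -(ge0_integralTZl _ mb b0 M'0); apply: ge0_le_integralT.
- by apply: emeasurable_funM; [exact: measurable_cst|].
- by move=> u; exact: mule_ge0.
- apply: emeasurable_funM; first by mfun.
  apply: (measurableT_comp mf); apply: measurable_scalecV; last by mfun.
  by apply: measurable_invr; apply: measurable_enorm; mfun.
- move=> u; rewrite -!EFinM lee_fin.
  have [u1|u1] := leP (enorm u) 1%R; last first.
    by rewrite /ball_pdf indicE memNset ?mulr0 ?mul0r ?mulr0//= => /(lt_le_trans u1); rewrite ltxx.
  rewrite mulrCA; apply: ler_wpM2l; first exact: ball_pdf_ge0.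
  have [->|u0] := eqVneq u 0%R.
    have -> : dotv (S *m zeta) (0 : V) = 0%R by rewrite -(scale0r (0 : V)) dotvZr mul0r.
    by rewrite expr0n mulr0 sqr_ge0.
  have nu : (0 < (enorm u)^-1)%R by rewrite invr_gt0 lt_neqAle eq_sym enorm_eq0 u0 sqrtr_ge0.
  have pu : (0 < pnorm C u)%R by rewrite (pnorm_gt0 Cpos).
  rewrite (pipZr Cpos) (pnormZ Cpos) (gtr0_norm nu) invfM mulrACA divff ?gt_eqF// mul1r.
  rewrite pipE exprMn mulrC; apply: ler_wpM2l; first exact: sqr_ge0.
  rewrite exprVn lef_pV2 ?posrE ?exprn_gt0//.
  have /andP[_ H] := rayleigh_bounds u (posdef_inv Cpos).
  rewrite (sqr_pnorm Cpos); apply: (le_trans H).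
  rewrite -[leRHS]mulr1; apply: ler_wpM2l; first exact: ltW.
  by rewrite -[leLHS]sqr_sqrtr ?dotvv_ge0// -/(enorm u) expr_le1// sqrtr_ge0.
Qed.

End rate_positive.

(** * Total variation *)

Section gaussian_moment.
Local Open Scope ereal_scope.
Context (R : realType) (d : nat) (C : 'M[R]_d) (Cpos : posdef C) (d0 : (0 < d)%N).
Notation V := 'cV[R]_d.
Notation L := (lebesgue_cV R d).
Local Notation pip := (pip C).
Local Notation pnorm := (pnorm C).

(* Dilating by a costs a factor a^d >= 1/2 in volume and gains 1 - a^2 >= 1/(2d) in the exponent. *)
Let a : R := (1 - (2 * d%:R)^-1)%R.

Let d1 : (1 <= d%:R :> R)%R. Proof. by rewrite (ler_nat R 1 d). Qed.

Let a_gt0 : (0 < a)%R.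
Proof. by have := d1; rewrite subr_gt0 => ?; rewrite invf_lt1; lra. Qed.

Lemma sqr_pnorm_gaussian_pdf (x : V) :
  (pnorm x ^+ 2 * gaussian_pdf C x <= 4 * d%:R * gaussian_pdf C (a *: x))%R.
Proof.
rewrite !gaussian_pdfE pipZl (pipZr Cpos) -!(sqr_pnorm Cpos) mulrA [leRHS]mulrA.
apply: ler_wpM2r; first by rewrite invr_ge0 sqrtr_ge0.
set q := (pnorm x ^+ 2)%R; have q0 : (0 <= q)%R by exact: sqr_ge0.
have -> : (- (a * (a * q)) / 2 = (1 - a * a) * q / 2 + - q / 2)%R by field.
rewrite expRD mulrA; apply: ler_wpM2r; first exact: expR_ge0.
rewrite mulrC -ler_pdivrMr ?mulr_gt0 ?ltr0n// mulrC.
apply: (@le_trans _ _ ((1 - a * a) * q / 2)%R); last first.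
  by rewrite (le_trans _ (expR_ge1Dx _))// lerDr.
have H : ((2 * d%:R)^-1 <= 1 - a * a)%R.
  have -> : (1 - a * a = (2 * d%:R)^-1 * (1 + a))%R by rewrite /a; ring.
  by rewrite ler_peMr ?lerDl ?(ltW a_gt0)// invr_ge0 mulr_ge0.
have -> : ((4 * d%:R)^-1 * q = (2 * d%:R)^-1 * q / 2)%R.
  by field; rewrite gt_eqF// (lt_le_trans _ d1).
by do 2 (apply: ler_wpM2r => //).
Qed.

Lemma gaussian_second_moment : gaussian C setT = 1 ->
  \int[gaussian C]_x (pnorm x ^+ 2)%:E <= (8 * d%:R)%:E.
Proof.
move=> g1.
have mg : measurable_fun [set: V] (fun x => (gaussian_pdf C x)%:E).
  by apply/measurable_EFinP; exact: measurable_gaussian_pdf.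
have g0 x : 0 <= (gaussian_pdf C x)%:E by rewrite lee_fin gaussian_pdf_ge0.
have mq : measurable_fun setT (fun x : V => (pnorm x ^+ 2)%:E).
  by apply/measurable_EFinP; apply: measurable_funX; mfun.
have q0 (x : V) : 0 <= (pnorm x ^+ 2)%:E by rewrite lee_fin sqr_ge0.
have mga : measurable_fun [set: V] (fun x => (gaussian_pdf C (a *: x)%R)%:E).
  by apply: (measurableT_comp mg); apply: measurable_scalecV; mfun.
rewrite ge0_integral_gaussian//.
apply: (@le_trans _ _ (\int[L]_x ((4 * d%:R)%:E * (gaussian_pdf C (a *: x)%R)%:E))).
  apply: ge0_le_integralT.
  - exact: emeasurable_funM.
  - by move=> x; exact: mule_ge0.
  - by apply: emeasurable_funM; [exact: measurable_cst|].
  - by move=> x; rewrite -!EFinM lee_fin mulrC; exact: sqr_pnorm_gaussian_pdf.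
have k0 : 0 <= (4 * d%:R : R)%:E by rewrite lee_fin mulr_ge0.
rewrite (ge0_integralTZl _ mga (fun x => g0 _) k0).
have an : (a != 0)%R by rewrite gt_eqF.
have E : 1 = (`|a| ^+ d)%:E * \int[L]_x (gaussian_pdf C (a *: x)%R)%:E.
  have H := @ge0_integral_lebesgue_cV_affine R d a 0 _ an mg g0.
  rewrite -[LHS]g1; apply: (etrans H); apply: f_equal.
  by apply: eq_integral => x _; rewrite addr0.
have J0 : 0 <= \int[L]_x (gaussian_pdf C (a *: x)%R)%:E by apply: integralT_ge0 => x; exact: g0.
have ad : (2^-1 <= `|a| ^+ d)%R.
  have t0 : (0 <= (2 * d%:R)^-1 :> R)%R by rewrite invr_ge0 mulr_ge0.
  have t1 : ((2 * d%:R)^-1 <= 1 :> R)%R by have := d1; move=> ?; rewrite invf_le1; lra.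
  rewrite gtr0_norm//; apply: (le_trans _ (bernoulli_ineq d t0 t1)).
  rewrite invfM mulrCA divff; last by rewrite gt_eqF// (lt_le_trans _ d1).
  by lra.
have J2 : \int[L]_x (gaussian_pdf C (a *: x)%R)%:E <= (2 : R)%:E.
  have := lee_wpmul2r J0 (_ : (2^-1)%:E <= (`|a| ^+ d)%:E); rewrite lee_fin => /(_ ad).
  rewrite -E; case: (\int[L]_x _) J0 => [r| |] _; rewrite ?leNye//; last by rewrite gt0_muley ?lte_fin.
  by rewrite -EFinM !lee_fin mulrC ler_pdivrMr// mul1r.
apply: (le_trans (lee_wpmul2l k0 J2)).
by rewrite -EFinM lee_fin; lra.
Qed.

Lemma condition_number_ge1 : (1 <= condition_number (invmx C))%R.
Proof.
have m0 := mineig_gt0 d0 (posdef_inv Cpos).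
rewrite /condition_number ler_pdivlMr// mul1r.
pose v : V := delta_mx (Ordinal d0) ord0.
have v1 : dotv v v = 1%R by rewrite dotv_delta mxE !eqxx.
have /andP[H1 H2] := rayleigh_bounds v (posdef_inv Cpos).
by move: (le_trans H1 H2); rewrite v1 !mulr1.
Qed.

Lemma smooth_dim_moment : gaussian C setT = 1 ->
  \int[gaussian C]_x ((smooth_dim C + pnorm x) ^+ 2)%:E <=
    ((6 * (d%:R * condition_number (invmx C))) ^+ 2)%:E.
Proof.
move=> g1; set D := smooth_dim C; set k := condition_number _.
have k1 : (1 <= k)%R by exact: condition_number_ge1.
have mq : measurable_fun setT (fun x : V => (pnorm x ^+ 2)%:E).
  by apply/measurable_EFinP; apply: measurable_funX; mfun.
have q0 (x : V) : 0 <= (pnorm x ^+ 2)%:E by rewrite lee_fin sqr_ge0.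
have m2q : measurable_fun setT (fun x : V => (2 : R)%:E * (pnorm x ^+ 2)%:E).
  by apply: emeasurable_funM; [exact: measurable_cst|].
have twoq0 (x : V) : 0 <= (2 : R)%:E * (pnorm x ^+ 2)%:E by apply: mule_ge0 => //; rewrite lee_fin.
have c0 (x : V) : 0 <= cst (2 * D ^+ 2)%:E x by rewrite lee_fin mulr_ge0// sqr_ge0.
apply: (@le_trans _ _ (\int[gaussian C]_x (cst (2 * D ^+ 2)%:E x + (2 : R)%:E * (pnorm x ^+ 2)%:E))).
  apply: ge0_le_integralT.
  - apply/measurable_EFinP; apply: measurable_funX; apply: measurable_funD; mfun.
  - by move=> x; rewrite lee_fin sqr_ge0.
  - by apply: emeasurable_funD => //; exact: measurable_cst.
  - move=> x; rewrite -EFinM -EFinD lee_fin -subr_ge0.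
    have -> : (2 * D ^+ 2 + 2 * pnorm x ^+ 2 - (D + pnorm x) ^+ 2 = (D - pnorm x) ^+ 2)%R by ring.
    exact: sqr_ge0.
have cE : \int[gaussian C]_x (cst (2 * D ^+ 2)%:E x) = (2 * D ^+ 2)%:E.
  rewrite integral_cst//; transitivity ((2 * D ^+ 2)%:E * 1); last by rewrite mule1.
  by congr (_ * _); exact: g1.
rewrite (ge0_integralTD _ (measurable_cst _) c0 m2q twoq0) cE.
rewrite (ge0_integralTZl _ mq q0); last by rewrite lee_fin.
apply: (@le_trans _ _ ((2 * D ^+ 2)%:E + (2 : R)%:E * (8 * d%:R)%:E)).
  by apply: leeD2l; apply: lee_wpmul2l; [rewrite lee_fin|exact: gaussian_second_moment].
rewrite -EFinM -EFinD lee_fin.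
have rk : (kappa_rt C ^+ 2 = k)%R by rewrite sqr_sqrtr// (le_trans _ k1).
have r1 : (1 <= kappa_rt C)%R by rewrite -sqrtr1 ler_wsqrtr.
have rkk : (kappa_rt C <= k)%R by rewrite -rk expr2 ler_peMl// (le_trans _ r1).
have D3 : (D <= 3 * (d%:R * k))%R.
  have : (1 <= d%:R * k)%R by rewrite -[leLHS]mulr1 ler_pM.
  have : (d%:R * kappa_rt C <= d%:R * k)%R by rewrite ler_wpM2l.
  rewrite /D /smooth_dim; move: (_ * k)%R (_ * kappa_rt C)%R => u v; lra.
have D0 : (0 <= D)%R by rewrite (le_trans _ (smooth_dim_ge2 C)).
have D9 : (D ^+ 2 <= (3 * (d%:R * k)) ^+ 2)%R.
  by rewrite ler_pXn2r// nnegrE// (le_trans D0).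
have dk : (d%:R <= (d%:R * k) ^+ 2)%R.
  have H : (d%:R <= d%:R * k)%R by rewrite ler_peMr.
  by rewrite expr2 (le_trans H)// ler_peMl ?(le_trans _ H)// (le_trans d1).
move: D9 dk; move: (d%:R * k)%R (D ^+ 2)%R => w u.
have -> : ((3 * w) ^+ 2 = 9 * w ^+ 2)%R by ring.
have -> : ((6 * w) ^+ 2 = 36 * w ^+ 2)%R by ring.
by have := d1; move: (w ^+ 2)%R => ww ? D9 dk; lra.
Qed.

End gaussian_moment.

Section coupling_integrals.
Local Open Scope ereal_scope.
Context d (T : measurableType d) (R : realType).

Lemma ge0_integral_marginal (p : probability (T * T)%type R) (m : {measure set T -> \bar R})
    (phi : T * T -> T) (f : T -> \bar R) :
  measurable_fun setT phi -> (forall A, measurable A -> p (phi @^-1` A) = m A) ->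
  measurable_fun setT f -> (forall x, 0 <= f x) ->
  \int[m]_x f x = \int[p]_z f (phi z).
Proof.
move=> mphi pm mf f0.
have E := @ge0_integral_pushforward _ _ _ _ R phi mphi p setT f measurableT mf (fun y _ => f0 y).
rewrite preimage_setT in E; rewrite -[RHS]E.
by apply: eq_measure_integral => A mA _; rewrite -pm.
Qed.

End coupling_integrals.

Section total_variation.
Local Open Scope ereal_scope.
Context (R : realType) (d : nat) (C : 'M[R]_d) (Cpos : posdef C) (d0 : (0 < d)%N).
Notation V := 'cV[R]_d.
Local Notation pnorm := (pnorm C).
Implicit Types (nu : probability V R) (A : set V).

Lemma iter_hr_op_ge0 n (f : V -> \bar R) x : (forall y, 0 <= f y) -> 0 <= iter n (hr_op C) f x.
Proof. exact: (@iter_kernel_op_ge0 _ _ _ (hit_and_run_kernel C)). Qed.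

Lemma measurable_iter_hr_op n (f : V -> \bar R) : measurable_fun setT f ->
  (forall y, 0 <= f y) -> measurable_fun setT (iter n (hr_op C) f).
Proof. exact: (@measurable_iter_kernel_op _ _ _ (hit_and_run_kernel C)). Qed.

Lemma gaussian_invariant_iter n (f : V -> \bar R) : measurable_fun setT f ->
  (forall y, 0 <= f y) -> \int[gaussian C]_x iter n (hr_op C) f x = \int[gaussian C]_x f x.
Proof.
move=> mf f0; elim: n => // n IH; rewrite -IH /=; apply: (gaussian_invariant Cpos d0).
- exact: measurable_iter_hr_op.
- by move=> x; exact: iter_hr_op_ge0.
Qed.

Lemma coupling_gaussianT nu (p : probability (V * V)%type R) :
  coupling (gaussian C) nu p -> gaussian C setT = 1.
Proof.
move=> cp; have [<- _] := cp setT measurableT.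
rewrite preimage_setT; exact: probability_setT.
Qed.

(* The two-step smoothing bound, relaxed by [2ab <= theta a^2 + b^2 / theta] so that it is
   propagated by the contraction. *)
Lemma hr_op2_quadratic_smoothing K theta : (0 <= K)%R -> (0 < theta)%R ->
  (forall m : R, \int[lebesgue_measure]_t
     ((psi t)%:E * ((1 + `|t|) * (1 + isqrt (t - m)))%:E) <= K%:E) ->
  forall (f : V -> \bar R) x delta, measurable_fun setT f ->
  (forall y, 0 <= f y) -> (forall y, f y <= 1) ->
  hr_op C (hr_op C f) x <= hr_op C (hr_op C f) (x + delta)%R +
    (3 * K ^+ 2 * theta * (smooth_dim C + pnorm x) ^+ 2)%:E +
    (3 * K ^+ 2 / theta * pnorm delta ^+ 2)%:E.
Proof.
move=> K0 t0 HK f x delta mf f0 f1.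
apply: (le_trans (hr_op2_smoothing Cpos d0 K0 HK x delta mf f0 f1)).
rewrite -[leRHS]addeA; apply: leeD2l; rewrite -EFinD lee_fin.
move: (smooth_dim C + pnorm x)%R (pnorm delta) => a b; rewrite -subr_ge0.
have -> : (3 * K ^+ 2 * theta * a ^+ 2 + 3 * K ^+ 2 / theta * b ^+ 2 - 6 * K ^+ 2 * a * b =
    3 * K ^+ 2 / theta * (theta * a - b) ^+ 2)%R by field; rewrite gt_eqF.
apply: mulr_ge0; last exact: sqr_ge0.
by apply: divr_ge0; [apply: mulr_ge0 => //; exact: sqr_ge0|exact: ltW].
Qed.

Lemma integral_gaussian_le_law K theta q n nu (p : probability (V * V)%type R) (f : V -> \bar R) :
  (0 <= K)%R -> (0 < theta)%R ->
  (forall m : R, \int[lebesgue_measure]_t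
     ((psi t)%:E * ((1 + `|t|) * (1 + isqrt (t - m)))%:E) <= K%:E) ->
  coupling (gaussian C) nu p ->
  \int[p]_z (pnorm (z.1 - z.2) ^+ 2)%:E <= q%:E ->
  measurable_fun setT f -> (forall y, 0 <= f y) -> (forall y, f y <= 1) ->
  \int[gaussian C]_x f x <= \int[kernel_law (hit_and_run_kernel C) n.+2 nu]_x f x +
    (3 * K ^+ 2 * (theta * (6 * (d%:R * condition_number (invmx C))) ^+ 2 +
       (1 - 2 * hr_rate C) ^+ n * q / theta))%:E.
Proof.
move=> K0 t0 HK cp Hq mf f0 f1.
have g1 := coupling_gaussianT cp.
set u := hr_op C (hr_op C f).
have mu : measurable_fun setT u.
  by apply: measurable_hr_op; [exact: measurable_hr_op|move=> y; exact: hr_op_ge0].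
have u0 y : 0 <= u y by apply: hr_op_ge0 => z; exact: hr_op_ge0.
set a := (3 * K ^+ 2)%R.
have a0 : (0 <= a)%R by apply: mulr_ge0 => //; exact: sqr_ge0.
pose W0 (x : V) := ((smooth_dim C + pnorm x) ^+ 2)%:E.
have mW0 : measurable_fun setT W0.
  by apply/measurable_EFinP; apply: measurable_funX; apply: measurable_funD; mfun.
have W00 x : 0 <= W0 x by rewrite lee_fin sqr_ge0.
pose W (x : V) := (a * theta)%:E * W0 x.
have at0 : 0 <= (a * theta)%:E by rewrite lee_fin; apply: mulr_ge0 => //; exact: ltW.
have mW : measurable_fun setT W by apply: emeasurable_funM => //; exact: measurable_cst.
have W0' x : 0 <= W x by exact: mule_ge0.
have b0 : (0 <= a / theta)%R by apply: divr_ge0 => //; exact: ltW.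
have H x delta : u x <= u (x + delta)%R + W x + (a / theta * pnorm delta ^+ 2)%:E.
  by have := hr_op2_quadratic_smoothing K0 t0 HK x delta mf f0 f1.
have I := iter_hr_op_contraction Cpos n d0 b0 mu u0 mW W0' H.
set r := (1 - 2 * hr_rate C)%R in I *.
have uE : iter n (hr_op C) u = iter n.+2 (hr_op C) f by rewrite !iterSr.
pose Pf := iter n.+2 (hr_op C) f.
have mP : measurable_fun setT Pf by exact: measurable_iter_hr_op.
have P0 x : 0 <= Pf x by exact: iter_hr_op_ge0.
pose PW := iter n (hr_op C) W.
have mPW : measurable_fun setT PW by exact: measurable_iter_hr_op.
have PW0 x : 0 <= PW x by exact: iter_hr_op_ge0.
have pf A : measurable A -> p (fst @^-1` A) = gaussian C A by move=> /cp[].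
have ps A : measurable A -> p (snd @^-1` A) = nu A by move=> /cp[].
rewrite (ge0_integral_kernel_law _ _ _ mf f0) -[iter _ _ _]/Pf.
rewrite -(gaussian_invariant_iter n.+2 mf f0) -[iter _ _ _]/Pf.
rewrite (ge0_integral_marginal measurable_fst pf mP P0).
rewrite (ge0_integral_marginal measurable_snd ps mP P0).
pose e := (a / theta * r ^+ n)%R.
have e0 : 0 <= e%:E.
  by rewrite lee_fin; apply: mulr_ge0 => //; apply: exprn_ge0; rewrite subr_ge0 hr_rate_le.
have mq : measurable_fun setT (fun z : V * V => (pnorm (z.1 - z.2) ^+ 2)%:E).
  apply/measurable_EFinP; apply: measurable_funX; apply: measurable_fun_pnorm.
  by apply: measurable_subcV; mfun.
have q0 (z : V * V) : 0 <= (pnorm (z.1 - z.2) ^+ 2)%:E by rewrite lee_fin sqr_ge0.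
have m1 : measurable_fun setT (fun z : V * V => Pf z.2) by exact: (measurableT_comp mP measurable_snd).
have m2 : measurable_fun setT (fun z : V * V => PW z.1) by exact: (measurableT_comp mPW measurable_fst).
have m3 : measurable_fun setT (fun z : V * V => e%:E * (pnorm (z.1 - z.2) ^+ 2)%:E).
  by apply: emeasurable_funM => //; exact: measurable_cst.
have q0' (z : V * V) : 0 <= e%:E * (pnorm (z.1 - z.2) ^+ 2)%:E by exact: mule_ge0.
apply: (@le_trans _ _ (\int[p]_z (Pf z.2 + PW z.1 + e%:E * (pnorm (z.1 - z.2) ^+ 2)%:E))).
  apply: ge0_le_integralT.
  - exact: (measurableT_comp mP measurable_fst).
  - by move=> z; exact: P0.
  - exact: (emeasurable_funD (emeasurable_funD m1 m2) m3).
  - move=> [z1 z2] /=; have := I z1 (z2 - z1)%R; rewrite uE.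
    have -> : (z1 + (z2 - z1) = z2)%R by rewrite addrC subrK.
    by have -> : pnorm (z2 - z1)%R = pnorm (z1 - z2)%R by rewrite -(pnormN Cpos) opprB.
rewrite (ge0_integralTD _ (emeasurable_funD m1 m2) (fun z => adde_ge0 (P0 _) (PW0 _)) m3 q0').
rewrite (ge0_integralTD _ m1 (fun z => P0 _) m2 (fun z => PW0 _)) -addeA.
apply: leeD2l; rewrite (ge0_integralTZl _ mq q0 e0).
rewrite -(ge0_integral_marginal measurable_fst pf mPW PW0).
rewrite /PW (gaussian_invariant_iter n mW W0') (ge0_integralTZl _ mW0 W00 at0).
apply: (le_trans (leeD (lee_wpmul2l at0 (smooth_dim_moment Cpos d0 g1)) (lee_wpmul2l e0 Hq))).
rewrite -!EFinM -EFinD lee_fin /e le_eqVlt; apply/orP; left; apply/eqP.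
by field; rewrite gt_eqF.
Qed.

End total_variation.

Section mixing_bound.
Local Open Scope ereal_scope.
Context (R : realType) (d : nat) (C : 'M[R]_d) (Cpos : posdef C) (d0 : (0 < d)%N).
Notation V := 'cV[R]_d.
Local Notation pnorm := (pnorm C).

Lemma tv_dist_le_two_sided dT (T : measurableType dT) (mu nu : {measure set T -> \bar R}) (e : R) :
  mu setT = 1 -> nu setT = 1 ->
  (forall A, measurable A -> nu A <= mu A + e%:E) -> tv_dist mu nu <= e%:E.
Proof.
move=> mu1 nu1 H; apply: ge_ereal_sup => _ [A mA <-].
have le1 (m : {measure set T -> \bar R}) : m setT = 1 -> forall B, measurable B -> m B <= 1.
  move=> m1 B mB; rewrite -m1.
  by apply: (le_measure m (mem_set mB) (mem_set measurableT)).
have finm (m : {measure set T -> \bar R}) B : m setT = 1 -> measurable B -> m B \is a fin_num.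
  by move=> m1 mB; rewrite ge0_fin_numE ?measure_ge0// (le_lt_trans (le1 _ m1 _ mB))// ltry.
have compl (m : {measure set T -> \bar R}) : m setT = 1 -> m (~` A) = 1 - m A.
  move=> m1; have E : m (~` A) + m A = 1.
    by rewrite -m1 -measureU ?setvU ?setICl//; exact: measurableC.
  by rewrite -E addeK// finm.
have := H _ mA; have := H _ (measurableC mA); rewrite !compl//.
rewrite -(fineK (finm _ A mu1 mA)) -(fineK (finm _ A nu1 mA)).
rewrite -!EFinB -!EFinD !lee_fin => H1 H2.
rewrite ler_norml; apply/andP; split; lra.
Qed.

Lemma coupling_cost_lt (nu : probability V R) (delta : R) :
  wasserstein2 (sqrtmx (invmx C)) (gaussian C) nu < delta%:E ->
  exists2 p : probability (V * V)%type R, coupling (gaussian C) nu p &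
    \int[p]_z (pnorm (z.1 - z.2) ^+ 2)%:E <= (delta ^+ 2)%:E.
Proof.
move=> /ereal_inf_lt[_ [p cp <-]] H; exists p => //; move: H.
have : 0 <= \int[p]_z (pnorm (z.1 - z.2) ^+ 2)%:E.
  by apply: integralT_ge0 => z; rewrite lee_fin sqr_ge0.
rewrite /pnorm; case: (\int[p]_z _) => [q| |]//; last by rewrite poweRyr.
rewrite lee_fin => q0; rewrite poweR_EFin lte_fin powR12_sqrt// lee_fin => H.
by rewrite -(sqr_sqrtr q0) ler_pXn2r ?ltW// nnegrE ?sqrtr_ge0// (le_trans _ (ltW H))// sqrtr_ge0.
Qed.

Lemma mixing_time_le_nat (nu : probability V R) (eps : R) n :
  tv_dist (kernel_law (hit_and_run_kernel C) n nu) (gaussian C) <= eps%:E ->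
  mixing_time C eps nu <= n%:R%:E.
Proof. by move=> H; apply: ereal_inf_lbound; exists n. Qed.

Lemma tv_dist_hit_and_run K (nu : probability V R) (eps delta : R) n :
  (0 < K)%R -> (0 < eps)%R -> (0 < delta)%R ->
  (forall m : R, \int[lebesgue_measure]_t
     ((psi t)%:E * ((1 + `|t|) * (1 + isqrt (t - m)))%:E) <= K%:E) ->
  wasserstein2 (sqrtmx (invmx C)) (gaussian C) nu < delta%:E ->
  (expR (- hr_rate C * n%:R) * delta * (36 * K ^+ 2 * (d%:R * condition_number (invmx C))) <= eps)%R ->
  tv_dist (kernel_law (hit_and_run_kernel C) n.+2 nu) (gaussian C) <= eps%:E.
Proof.
move=> K0 e0 delta0 HK /coupling_cost_lt[p cp Hq] small.
set k := condition_number (invmx C) in small *.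
have k0 : (0 < k)%R by exact: lt_le_trans (condition_number_ge1 Cpos d0).
have s0 : (0 < d%:R * k)%R by rewrite mulr_gt0 ?ltr0n.
set s := (d%:R * k)%R in small s0.
(* theta makes the moment term equal to eps / 2. *)
pose theta := (eps / (6 * K ^+ 2 * (6 * s) ^+ 2))%R.
have K20 : (0 < K ^+ 2)%R by rewrite exprn_gt0.
have t0 : (0 < theta)%R.
  apply: divr_gt0 => //; apply: mulr_gt0; first exact: mulr_gt0.
  by apply: exprn_gt0; exact: mulr_gt0.
have g1 := coupling_gaussianT cp.
have kl1 : kernel_law (hit_and_run_kernel C) n.+2 nu setT = 1 by exact: probability_setT.
apply: tv_dist_le_two_sided => // A mA.
have mI : measurable_fun setT (fun x : V => (\1_A x)%:E : \bar R).
  by apply/measurable_EFinP; exact: measurable_indic.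
have I0 (x : V) : 0 <= (\1_A x)%:E :> \bar R by rewrite lee_fin.
have I1 (x : V) : (\1_A x)%:E <= 1 :> \bar R by rewrite lee_fin indicE; case: (_ \in _).
have := integral_gaussian_le_law Cpos d0 n (ltW K0) t0 HK cp Hq mI I0 I1.
rewrite !integral_indic// !setIT => /le_trans; apply; apply: leeD2l; rewrite lee_fin.
rewrite -/k -/s; set r := (1 - 2 * hr_rate C)%R.
have r0 : (0 <= r)%R by rewrite subr_ge0 hr_rate_le.
have rE : (r ^+ n <= expR (- hr_rate C * n%:R) ^+ 2)%R.
  have r2 : (r <= expR (- hr_rate C) ^+ 2)%R.
    rewrite -expRM_natr; apply: (le_trans _ (expR_ge1Dx _)); rewrite /r; lra.
  by rewrite expRM_natr exprAC; apply: lerXn2r => //; rewrite nnegrE exprn_ge0// expR_ge0.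
move: rE small; move: (expR _) (expR_ge0 (- hr_rate C * n%:R)) => E E0 rE small.
have E1 : ((36 * K ^+ 2 * s) ^+ 2 * (r ^+ n * delta ^+ 2) <= eps ^+ 2)%R.
  apply: (@le_trans _ _ ((E * delta * (36 * K ^+ 2 * s)) ^+ 2)%R).
    move: (36 * K ^+ 2 * s)%R => X.
    have -> : ((E * delta * X) ^+ 2 = X ^+ 2 * (E ^+ 2 * delta ^+ 2))%R by ring.
    apply: ler_wpM2l; first exact: sqr_ge0.
    by apply: ler_wpM2r => //; exact: sqr_ge0.
  have X0 : (0 <= 36 * K ^+ 2 * s)%R.
    by apply: mulr_ge0; [apply: mulr_ge0 => //; exact: ltW|exact: ltW].
  have Y0 : (0 <= E * delta * (36 * K ^+ 2 * s))%R.
    by apply: mulr_ge0 => //; apply: mulr_ge0 => //; exact: ltW.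
  by apply: lerXn2r => //; rewrite nnegrE; exact: ltW.
have -> : (3 * K ^+ 2 * (theta * (6 * s) ^+ 2 + r ^+ n * delta ^+ 2 / theta) =
    eps / 2 + (36 * K ^+ 2 * s) ^+ 2 * (r ^+ n * delta ^+ 2) / eps / 2)%R.
  by rewrite /theta; field; rewrite !gt_eqF.
move: E1; move: ((36 * K ^+ 2 * s) ^+ 2 * (r ^+ n * delta ^+ 2))%R => y E1.
have : (y / eps <= eps)%R by rewrite ler_pdivrMr// -expr2.
by move: (y / eps)%R => z; lra.
Qed.

End mixing_bound.

Lemma maxe1_lne (R : realType) (u : R) : (0 <= u)%R -> exists2 l : R,
  (1 <= l) /\ (u <= expR l) & (maxe 1 (lne u%:E) = l%:E)%E.
Proof.
move=> u0; exists (Num.max 1 (ln u))%R; last first.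
  rewrite /lne; case: ifPn => [ule|u1].
    by rewrite ln0// EFin_max [LHS]max_l ?leNye// [RHS]max_l ?lee_fin.
  by rewrite EFin_max.
split; first by rewrite le_max lexx.
have [->|un] := eqVneq u 0%R; first exact: expR_ge0.
have up : (0 < u)%R by rewrite lt_neqAle eq_sym un.
by rewrite -[leLHS]lnK ?posrE// ler_expR le_max lexx orbT.
Qed.

Theorem theorem2 (R : realType) :
  exists K K' : R, 0 < K /\ 0 < K' /\
    forall (d : nat) (C : 'M[R]_d) (nu : probability 'cV[R]_d R) (eps : R),
      (0 < d)%N -> posdef C -> 0 < eps ->
      (mixing_time C eps nu <=
        (K * (hr_rate C)^-1)%:E *
        maxe 1 (lne ((K' * Num.max (condition_number (invmx C))
                             (Num.max (maxeig (invmx C)) (mineig (invmx C))^-1)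
                         * d%:R * eps^-1)%:E *
                     wasserstein2 (sqrtmx (invmx C)) (gaussian C) nu)))%E.
Proof.
have [k k0 Hk] := integral_psi_isqrt R.
pose a : R := k + 1.
have a0 : 0 < a by rewrite /a; lra.
have Ha (m : R) : (\int[lebesgue_measure]_t
    ((psi t)%:E * ((1 + `|t|) * (1 + isqrt (t - m)))%:E) <= a%:E)%E.
  by apply: (le_trans (Hk m)); rewrite lee_fin lerDl.
exists 3, (72 * a ^+ 2); split => //; split; first by rewrite mulr_gt0// exprn_gt0.
move=> d C nu eps d0 Cpos e0.
have rho0 := hr_rate_gt0 d0 Cpos; have rho1 := hr_rate_le Cpos d0.
set rho := hr_rate C in rho0 rho1 *.
set mx := Num.max _ _.
have mx1 : 1 <= mx by rewrite le_max (condition_number_ge1 Cpos d0).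
have kmx : condition_number (invmx C) <= mx by rewrite le_max lexx.
set c := 72 * a ^+ 2 * mx * d%:R * eps^-1.
have a20 : 0 < a ^+ 2 by rewrite exprn_gt0.
have mx0 : 0 < mx by exact: lt_le_trans mx1.
have dR0 : 0 < d%:R :> R by rewrite ltr0n.
have c0 : 0 < c.
  by apply: divr_gt0 => //; apply: mulr_gt0 => //; apply: mulr_gt0 => //; exact: mulr_gt0.
have coef0 : 0 < 3 * rho^-1 by rewrite mulr_gt0// invr_gt0.
have W0 : (0 <= wasserstein2 (sqrtmx (invmx C)) (gaussian C) nu)%E.
  by apply: le_ereal_inf_tmp => _ [p _ <-]; exact: poweR_ge0.
case WE : (wasserstein2 _ _ _) W0 => [w| |]; last 2 first.
- by move=> _; rewrite gt0_muley ?lte_fin//= maxey gt0_muley ?lte_fin// leey.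
- by rewrite leeNy_eq.
rewrite lee_fin => w0; rewrite -EFinM.
have [l [l1 ul] ->] := maxe1_lne (mulr_ge0 (ltW c0) w0).
rewrite -EFinM.
pose j := (Num.trunc (l / rho)).+1.
have lr0 : 0 <= l / rho by rewrite divr_ge0 ?(ltW rho0)// (le_trans _ l1).
have jl : l / rho < j%:R by exact: truncnS_gt.
have ju : j%:R <= l / rho + 1.
  by rewrite /j -natr1 lerD2r truncn_le.
pose delta := expR l * 2 / c.
have El := expR_gt0 l.
have delta0 : 0 < delta by rewrite divr_gt0// mulr_gt0.
apply: (le_trans (y := (j.+2)%:R%:E)).
  apply: mixing_time_le_nat; apply: (tv_dist_hit_and_run Cpos d0 a0 e0 delta0 Ha).
    rewrite WE lte_fin /delta ltr_pdivlMr// mulrC.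
    apply: (le_lt_trans ul); rewrite ltr_pMr; [lra|exact: El].
  rewrite -/rho.
  have E1 : expR (- rho * j%:R) * expR l <= 1.
    rewrite -expRD expR_le1.
    move: jl; rewrite ltr_pdivrMr// => jl; rewrite mulNr (mulrC rho); lra.
  have -> : expR (- rho * j%:R) * delta * (36 * a ^+ 2 * (d%:R * condition_number (invmx C))) =
      (expR (- rho * j%:R) * expR l) * (condition_number (invmx C) / mx) * eps.
    rewrite /delta /c; field.
    by rewrite !gt_eqF.
  rewrite -[leRHS]mul1r; apply: ler_wpM2r; first exact: ltW.
  have k0' : 0 <= condition_number (invmx C) / mx.
    by rewrite divr_ge0 ?(ltW mx0)// (le_trans _ (condition_number_ge1 Cpos d0)).
  have k1' : condition_number (invmx C) / mx <= 1 by rewrite ler_pdivrMr// mul1r.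
  have E0 : 0 <= expR (- rho * j%:R) * expR l by apply: mulr_ge0; exact: expR_ge0.
  by rewrite -[leRHS]mul1r; apply: ler_pM.
rewrite lee_fin -addn2 natrD.
have l2 : 2 <= l / rho.
  by rewrite ler_pdivlMr// (le_trans _ l1).
have -> : 3 * rho^-1 * l = 3 * (l / rho) by rewrite -mulrA (mulrC _ l).
move: ju l2; move: (l / rho) => t; lra.
Qed.
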